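(* Let $G$ be a connected reductive group over $F$ and $\mu$ a cocharacter of $G_{\overline F}$. Let $x\in\mathrm{Gr}_{G,\mu}(C)$ and assume that one of the following holds: (1) $x\in G(C)\mu(\xi^{-1})G(B_{\mathrm{dR}}^+)/G(B_{\mathrm{dR}}^+)$ for some section $C\to B_{\mathrm{dR}}^+(C)$ of the reduction map (used to view $G(C)$ as a subset of $G(B_{\mathrm{dR}}^+)$), or (2) $\mu$ is minuscule. Then the Harder--Narasimhan vector $\mathrm{HN}(\mathcal{E}_1,x)$ equals the Harder--Narasimhan vector, in the sense of Dat--Orlik--Rapoport, of $(D,\mathrm{BB}_\mu(x))$, where $D$ is the $G$-isocrystal associated with $1\in G(\breve F)$. Furthermore, the two Harder--Narasimhan filtrations correspond to the same parabolic subgroup of $G$.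
   Context: $F$ is a finite extension of $\mathbb{Q}_p$, $\overline F$ an algebraic closure, $\Gamma=\mathrm{Gal}(\overline F|F)$, $\breve F$ the completion of the maximal unramified extension. $C$ is a complete algebraically closed field containing $\overline F$; $B_{\mathrm{dR}}^+=B_{\mathrm{dR}}^+(C)\supset\overline F$ with uniformizer $\xi$ and residue field $C$, $B_{\mathrm{dR}}=B_{\mathrm{dR}}^+[\xi^{-1}]$. $\mathrm{Gr}_G$ is the $B_{\mathrm{dR}}^+$-Grassmannian, $\mathrm{Gr}_{G,\mu}(C)=G(B_{\mathrm{dR}}^+)\mu(\xi)^{-1}G(B_{\mathrm{dR}}^+)/G(B_{\mathrm{dR}}^+)$. $\mathcal{E}_1$ is the trivial $G$-bundle on the Fargues--Fontaine curve over $C^\flat$. Harder--Narasimhan vector of $(\mathcal{E}_1,x)$. For a finite-dimensional $F$-vector space $V$ and a lattice $\Lambda\subset V\otimes_FB_{\mathrm{dR}}$ put $\mathrm{rk}=\dim V$, $\deg(V,\Lambda)=-\mathrm{val}_\xi\det g$ if $\Lambda=g(V\otimes B_{\mathrm{dR}}^+)$. Subobjects are $F$-subspaces $W$ with lattice $\Lambda\cap W_{B_{\mathrm{dR}}}$, quotients carry the image lattice; the Harder--Narasimhan filtration is the unique flag of $F$-subspaces with semistable (w.r.t. $\deg/\mathrm{rk}$) subquotients of strictly decreasing slopes, indexed by $\mathbb{Q}$ via $V^{\geq\lambda}$ (largest step with all graded slopes $\geq\lambda$). For $x\in\mathrm{Gr}_G(C)$ the filtrations of $(V,\rho(x)(V\otimes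 B_{\mathrm{dR}}^+))$, $(V,\rho)\in\mathrm{Rep}_FG$, form a tensor-compatible exact filtration of the standard fibre functor; its group of tensor automorphisms is a parabolic subgroup of $G$ over $F$, the parabolic subgroup corresponding to the filtration, and $\mathrm{HN}(\mathcal{E}_1,x)$ is the rational cocharacter, central in a Levi, splitting it. Bialynicki-Birula map. $P_\mu\subseteq G_C$ is the parabolic on whose Lie algebra $\mu$ has weights $\geq0$, $\mathcal{F}\ell(G,\mu)$ is the flag variety with $\mathcal{F}\ell(G,\mu)(C)=G(C)/P_\mu(C)$. For $x=g\mu(\xi^{-1})G(B_{\mathrm{dR}}^+)$ with $g\in G(B_{\mathrm{dR}}^+)$ and reduction $\bar g\in G(C)$, $\mathrm{BB}_\mu(x)=\bar gP_\mu(C)$. A point $\bar gP_\mu(C)$ gives, for each $(V,\rho)\in\mathrm{Rep}_FG$, the decreasing filtration on $V\otimes_FC$ with $i$-th step $\rho(\bar g)\bigl(\bigoplus_{j\geq i}V_{C,j}\bigr)$, where $V_{C,j}$ is the weight-$j$ space of $\rho\circ\mu$. Dat--Orlik--Rapoport Harder--Narasimhan vector. For the trivial isocrystal $(V\otimes_F\breve F,\mathrm{id}\otimes\sigma)$ with a filtration $\mathcal F^\bullet$ on $V\otimes_FC$, subobjects are sub-isocrystals, i.e. $F$-subspaces $W\subseteq V$, with induced filtration $\mathcal F^\bullet\cap W_C$; $\mathrm{rk}=\dim W$ and $\deg=\sum_i i\dim\mathrm{gr}^i(\mathcal F^\bullet\cap W_C)$; quotients carry the quotient filtration. The resulting Harder--Narasimhan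 filtrations for all $(V,\rho)\in\mathrm{Rep}_FG$ again form a tensor-compatible exact filtration of the standard fibre functor, and the associated parabolic subgroup of $G$ and splitting rational cocharacter are the Harder--Narasimhan parabolic and Harder--Narasimhan vector of $(D,\mathrm{BB}_\mu(x))$. *)

(* Defs.v *)
From mathcomp Require Export all_boot all_order all_algebra.
From mathcomp Require Export fieldext.
From mathcomp Require Export boolp classical_sets fsbigop reals.
From mathcomp.multinomials Require Export mpoly.

Set Implicit Arguments.
Unset Strict Implicit.
Unset Printing Implicit Defensive.

Import Order.TTheory GRing.Theory Num.Theory.

Global Open Scope classical_set_scope.
Global Open Scope ring_scope.

Record nonarch_abs (R : realType) (K : fieldType) (a : K -> R) : Prop :=
  NonarchAbs {
    abs_ge0 : forall x, 0 <= a x;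
    abs_eq0 : forall x, (a x = 0) <-> (x = 0);
    abs_mul : forall x y, a (x * y) = a x * a y;
    abs_ultra : forall x y, a (x + y) <= Num.max (a x) (a y) }.

Definition abs_lim (R : realType) (K : fieldType) (a : K -> R)
    (u : nat -> K) (l : K) : Prop :=
  forall e : R, 0 < e ->
    exists N : nat, forall m : nat, (N <= m)%N -> a (u m - l) < e.

Definition abs_complete (R : realType) (K : fieldType) (a : K -> R) : Prop :=
  forall u : nat -> K,
    (forall e : R, 0 < e -> exists N : nat, forall m q : nat,
       (N <= m)%N -> (N <= q)%N -> a (u m - u q) < e) ->
    exists l, abs_lim a u l.

(* [Q_p] is the completion of [rat] for the [p]-adic absolute value:
   [abs_Qp_p] forces [a] to restrict to that absolute value on [rat]
   (Ostrowski), and in particular forces characteristic 0. *)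
Record is_Qp (R : realType) (p : nat) (Qp : fieldType) (a : Qp -> R) : Prop :=
  IsQp {
    Qp_abs : nonarch_abs a;
    abs_Qp_p : a p%:R = p%:R^-1;
    Qp_complete : abs_complete a;
    Qp_dense : forall (x : Qp) (e : R), 0 < e ->
      exists q : rat, a (x - ratr q) < e }.

Definition adic_complete (A : comNzRingType) (r : A) : Prop :=
  (forall a : A, (forall m : nat, exists b, a = r ^+ m * b) -> a = 0) /\
  (forall u : nat -> A,
     (forall m : nat, exists b, u m.+1 - u m = r ^+ m * b) ->
     exists l, forall m : nat, exists b, l - u m = r ^+ m * b).

Definition ideal_pow (A : comNzRingType) (I : set A) (m : nat) : set A :=
  [set a | exists (k : nat) (r : 'I_k -> A) (f : 'I_k -> 'I_m -> A),
     (forall l q, I (f l q)) /\ a = \sum_l r l * \prod_q f l q].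

(* Elements of the tilt of [O_C], as [p]-power compatible sequences in [O_C];
   multiplication is termwise and addition is [tilt_add]. *)
Definition tilt (R : realType) (p : nat) (C : fieldType) (a : C -> R)
    (x : nat -> C) : Prop :=
  (forall m : nat, x m.+1 ^+ p = x m) /\ a (x 0%N) <= 1.

Definition tilt_add (R : realType) (p : nat) (C : fieldType) (a : C -> R)
    (x y z : nat -> C) : Prop :=
  forall m : nat,
    abs_lim a (fun k => (x (m + k)%N + y (m + k)%N) ^+ (p ^ k)) (z m).

(* [A] is the ring of Witt vectors of the tilt of [O_C], characterized as the
   strict [p]-ring with that (perfect) residue ring; [T] is the Teichmueller
   map, only meaningful on [tilt] sequences, and [theta] is Fontaine's map. *)
Record is_Ainf (R : realType) (p : nat) (C : fieldType) (a : C -> R)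
    (A : comNzRingType) (T : (nat -> C) -> A)
    (theta : {rmorphism A -> C}) : Prop := IsAinf {
  Ainf_torsion_free : forall x : A, p%:R * x = 0 -> x = 0;
  Ainf_complete : adic_complete (p%:R : A);
  teich1 : T (fun=> 1) = 1;
  teichM : forall x y, tilt p a x -> tilt p a y ->
    T (fun m => x m * y m) = T x * T y;
  teichD : forall x y z, tilt p a x -> tilt p a y -> tilt p a z ->
    tilt_add p a x y z -> exists b, T x + T y = T z + p%:R * b;
  teich_surj : forall y : A,
    exists x, tilt p a x /\ exists b, y = T x + p%:R * b;
  teich_inj : forall x y, tilt p a x -> tilt p a y ->
    (exists b, T x - T y = p%:R * b) -> x = y;
  theta_bounded : forall y : A, a (theta y) <= 1;
  theta_teich : forall x, tilt p a x -> theta (T x) = x 0%N }.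

(* [Bp] is the completion of [A[1/p]] along the kernel [J] of [theta], with
   uniformizer [xi] and residue map [th].  The last two fields say that
   [A[1/p] / J^m -> Bp / xi^m] is bijective, denominators [p^k] cleared. *)
Record is_BdRplus (p : nat) (C : fieldType) (A : comNzRingType)
    (theta : {rmorphism A -> C}) (Bp : idomainType)
    (io : {rmorphism A -> Bp}) (th : {rmorphism Bp -> C}) (xi : Bp) : Prop :=
  IsBdRplus {
    BdRplus_p_unit : (p%:R : Bp) \is a GRing.unit;
    BdRplus_theta : forall y, th (io y) = theta y;
    residue_surj : forall c : C, exists b, th b = c;
    xi_neq0 : xi != 0;
    residue_ker : forall b, (th b = 0) <-> (exists c, b = xi * c);
    BdRplus_complete : adic_complete xi;
    BdRplus_dense : forall (m : nat) (b : Bp),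
      exists (k : nat) (y : A) (c : Bp), p%:R ^+ k * b = io y + xi ^+ m * c;
    BdRplus_ker : forall (m : nat) (y : A),
      (exists c, io y = xi ^+ m * c) <->
      (exists k : nat,
         ideal_pow [set z | theta z = 0] m (p%:R ^+ k * y)) }.

Definition is_BdR (Bp : idomainType) (xi : Bp) (B : fieldType)
    (j : {rmorphism Bp -> B}) : Prop :=
  injective j /\ forall b : B, exists (m : nat) (c : Bp), b * j xi ^+ m = j c.

Definition val_xi (Bp : idomainType) (xi : Bp) (B : fieldType) (j : Bp -> B)
    (b : B) : int :=
  xget 0 [set i : int | exists2 u, u \is a GRing.unit & b = j u * j xi ^ i].

(* Everything below uses the functor of points on commutative [k]-algebras,
   an algebra being a ring [R] with a map [f : k -> R]. *)

Definition zero_locus (k : fieldType) (n : nat) (S : set {mpoly k[n * n]})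
    (R : comUnitRingType) (f : k -> R) (g : 'M[R]_n) : Prop :=
  g \in unitmx /\ forall q, S q -> mmap f (fun l => mxvec g 0 l) q = 0.

(* A closed subgroup scheme of [GL_n]; every affine group scheme of finite
   type over [k] is of this form. *)
Record linear_group (k : fieldType) (n : nat) := LinearGroup {
  equations : set {mpoly k[n * n]};
  points_1 : forall (R : comUnitRingType) (f : {rmorphism k -> R}),
    zero_locus equations f 1%:M;
  points_mul : forall (R : comUnitRingType) (f : {rmorphism k -> R}) g h,
    zero_locus equations f g -> zero_locus equations f h ->
    zero_locus equations f (g *m h);
  points_inv : forall (R : comUnitRingType) (f : {rmorphism k -> R}) g,
    zero_locus equations f g -> zero_locus equations f (invmx g) }.

Definition points (k : fieldType) (n : nat) (G : linear_group k n)
    (R : comUnitRingType) (f : k -> R) : set 'M[R]_n :=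
  [set g | zero_locus (equations G) f g].

(* [Rep_k G], on the spaces [k^m].  A regular function on [G] is the
   restriction of a polynomial in the entries and the inverse determinant. *)
Definition rep_at (k : fieldType) (n m N : nat) (Q : 'M[{mpoly k[n * n]}]_m)
    (R : comUnitRingType) (f : k -> R) (g : 'M[R]_n) : 'M[R]_m :=
  (\det g) ^- N *: map_mx (mmap f (fun l => mxvec g 0 l)) Q.

Record rep (k : fieldType) (n : nat) (G : linear_group k n) := Rep {
  rdim : nat;
  rdenom : nat;
  rnum : 'M[{mpoly k[n * n]}]_rdim;
  rep_1 : forall (R : comUnitRingType) (f : {rmorphism k -> R}),
    rep_at rdenom rnum f 1%:M = 1%:M;
  rep_mul : forall (R : comUnitRingType) (f : {rmorphism k -> R}) g h,
    points G f g -> points G f h ->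
    rep_at rdenom rnum f (g *m h)
      = rep_at rdenom rnum f g *m rep_at rdenom rnum f h }.

Definition rho (k : fieldType) (n : nat) (G : linear_group k n) (r : rep G)
    (R : comUnitRingType) (f : k -> R) (g : 'M[R]_n) : 'M[R]_(rdim r) :=
  rep_at (rdenom r) (rnum r) f g.

(* Cocharacters of [G_K], for [i : k -> K]: a morphism [G_m -> G_K] is a
   matrix of Laurent polynomials [t^-N * Q(t)] over [K]. *)
Definition cochar_at (K : fieldType) (n N : nat) (Q : 'M[{poly K}]_n)
    (R : comUnitRingType) (f : K -> R) (t : R) : 'M[R]_n :=
  t ^- N *: map_mx (fun q => (map_poly f q).[t]) Q.

Record cochar (k : fieldType) (n : nat) (G : linear_group k n)
    (K : fieldType) (i : k -> K) := Cochar {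
  cdenom : nat;
  cnum : 'M[{poly K}]_n;
  cochar_points : forall (R : comUnitRingType) (f : {rmorphism K -> R}) t,
    t \is a GRing.unit -> points G (f \o i) (cochar_at cdenom cnum f t);
  cochar_mul : forall (R : comUnitRingType) (f : {rmorphism K -> R}) s t,
    s \is a GRing.unit -> t \is a GRing.unit ->
    cochar_at cdenom cnum f (s * t)
      = cochar_at cdenom cnum f s *m cochar_at cdenom cnum f t }.

Definition cev (k : fieldType) (n : nat) (G : linear_group k n)
    (K : fieldType) (i : k -> K) (mu : cochar G i)
    (R : comUnitRingType) (f : K -> R) (t : R) : 'M[R]_n :=
  cochar_at (cdenom mu) (cnum mu) f t.

(* Vectors of weight [w] of [rho \o mu] over an extension [h : K -> L]. *)
Definition weight_vec (k : fieldType) (n : nat) (G : linear_group k n)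
    (r : rep G) (K : fieldType) (i : k -> K) (mu : cochar G i)
    (L : fieldType) (h : K -> L) (w : int) : set 'cV[L]_(rdim r) :=
  [set v | forall (R : comUnitRingType) (f : {rmorphism L -> R}) (t : R),
     t \is a GRing.unit ->
     rho r (f \o h \o i) (cev mu (f \o h) t) *m map_mx f v
       = t ^ w *: map_mx f v].

Arguments weight_vec {k n G} r {K i} mu {L} h w _.

Definition weight_sum (k : fieldType) (n : nat) (G : linear_group k n)
    (r : rep G) (K : fieldType) (i : k -> K) (mu : cochar G i)
    (L : fieldType) (h : K -> L) (P : set int) : set 'cV[L]_(rdim r) :=
  [set v | exists (l : nat) (w : 'I_l -> int) (u : 'I_l -> 'cV[L]_(rdim r)),
     (forall q, P (w q) /\ weight_vec r mu h (w q) (u q)) /\ v = \sum_q u q].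

Arguments weight_sum {k n G} r {K i} mu {L} h P _.

(* [X] is in the Lie algebra of [G_K] iff [1 + eps X] is a point of [G] over
   the dual numbers [K[eps]/eps^2]. *)
Definition Lie (k : fieldType) (n : nat) (G : linear_group k n)
    (K : fieldType) (i : k -> K) : set 'M[K]_n :=
  [set X | forall q, equations G q ->
     'X^2 %| mmap (fun c => (i c)%:P)
       (fun l => mxvec (1%:M + 'X *: map_mx polyC X : 'M[{poly K}]_n) 0 l) q].

Definition minuscule (k : fieldType) (n : nat) (G : linear_group k n)
    (K : fieldType) (i : k -> K) (mu : cochar G i) : Prop :=
  forall (X : 'M[K]_n) (w : int), Lie G i X -> X != 0 ->
    (forall (R : comUnitRingType) (f : {rmorphism K -> R}) (t : R),
       t \is a GRing.unit ->
       cev mu f t *m map_mx f X *m invmx (cev mu f t) = t ^ w *: map_mx f X) ->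
    (w = -1) \/ (w = 0) \/ (w = 1).

Definition zclosed (K : fieldType) (n : nat) (Z : set 'M[K]_n) : Prop :=
  exists S : set {mpoly K[n * n]}, Z = [set g | zero_locus S idfun g].

Definition zconnected (K : fieldType) (n : nat) (Z : set 'M[K]_n) : Prop :=
  forall Z1 Z2 : set 'M[K]_n, zclosed Z1 -> zclosed Z2 ->
    Z `<=` Z1 `|` Z2 -> Z `&` Z1 `&` Z2 = set0 ->
    (Z `<=` Z1) \/ (Z `<=` Z2).

Definition matrix_subgroup (K : fieldType) (n : nat) (H : set 'M[K]_n) : Prop :=
  [/\ H `<=` [set g | g \in unitmx], H 1%:M,
      forall g h, H g -> H h -> H (g *m h)
    & forall g, H g -> H (invmx g)].

Definition unipotent_radical (K : fieldType) (n : nat) (H : set 'M[K]_n) :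
    set 'M[K]_n :=
  [set u | exists U : set 'M[K]_n,
     [/\ zclosed U, matrix_subgroup U, zconnected U & U `<=` H] /\
     [/\ forall g v, H g -> U v -> U (g *m v *m invmx g),
         forall v, U v -> (v - 1%:M) ^+ n = 0
       & U u]].

(* [i : k -> K] is an algebraic closure and [k] has characteristic 0, so that
   [G] is smooth and geometric connectedness may be read on [K]-points. *)
Definition connected_reductive (k : fieldType) (n : nat) (G : linear_group k n)
    (K : closedFieldType) (i : k -> K) : Prop :=
  zconnected (points G i) /\ unipotent_radical (points G i) = [set 1%:M].

Definition extend_vspace (k : fieldType) (L : fieldType) (f : k -> L) (m : nat)
    (W : {vspace 'cV[k]_m}) : {vspace 'cV[L]_m} :=
  <<[seq map_mx f v | v <- vbasis W]>>%VS.

Section HN.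

(* [deg U W] is the degree of the subquotient [W / U] of a fixed object with
   underlying space ['cV_m]. *)
Context (k : fieldType) (m : nat).
Context (deg : {vspace 'cV[k]_m} -> {vspace 'cV[k]_m} -> int).

Definition slope (U W : {vspace 'cV[k]_m}) : rat :=
  (deg U W)%:~R / (\dim W - \dim U)%:R.

Definition semistable (U W : {vspace 'cV[k]_m}) : Prop :=
  forall W' : {vspace 'cV[k]_m}, (U <= W')%VS -> U != W' -> (W' <= W)%VS ->
    slope U W' <= slope U W.

Definition is_HN_flag (l : nat) (E : nat -> {vspace 'cV[k]_m}) : Prop :=
  [/\ E 0%N = 0%VS, E l = fullv,
      forall q, (q < l)%N ->
        [/\ (E q <= E q.+1)%VS, E q != E q.+1 & semistable (E q) (E q.+1)]
    & forall q, (q.+1 < l)%N -> slope (E q.+1) (E q.+2) < slope (E q) (E q.+1)].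

(* The steps [E q] of the flag are increasing, so the union over all [q] with
   graded slopes [>= a] up to [q] is the largest such step. *)
Definition HN_step (a : rat) : set 'cV[k]_m :=
  [set v | exists l E q,
     [/\ is_HN_flag l E, (q <= l)%N,
         forall s, (s < q)%N -> a <= slope (E s) (E s.+1) & v \in E q]].

End HN.

Definition fibre_filtration (k : fieldType) (n : nat) (G : linear_group k n) :=
  forall r : rep G, rat -> set 'cV[k]_(rdim r).

Definition ring_span (k : fieldType) (m : nat) (R : comUnitRingType)
    (f : k -> R) (V : set 'cV[k]_m) : set 'cV[R]_m :=
  [set v | exists (l : nat) (c : 'I_l -> R) (w : 'I_l -> 'cV[k]_m),
     (forall q, V (w q)) /\ v = \sum_q c q *: map_mx f (w q)].

(* The [R]-points of the group of tensor automorphisms of the filtered fibre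
   functor, a tensor automorphism of the fibre functor being given by an
   element of [G(R)]. *)
Definition filtration_parabolic (k : fieldType) (n : nat)
    (G : linear_group k n) (Fil : fibre_filtration G)
    (R : comUnitRingType) (f : k -> R) : set 'M[R]_n :=
  [set g | points G f g /\ forall (r : rep G) (a : rat) (v : 'cV[R]_(rdim r)),
     ring_span f (Fil r a) v <-> ring_span f (Fil r a) (rho r f g *m v)].

(* The rational cocharacter [rnumer / rden]. *)
Record rat_cochar (k : fieldType) (n : nat) (G : linear_group k n) :=
  RatCochar {
    rnumer : cochar G (idfun : k -> k);
    rden : nat;
    rden_gt0 : (0 < rden)%N }.

Definition splits (k : fieldType) (n : nat) (G : linear_group k n)
    (Fil : fibre_filtration G) (nu : rat_cochar G) : Prop :=
  forall (r : rep G) (a : rat),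
    Fil r a =
    weight_sum r (rnumer nu) (idfun : k -> k)
      [set w | a <= w%:~R / (rden nu)%:R].

(* [M] is a Levi subgroup of the subgroup [P] of [G]: it is a complement of
   the unipotent radical over the algebraic closure [i : k -> K]. *)
Definition is_Levi (k : fieldType) (n : nat) (K : closedFieldType) (i : k -> K)
    (P : forall R : comUnitRingType, (k -> R) -> set 'M[R]_n)
    (M : linear_group k n) : Prop :=
  [/\ forall (R : comUnitRingType) (f : {rmorphism k -> R}),
        points M f `<=` P R f,
      forall g, P K i g -> exists h u,
        [/\ points M i h, unipotent_radical (P K i) u & g = h *m u]
    & forall u, points M i u -> unipotent_radical (P K i) u -> u = 1%:M].

Definition central_in (k : fieldType) (n : nat) (G : linear_group k n)
    (nu : rat_cochar G) (M : linear_group k n) : Prop :=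
  forall (R : comUnitRingType) (f : {rmorphism k -> R}) (t : R),
    t \is a GRing.unit ->
    points M f (cev (rnumer nu) f t) /\
    forall g, points M f g ->
      g *m cev (rnumer nu) f t = cev (rnumer nu) f t *m g.

(* A splitting is only unique up to conjugation by the unipotent radical of
   the parabolic (and up to expanding the fraction [rnumer / rden]), so the
   vector of a filtration is the class consisting of all of them. *)
Definition filtration_vector (k : fieldType) (n : nat) (G : linear_group k n)
    (K : closedFieldType) (i : k -> K) (Fil : fibre_filtration G) :
    set (rat_cochar G) :=
  [set nu | splits Fil nu /\
     exists2 M, is_Levi i (@filtration_parabolic k n G Fil) M
       & central_in nu M].

Definition gr_coset (k : fieldType) (n : nat) (G : linear_group k n)
    (Bp : idomainType) (f : k -> Bp) (B : fieldType) (j : Bp -> B)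
    (g : 'M[B]_n) : set 'M[B]_n :=
  [set g *m map_mx j h | h in points G f].

(* [f : K -> Bp] is the embedding of the field of definition of [mu]. *)
Definition in_Gr_mu (k : fieldType) (n : nat) (G : linear_group k n)
    (K : fieldType) (i : k -> K) (mu : cochar G i)
    (Bp : idomainType) (xi : Bp) (f : K -> Bp) (B : fieldType) (j : Bp -> B)
    (x : set 'M[B]_n) : Prop :=
  exists2 g, points G (f \o i) g
    & x = gr_coset G (f \o i) j
            (map_mx j g *m invmx (cev mu (j \o f) (j xi))).

(* [x] lies in [G(C) mu(xi^-1) G(Bp) / G(Bp)] for a section [C -> Bp] of
   [th]; viewing [G(C)] in [G(Bp)] requires a section of [k]-algebras. *)
Definition in_section_orbit (k : fieldType) (n : nat) (G : linear_group k n)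
    (K : fieldType) (i : k -> K) (mu : cochar G i)
    (C : fieldType) (Bp : idomainType) (th : Bp -> C) (xi : Bp) (f : K -> Bp)
    (B : fieldType) (j : Bp -> B) (x : set 'M[B]_n) : Prop :=
  exists s : {rmorphism C -> Bp},
    [/\ forall c, th (s c) = c, forall a, s (th (f (i a))) = f (i a)
      & exists2 g, points G (th \o f \o i) g
          & x = gr_coset G (f \o i) j
                  (map_mx (j \o s) g *m cev mu (j \o f) (j xi)^-1)].

(* The lattice [rho(x) (V \otimes Bp)]. *)
Definition x_lattice (k : fieldType) (n : nat) (G : linear_group k n)
    (Bp : idomainType) (B : fieldType) (j : Bp -> B) (f : k -> Bp)
    (x : set 'M[B]_n) (r : rep G) : set 'cV[B]_(rdim r) :=
  [set v | exists g (w : 'cV[Bp]_(rdim r)),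
     x g /\ v = rho r (j \o f) g *m map_mx j w].

Arguments x_lattice {k n G Bp B} j f x r _.

Definition lattice_deg (Bp : idomainType) (xi : Bp) (B : fieldType)
    (j : Bp -> B) (m : nat) (La : set 'cV[B]_m) : int :=
  - val_xi xi j (\det (xget 1%:M
      [set g : 'M[B]_m | g \in unitmx /\
         La = [set g *m map_mx j w | w in [set: 'cV[Bp]_m]]])).

(* The image of the lattice [La `&` W_B] in [(W / U)_B], in the coordinates
   given by a basis of the complement [W :\: U] of [U] in [W]. *)
Definition subquotient_lattice (k : fieldType) (B : fieldType) (f : k -> B)
    (m : nat) (La : set 'cV[B]_m) (U W : {vspace 'cV[k]_m}) :
    set 'cV[B]_(\dim (W :\: U)) :=
  [set c | exists l,
     [/\ La l, l \in extend_vspace f W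
       & \sum_q c q 0 *: map_mx f (tnth (vbasis (W :\: U)) q) - l
           \in extend_vspace f U]].

Arguments subquotient_lattice {k B} f {m} La U W _.

Definition HN_filtration (k : fieldType) (n : nat) (G : linear_group k n)
    (Bp : idomainType) (xi : Bp) (f : k -> Bp) (B : fieldType) (j : Bp -> B)
    (x : set 'M[B]_n) : fibre_filtration G :=
  fun r => HN_step (fun U W =>
    lattice_deg xi j (subquotient_lattice (j \o f) (x_lattice j f x r) U W)).

(* The parabolic on whose Lie algebra [mu] has weights [>= 0]: the points [g]
   for which [lim_(t -> 0) mu(t) g mu(t)^-1] exists in [G], i.e. the orbit map
   [G_m -> G] extends to the affine line, necessarily by a polynomial matrix
   [Lm] (SGA 3 XXVI; Conrad-Gabber-Prasad, 2.1). *)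
Definition P_mu (k : fieldType) (n : nat) (G : linear_group k n)
    (K : fieldType) (i : k -> K) (mu : cochar G i) (C : fieldType)
    (h : K -> C) : set 'M[C]_n :=
  [set g | points G (h \o i) g /\
     exists Lm : 'M[{poly C}]_n,
     forall (R : comUnitRingType) (f : {rmorphism C -> R}) (t : R),
       let Lt := map_mx (fun q => (map_poly f q).[t]) Lm in
       points G (f \o h \o i) Lt /\
       (t \is a GRing.unit ->
          Lt = cev mu (f \o h) t *m map_mx f g *m invmx (cev mu (f \o h) t))].

Definition flag_coset (k : fieldType) (n : nat) (G : linear_group k n)
    (K : fieldType) (i : k -> K) (mu : cochar G i) (C : fieldType)
    (h : K -> C) (g : 'M[C]_n) : set 'M[C]_n :=
  [set g *m q | q in P_mu mu h].

(* The Bialynicki-Birula map; points of the flag variety are the cosets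
   [flag_coset].  The value is [set0] if [x] is not in [Gr_mu]. *)
Definition BB (k : fieldType) (n : nat) (G : linear_group k n)
    (K : fieldType) (i : k -> K) (mu : cochar G i)
    (C : fieldType) (Bp : idomainType) (th : Bp -> C) (xi : Bp) (f : K -> Bp)
    (B : fieldType) (j : Bp -> B) (x : set 'M[B]_n) : set 'M[C]_n :=
  xget set0 [set y | exists g,
    [/\ points G (f \o i) g,
        x = gr_coset G (f \o i) j (map_mx j g *m cev mu (j \o f) (j xi)^-1)
      & y = flag_coset mu (th \o f) (map_mx th g)]].

(* The subspace with underlying set [S], if there is one. *)
Definition vspace_of (C : fieldType) (m : nat) (S : set 'cV[C]_m) :
    {vspace 'cV[C]_m} :=
  xget 0%VS [set W : {vspace 'cV[C]_m} | [set v | v \in W] = S].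

(* The filtration of [V_C] given by a point [y] of the flag variety, computed
   with a representative of the coset [y]. *)
Definition flag_filtration (k : fieldType) (n : nat) (G : linear_group k n)
    (K : fieldType) (i : k -> K) (mu : cochar G i) (C : fieldType)
    (h : K -> C) (y : set 'M[C]_n) (r : rep G) (w : int) :
    {vspace 'cV[C]_(rdim r)} :=
  vspace_of [set rho r (h \o i) (xget 1%:M y) *m v
            | v in weight_sum r mu h [set w' | w <= w']].

(* [deg = \sum_i i * dim gr^i] for the filtration induced on [W / U]. *)
Definition DOR_deg (k : fieldType) (C : fieldType) (f : k -> C) (m : nat)
    (Fl : int -> {vspace 'cV[C]_m}) (U W : {vspace 'cV[k]_m}) : int :=
  let d w : int :=
    (\dim ((Fl w :&: extend_vspace f W) + extend_vspace f U)%VS)%:Z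
      - (\dim (extend_vspace f U))%:Z in
  \sum_(w \in [set: int]) w * (d w - d (w + 1)).

(* [D] being the trivial [G]-isocrystal, the subobjects of [D(V)] are the
   subspaces of [V] over the base field. *)
Definition DOR_filtration (k : fieldType) (n : nat) (G : linear_group k n)
    (K : fieldType) (i : k -> K) (mu : cochar G i) (C : fieldType)
    (h : K -> C) (y : set 'M[C]_n) : fibre_filtration G :=
  fun r => HN_step (DOR_deg (h \o i) (flag_filtration mu h y r)).

(* Main.v *)
From HB Require Import structures.
Require Import Defs.
From mathcomp Require Import perm cyclic ring zify.

Set Implicit Arguments.
Unset Strict Implicit.
Unset Printing Implicit Defensive.

Import Order.TTheory GRing.Theory Num.Theory.

(* For a representation [V] let [La] be the lattice of [x] in [V_B] and
   [F] the filtration of [V_C] given by [BB(x)].  It suffices to show that the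
   two degrees agree on all subquotients [W / U] of [V] by subspaces over the
   base field, since then the two Harder-Narasimhan formalisms coincide.

   Suppose [x = s(g) mu(xi)^-1] for a section [s : C -> Bp] compatible with the
   embeddings of [Fbar].  Then [La = sum_w xi^-w s(F^w) Bp], and because [s] is
   linear over the base field the same holds for [La] and [F] replaced by their
   images in [W / U]; a basis of [W_C / U_C] adapted to the filtration shows
   that both degrees equal the sum of its jumps.

   A section exists by a Zorn and Hensel argument on the subrings of [Bp] that
   [th] maps injectively, and Hensel uniqueness makes every section over the
   base field compatible with [Fbar].  If [mu] is minuscule, write
   [x = g mu(xi)^-1] and [g = s(th g) h] with [h = 1] modulo [xi].  The
   logarithm of [h] lies in the Lie algebra, so it has only the weights -1, 0,
   1 and is divisible by [xi]; it follows that [mu(xi) h mu(xi)^-1] is integral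
   and [x = s(th g) mu(xi)^-1]. *)

(** * The discrete valuation ring and its residue sections *)

(** The point [BB(x)] and its representative are arbitrary choices made without reference to a
    section, so the filtration must be shown not to depend on them: both changes of representative
    are block triangular for the weights of [mu], and such an automorphism preserves the weight
    filtration. Generic points of the multiplicative group are replaced by the positive integers,
    which in characteristic 0 determine a polynomial; this yields the weight projectors and also
    works modulo powers of [xi]. In the minuscule case the logarithm is only a truncated sum, and
    its membership in the Lie algebra becomes the statement that the differentials at 1 of the
    equations of [G] take values on it divisible by a high power of [xi]. These differentials have
    coefficients in a field, so the absence of weights other than -1, 0, 1 gives a left inverse over
    that field, which transports the divisibility to matrix entries. The blocks of weight
    [a - b <= -2] of [h - 1] then gain [b - a] powers of [xi], exactly what conjugation by [mu(xi)]
    loses. *)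

Definition powdvd (A : comNzRingType) (r : A) (m : nat) (a : A) : Prop :=
  exists c, a = r ^+ m * c.

Section PowDvd.
Context (A : comNzRingType) (r : A).

Lemma powdvd0 m : powdvd r m 0.
Proof. by exists 0; rewrite mulr0. Qed.

Lemma powdvdD m a b : powdvd r m a -> powdvd r m b -> powdvd r m (a + b).
Proof. by move=> [c ->] [d ->]; exists (c + d); rewrite mulrDr. Qed.

Lemma powdvdN m a : powdvd r m a -> powdvd r m (- a).
Proof. by move=> [c ->]; exists (- c); rewrite mulrN. Qed.

Lemma powdvdB m a b : powdvd r m a -> powdvd r m b -> powdvd r m (a - b).
Proof. by move=> Ha Hb; apply: powdvdD => //; apply: powdvdN. Qed.

Lemma powdvdM m q a b : powdvd r m a -> powdvd r q b -> powdvd r (m + q) (a * b).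
Proof. by move=> [c ->] [d ->]; exists (c * d); rewrite exprD; ring. Qed.

Lemma powdvd_mulr m a b : powdvd r m a -> powdvd r m (a * b).
Proof. by move=> [c ->]; exists (c * b); rewrite mulrA. Qed.

Lemma powdvd_mull m a b : powdvd r m b -> powdvd r m (a * b).
Proof. by rewrite mulrC; apply: powdvd_mulr. Qed.

Lemma powdvd_leq m q a : (m <= q)%N -> powdvd r q a -> powdvd r m a.
Proof.
by move=> mq [c ->]; exists (r ^+ (q - m) * c); rewrite mulrA -exprD subnKC.
Qed.

Lemma powdvd0n a : powdvd r 0 a.
Proof. by exists a; rewrite expr0 mul1r. Qed.

Lemma powdvd_sum m (I : Type) (s : seq I) (P : pred I) (f : I -> A) :
  (forall i, P i -> powdvd r m (f i)) -> powdvd r m (\sum_(i <- s | P i) f i).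
Proof.
move=> H; elim/big_ind: _ => //; [exact: powdvd0|by move=> *; apply: powdvdD].
Qed.

Lemma powdvdMn m a k : powdvd r m a -> powdvd r m (a *+ k).
Proof. by move=> [c ->]; exists (c *+ k); rewrite mulrnAr. Qed.

End PowDvd.

Lemma horner_congr (A : comNzRingType) (q : {poly A}) (a d : A) :
  exists e, q.[a + d] = q.[a] + d * e.
Proof.
elim/poly_ind: q => [|q c [e He]]; first by exists 0; rewrite !horner0; ring.
exists (q.[a] + e * (a + d)); rewrite !hornerE He; ring.
Qed.

Lemma horner_taylor2 (A : comNzRingType) (q : {poly A}) (a d : A) :
  exists e, q.[a + d] = q.[a] + d * q^`().[a] + d ^+ 2 * e.
Proof.
elim/poly_ind: q => [|q c [e He]].
  by exists 0; rewrite deriv0 !horner0; ring.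
exists (q^`().[a] + e * (a + d)).
rewrite derivD derivM derivX derivC !hornerE He; ring.
Qed.

Section DvrBasics.
Context (C : fieldType) (Bp : idomainType) (th : {rmorphism Bp -> C}) (xi : Bp).
Hypothesis xi0 : xi != 0.
Hypothesis th_surj : forall c : C, exists b, th b = c.
Hypothesis th_ker : forall b, (th b = 0) <-> (exists c, b = xi * c).
Hypothesis xi_complete : adic_complete xi.

Lemma th_ker1 b : th b = 0 <-> powdvd xi 1 b.
Proof. by rewrite th_ker /powdvd expr1. Qed.

Lemma powdvd_cancel m q a : powdvd xi (m + q) (xi ^+ m * a) -> powdvd xi q a.
Proof.
move=> [c Hc]; exists c; apply: (mulfI (expf_neq0 m xi0)).
by rewrite mulrA -exprD.
Qed.

(** The inverse is the [xi]-adic limit of the geometric sums: its product with [1 - xi * c] differs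
    from 1 by an element of every power of [xi], hence by 0. *)
Lemma unit_1Bxi c : 1 - xi * c \is a GRing.unit.
Proof.
case: xi_complete => sep conv.
have [|l Hl] := conv (fun m => \sum_(i < m) (xi * c) ^+ i).
  by move=> m; exists (c ^+ m); rewrite big_ord_recr /= exprMn; ring.
suff E : (1 - xi * c) * l = 1 by apply/unitrPr; exists l.
apply/eqP; rewrite -subr_eq0; apply/eqP/sep => m.
have [b Hb] := Hl m; set u := \sum_(i < m) _ in Hb.
have Eu : (1 - xi * c) * u = 1 - (xi * c) ^+ m.
  by rewrite -[RHS]opprB subrX1 -/u; ring.
exists ((1 - xi * c) * b - c ^+ m).
have -> : l = u + xi ^+ m * b by rewrite -Hb addrC subrK.
rewrite mulrDr Eu exprMn; ring.
Qed.

Lemma unit_thE b : (b \is a GRing.unit) = (th b != 0).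
Proof.
apply/idP/idP => [/(rmorph_unit th)|]; first by rewrite unitfE.
move=> hb; have [b' Hb'] := th_surj (th b)^-1.
have /th_ker [c Hc] : th (1 - b * b') = 0.
  by rewrite rmorphB rmorph1 rmorphM Hb' divff // subrr.
have : b * b' \is a GRing.unit.
  by rewrite -[b * b'](subKr 1) Hc unit_1Bxi.
by rewrite unitrM => /andP[].
Qed.

(** Newton iteration with the slope frozen at [b0]: the derivative is constant modulo [xi] along the
    sequence, so every step gains one power of [xi], and this linear convergence suffices. *)
Lemma hensel (q : {poly Bp}) (b0 : Bp) :
  th q.[b0] = 0 -> th q^`().[b0] != 0 -> exists b, q.[b] = 0 /\ th b = th b0.
Proof.
move=> q0 q1; case: xi_complete => sep conv.
have Uq1 : q^`().[b0] \is a GRing.unit by rewrite unit_thE.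
set u := (q^`().[b0])^-1.
pose b := fix b m := if m is m'.+1 then b m' - q.[b m'] * u else b0.
have IH m : powdvd xi m.+1 q.[b m] /\ powdvd xi 1 (b m - b0).
  elim: m => [|m [IH1 IH2]] /=.
    by split; [apply/th_ker1|rewrite subrr; apply: powdvd0].
  set d := q.[b m]; have [e He] := horner_taylor2 q (b m) (- (d * u)).
  have [e' He'] := horner_congr q^`() b0 (b m - b0).
  rewrite addrC subrK in He'.
  split.
    rewrite He He'.
    have -> : d + - (d * u) * (q^`().[b0] + (b m - b0) * e') + (- (d * u)) ^+ 2 * e
       = d * (1 - u * q^`().[b0]) - d * ((b m - b0) * (u * e')) + d * d * (u ^+ 2 * e).
      by ring.
    rewrite mulVr // subrr mulr0 sub0r; apply: powdvdD; first apply: powdvdN.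
      by rewrite -addn1; apply: powdvdM => //; apply: powdvd_mulr.
    by apply: powdvd_mulr; apply: (@powdvd_leq _ _ _ (m.+1 + m.+1)); [lia|apply: powdvdM].
  rewrite addrAC; apply: powdvdB => //; apply: powdvd_mulr.
  exact: powdvd_leq IH1.
have [|l Hl] := conv b.
  move=> m /=; have [[c Hc] _] := IH m; exists (- (xi * c * u)).
  by rewrite Hc exprS; ring.
exists l; split.
  apply: sep => m; have [c Hc] := Hl m.
  have [e He] := horner_congr q (b m) (l - b m).
  rewrite addrC subrK in He; rewrite He Hc.
  have [[c' ->] _] := IH m.
  by exists (xi * c' + c * e); rewrite exprS; ring.
have [c Hc] := Hl 1%N; have [_ [c' Hc']] := IH 1%N.
apply/eqP; rewrite -subr_eq0 -rmorphB; apply/eqP/th_ker.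
rewrite expr1 in Hc Hc'.
by exists (c + c'); rewrite mulrDr -Hc -Hc'; ring.
Qed.

End DvrBasics.

(** * Maximal subrings injecting into the residue field *)

Section ResidueSection.
Context (C : closedFieldType) (Bp : idomainType) (th : {rmorphism Bp -> C}) (xi : Bp).
Hypothesis xi0 : xi != 0.
Hypothesis th_surj : forall c : C, exists b, th b = c.
Hypothesis th_ker : forall b, (th b = 0) <-> (exists c, b = xi * c).
Hypothesis xi_complete : adic_complete xi.
Hypothesis charC : forall m, (m.+1)%:R != 0 :> C.

Definition lifting (S : set Bp) : Prop :=
  [/\ S 1, forall a b, S a -> S b -> S (a - b),
      forall a b, S a -> S b -> S (a * b)
    & forall a, S a -> th a = 0 -> a = 0].

(** Zorn is applied to the sets whose union with [S0] is lifting, not to the lifting sets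
    themselves: the union of the empty chain is empty and would not contain 1. *)
Lemma lifting_max (S0 : set Bp) : lifting S0 ->
  exists S, [/\ S0 `<=` S, lifting S &
    forall S', S `<=` S' -> lifting S' -> S' `<=` S].
Proof.
move=> L0; have [|A [LA maxA]] := @Zorn_bigcup Bp (fun S => lifting (S `|` S0)).
  move=> F FP totF.
  have [->|/set0P [X0 FX0]] := eqVneq F set0.
    by rewrite bigcup_set0 set0U.
  have dir a b : (\bigcup_(X in F) X `|` S0) a -> (\bigcup_(X in F) X `|` S0) b ->
      exists X, [/\ F X, (X `|` S0) a & (X `|` S0) b].
    move=> [[X FX Xa]|Sa] [[Y FY Yb]|Sb].
    - have [/(_ _ Xa) H|/(_ _ Yb) H] := totF _ _ FX FY.
        by exists Y; split=> //; left.
      by exists X; split=> //; left.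
    - by exists X; split=> //; [left|right].
    - by exists Y; split=> //; [right|left].
    - by exists X0; split=> //; right.
  have up X : F X -> (X `|` S0) `<=` (\bigcup_(X in F) X `|` S0).
    by move=> FX a [Xa|]; [left; exists X|right].
  split.
  - by apply: (up _ FX0); case: (FP _ FX0).
  - move=> a b /dir H /H [X [FX Xa Xb]]; apply: (up _ FX).
    by case: (FP _ FX) => _ + _ _; apply.
  - move=> a b /dir H /H [X [FX Xa Xb]]; apply: (up _ FX).
    by case: (FP _ FX) => _ _ + _; apply.
  - move=> a Ha; have [X [FX Xa _]] := dir _ _ Ha Ha.
    by case: (FP _ FX) => _ _ _; apply.
exists (A `|` S0); split; [by move=> a ?; right|exact: LA|move=> S' sub LS'].
have S'E : S' `|` S0 = S'.
  apply/seteqP; split=> a; last by move=> ?; left.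
  by move=> [//|Sa]; apply: sub; right.
apply: contrapT => nsub; apply: (maxA S'); last by rewrite S'E.
split; first by move=> a Aa; apply: sub; left.
by move=> H; apply: nsub => a /H; left.
Qed.

Section Maximal.
Context (S : set Bp).
Hypothesis LS : lifting S.
Hypothesis maxS : forall S', S `<=` S' -> lifting S' -> S' `<=` S.

Lemma liftS0 : S 0.
Proof. by case: LS => S1 SB _ _; rewrite -(subrr 1); apply: SB. Qed.

Lemma liftSN a : S a -> S (- a).
Proof. by case: LS => _ SB _ _ Sa; rewrite -sub0r; apply: SB => //; apply: liftS0. Qed.

Lemma liftSD a b : S a -> S b -> S (a + b).
Proof.
by move=> Sa Sb; rewrite -[b]opprK; case: LS => _ SB _ _; apply: SB => //; apply: liftSN.
Qed.

Lemma liftS_sum (I : Type) (s : seq I) (P : pred I) (f : I -> Bp) :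
  (forall i, P i -> S (f i)) -> S (\sum_(i <- s | P i) f i).
Proof. by move=> H; elim/big_ind: _ => //; [apply: liftS0|apply: liftSD]. Qed.

Lemma liftSMn a k : S a -> S (a *+ k).
Proof.
move=> Sa; elim: k => [|k IH]; first by rewrite mulr0n; apply: liftS0.
by rewrite mulrS; apply: liftSD.
Qed.

Lemma liftSX a k : S a -> S (a ^+ k).
Proof.
case: LS => S1 _ SM _ Sa; elim: k => [|k IH]; first by rewrite expr0.
by rewrite exprS; apply: SM.
Qed.

(** Localizing at [a] keeps [th] injective because [a] is not a zero divisor, and maximality then
    puts [a^-1] in [S]. A maximal lifting ring is thus a field. *)
Lemma liftSV a : S a -> a != 0 -> S a^-1.
Proof.
move=> Sa a0; have [S1 SB SM Sinj] := LS.
have Ua : a \is a GRing.unit.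
  by rewrite (unit_thE th_surj th_ker xi_complete); apply: contra_neq a0; apply: Sinj.
pose S' := [set b | exists2 k, S (b * a ^+ k) & True].
have mono b k k' : (k <= k')%N -> S (b * a ^+ k) -> S (b * a ^+ k').
  by move=> kk' Sb; rewrite -(subnKC kk') exprD mulrA; apply: SM => //; apply: liftSX.
suff : S' `<=` S by apply; exists 1%N => //; rewrite expr1 mulVr.
apply: maxS => [b Sb|]; first by exists 0%N => //; rewrite expr0 mulr1.
split.
- by exists 0%N => //; rewrite expr0 mulr1.
- move=> b c [k Sb _] [l Sc _]; exists (k + l)%N => //; rewrite mulrBl.
  by apply: SB; [apply: mono Sb; apply: leq_addr|apply: mono Sc; apply: leq_addl].
- move=> b c [k Sb _] [l Sc _]; exists (k + l)%N => //.
  by rewrite exprD mulrACA; apply: SM.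
- move=> b [k Sb _] tb; have : b * a ^+ k = 0.
    by apply: Sinj => //; rewrite rmorphM tb mul0r.
  by move/eqP; rewrite mulf_eq0 expf_eq0 (negPf a0) andbF orbF => /eqP.
Qed.

Definition polyS (q : {poly Bp}) := forall i, S q`_i.

Lemma polySB q r : polyS q -> polyS r -> polyS (q - r).
Proof. by move=> Hq Hr i; rewrite coefB; case: LS => _ SB _ _; apply: SB. Qed.

Lemma polySM q r : polyS q -> polyS r -> polyS (q * r).
Proof.
by move=> Hq Hr i; rewrite coefM; apply: liftS_sum => k _; case: LS => _ _ SM _; apply: SM.
Qed.

Lemma polySC c : S c -> polyS c%:P.
Proof. by move=> Sc i; rewrite coefC; case: ifP => // _; apply: liftS0. Qed.

Lemma polySX : polyS 'X.
Proof. by move=> i; rewrite coefX; case: (_ == _); [case: LS|apply: liftS0]. Qed.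

Lemma polySXn k : polyS 'X^k.
Proof. by move=> i; rewrite coefXn; case: (_ == _); [case: LS|apply: liftS0]. Qed.

(** The hypothesis says that [th] stays injective on [S[b]], so maximality absorbs [b]. *)
Lemma adjoin_in b :
  (forall p, polyS p -> th p.[b] = 0 -> p.[b] = 0) -> S b.
Proof.
move=> H; have [S1 SB SM Sinj] := LS.
pose S' := [set c | exists2 p, polyS p & c = p.[b]].
suff : S' `<=` S by apply; exists 'X; [apply: polySX|rewrite hornerX].
apply: maxS => [c Sc|]; first by exists c%:P; [apply: polySC|rewrite hornerC].
split.
- by exists 1%:P; [apply: polySC|rewrite hornerC].
- move=> _ _ [p Hp ->] [q Hq ->]; exists (p - q); first exact: polySB.
  by rewrite hornerD hornerN.
- move=> _ _ [p Hp ->] [q Hq ->]; exists (p * q); first exact: polySM.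
  by rewrite hornerM.
- by move=> _ [p Hp ->]; apply: H.
Qed.

Lemma th_horner (p : {poly Bp}) b : th p.[b] = (map_poly th p).[th b].
Proof. by rewrite horner_map. Qed.

(** If [c] is transcendental over [th(S)], any preimage of [c] can be adjoined. Otherwise a
    polynomial over [S] of least size killing [c] is separable at [c] in characteristic 0, and
    Hensel lifts [c] to a root of it in [Bp]. This root can be adjoined, since every polynomial over
    [S] killing [c] is a multiple of the chosen one. *)
Lemma lifting_surj c : exists2 b, S b & th b = c.
Proof.
have [S1 SB SM Sinj] := LS.
pose ann (k : nat) := `[< exists p, [/\ polyS p, p != 0, (map_poly th p).[c] = 0 & size p = k] >].
have [exk|nex] := pselect (exists k, ann k); last first.
  have [b Hb] := th_surj c; exists b => //; apply: adjoin_in => p Hp tp.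
  have [->|p0] := eqVneq p 0; first by rewrite horner0.
  case: nex; exists (size p); apply/asboolP; exists p; split=> //.
  by rewrite -Hb -th_horner.
have [k /asboolP [q [Hq q0 qc sq]] mink] := ex_minnP exk.
have minq p : polyS p -> (map_poly th p).[c] = 0 -> (size p < size q)%N -> p = 0.
  move=> Hp pc; rewrite sq => spq; apply/eqP/negP => /negP p0.
  have : (k <= size p)%N by apply: mink; apply/asboolP; exists p.
  by rewrite leqNgt spq.
have Slq : S (lead_coef q) by rewrite lead_coefE.
have lq0 : lead_coef q != 0 by rewrite lead_coef_eq0.
have Ulq : lead_coef q \is a GRing.unit.
  by rewrite (unit_thE th_surj th_ker xi_complete); apply: contra_neq lq0; apply: Sinj.
have sq1 : (1 < size q)%N.
  rewrite ltnNge; apply/negP => /size1_polyC qE.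
  move: qc; rewrite qE map_polyC hornerC => /(Sinj _ (Hq _)) q00.
  by move: q0; rewrite qE q00 eqxx.
have q'c : (map_poly th q^`()).[c] != 0.
  apply/eqP => H.
  have Hq' : polyS q^`().
    by move=> i; rewrite coef_deriv; apply: liftSMn.
  have := minq _ Hq' H (lt_size_deriv q0).
  move/(congr1 (fun p : {poly Bp} => p`_(size q).-2)).
  rewrite /= coef_deriv coef0.
  have -> : ((size q).-2.+1 = (size q).-1)%N by lia.
  rewrite -lead_coefE => E.
  have := Ulq; rewrite (unit_thE th_surj th_ker xi_complete) => /eqP; apply.
  have := congr1 th E; rewrite rmorphMn rmorph0 -mulr_natr => /eqP.
  rewrite mulf_eq0 => /orP[/eqP //|].
  by case: (size q) sq1 => [|[|m]] // _; rewrite (negPf (charC _)).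
have [b0 Hb0] := th_surj c.
have [||b [qb tb]] := @hensel _ _ th xi xi0 th_surj th_ker xi_complete q b0.
- by rewrite th_horner Hb0.
- by rewrite th_horner Hb0.
exists b; last by rewrite tb.
apply: adjoin_in => p Hp tp.
(* Division by [q], one leading term at a time: [r] has the same value as [p] at [b] and still kills
   [c], and below the size of [q] minimality leaves only 0. *)
have : (map_poly th p).[c] = 0 by rewrite -Hb0 -tb -th_horner.
have [l] := ubnP (size p); elim: l p Hp {tp} => // l IH p Hp sp pc.
have [spq|sqp] := ltnP (size p) (size q); first by rewrite (minq p) ?horner0.
pose r := p - (lead_coef p / lead_coef q)%:P * 'X^(size p - size q) * q.
have Hr : polyS r.
  apply: polySB => //; apply: polySM => //; apply: polySM; last exact: polySXn.
  by apply: polySC; apply: SM; [rewrite lead_coefE; apply: Hp|apply: liftSV].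
have rE : r.[b] = p.[b].
  by rewrite /r hornerD hornerN [(_ * q).[b]]hornerM qb mulr0 subr0.
rewrite -rE; apply: IH => //; last first.
  by rewrite /r rmorphB rmorphM /= hornerD hornerN hornerM qc pc mulr0 subr0.
have p0 : p != 0 by rewrite -size_poly_gt0; lia.
suff : (size r <= (size p).-1)%N by lia.
apply/leq_sizeP => i Hi.
have ri : (i < size p)%N -> i = (size p).-1 by lia.
rewrite /r -mulrA coefB coefCM coefXnM.
have -> : (i < size p - size q)%N = false by lia.
have [/ri ->|Hip] := ltnP i (size p).
  have -> : ((size p).-1 - (size p - size q) = (size q).-1)%N by lia.
  by rewrite -!/(lead_coef _) -mulrA mulVr // mulr1 subrr.
have -> : q`_(i - (size p - size q)) = 0.
  by apply: nth_default; rewrite leq_subRL ?subnK // (leq_trans (leq_subr _ _)).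
by rewrite nth_default // mulr0 subrr.
Qed.

End Maximal.

(** [th] is bijective from a maximal [S] onto [C], and the section is its inverse; the elements of
    [S0] lie in [S], so the section recovers them from their residues. *)
Lemma residue_section (S0 : set Bp) : lifting S0 ->
  exists s : {rmorphism C -> Bp},
    (forall c, th (s c) = c) /\ (forall b, S0 b -> s (th b) = b).
Proof.
move=> /lifting_max [S [S0S LS maxS]].
have surj := lifting_surj LS maxS; have [S1 SB SM Sinj] := LS.
pose s0 c := xget 0 [set b | S b /\ th b = c].
have s0P c : S (s0 c) /\ th (s0 c) = c.
  have [b Sb tb] := surj c.
  by have : [set b | S b /\ th b = c] (s0 c) by apply: (@xgetI _ 0 _ b).
have uniqS a b : S a -> S b -> th a = th b -> a = b.
  move=> Sa Sb tab; apply/eqP; rewrite -subr_eq0; apply/eqP/Sinj; first exact: SB.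
  by rewrite rmorphB tab subrr.
have sB : zmod_morphism s0.
  move=> a b; have [Sa ta] := s0P a; have [Sb tb] := s0P b; have [Sab tab] := s0P (a - b).
  by apply: uniqS => //; [apply: SB|rewrite tab rmorphB ta tb].
have sM : monoid_morphism s0.
  split=> [|a b].
    by have [Sa ta] := s0P 1; apply: uniqS => //; rewrite ta rmorph1.
  have [Sa ta] := s0P a; have [Sb tb] := s0P b; have [Sab tab] := s0P (a * b).
  by apply: uniqS => //; [apply: SM|rewrite tab rmorphM ta tb].
pose s : {rmorphism C -> Bp} := HB.pack s0
  (GRing.isZmodMorphism.Build C Bp s0 sB) (GRing.isMonoidMorphism.Build C Bp s0 sM).
exists s; split=> [c|b Sb] /=; first by case: (s0P c).
by have [Sa ta] := s0P (th b); apply: uniqS => //; apply: S0S.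
Qed.

End ResidueSection.

(** * Points, representations and characteristic zero *)

(** If a positive integer vanished, so would its part [M] prime to [p], as [p] itself is nonzero. By
    Euler [p ^ totient M] is 1 modulo [M], hence equal to 1 in [Qp], although its absolute value is
    less than 1. *)
Lemma is_Qp_char0 (R : realType) (p : nat) (Qp : fieldType) (a : Qp -> R) :
  prime p -> is_Qp p a -> forall m, (m.+1)%:R != 0 :> Qp.
Proof.
move=> pp HQ m; apply/eqP => m0; have Habs := Qp_abs HQ.
have a1 : a 1 = 1.
  have : a 1 * a 1 = a 1 * 1 by rewrite -(abs_mul Habs) !mulr1.
  by apply: mulfI; apply/eqP => /(abs_eq0 Habs) /eqP; rewrite oner_eq0.
have p0 : p%:R != 0 :> Qp.
  apply/eqP => /(abs_eq0 Habs); rewrite (abs_Qp_p HQ) => /eqP.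
  by rewrite invr_eq0 pnatr_eq0 -leqn0 leqNgt prime_gt0.
have [M cop ME] := pfactor_coprime pp (ltn0Sn m).
have M0 : M%:R = 0 :> Qp.
  move: m0; rewrite ME natrM natrX => /eqP.
  by rewrite mulf_eq0 expf_eq0 (negPf p0) andbF orbF => /eqP.
have Mgt0 : (0 < M)%N by case: M ME {cop M0} => //; rewrite mul0n.
have modM n : n%:R = (n %% M)%:R :> Qp.
  by rewrite {1}(divn_eq n M) natrD natrM M0 mulr0 add0r.
have pk : p%:R ^+ totient M = 1 :> Qp.
  by rewrite -natrX modM (Euler_exp_totient cop) -modM.
have := congr1 a pk; rewrite a1.
have -> k : a (p%:R ^+ k) = p%:R^-1 ^+ k.
  elim: k => [|k IH]; first by rewrite !expr0.
  by rewrite !exprS (abs_mul Habs) IH (abs_Qp_p HQ).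
have pR : 0 < p%:R :> R by rewrite ltr0n prime_gt0.
have p1 : p%:R^-1 < 1 :> R by rewrite invf_lt1 // ltr1n prime_gt1.
move/eqP; rewrite lt_eqF // exprn_ilt1 ?invr_ge0 ?(ltW pR) //.
by rewrite -lt0n totient_gt0.
Qed.

Lemma char0_rmorph (K : nzRingType) (L : fieldType) (f : {rmorphism L -> K}) :
  (forall m, (m.+1)%:R != 0 :> L) -> forall m, (m.+1)%:R != 0 :> K.
Proof.
by move=> H m; rewrite -(rmorph_nat f); apply/eqP => /eqP; rewrite fmorph_eq0 (negPf (H m)).
Qed.

(** * Uniqueness of lifts of algebraic elements *)

Section SectionUnique.
Context (F Fbar C : fieldType) (Bp : idomainType) (iF : {rmorphism F -> Fbar}).
Context (th : {rmorphism Bp -> C}) (f1 f2 : {rmorphism Fbar -> Bp}).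
Hypothesis char0 : forall m, (m.+1)%:R != 0 :> F.
Hypothesis algF : forall z, algebraicOver iF z.
Hypothesis f12 : forall a, f1 (iF a) = f2 (iF a).
Hypothesis th12 : forall z, th (f1 z) = th (f2 z).

(** A polynomial [q] of least size over [F] killing [z] is separable at [z]. Expanding its image [Q]
    at [f1 z] gives [0 = (f2 z - f1 z) * (Q'(f1 z) + (f2 z - f1 z) * e)], where the second factor
    has as residue the nonzero image of [q'(z)]. *)
Lemma section_unique z : f1 z = f2 z.
Proof.
pose ann k := `[< exists q : {poly F}, [/\ q != 0, root (map_poly iF q) z & size q = k] >].
have exk : exists k, ann k.
  by have [q q0 qz] := algF z; exists (size q); apply/asboolP; exists q.
have [k /asboolP [q [q0 qz sq]] mink] := ex_minnP exk.
have q'z : ~~ root (map_poly iF q^`()) z.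
  apply/negP => rz; have q'0 : q^`() != 0.
    have sq1 : (1 < size q)%N.
      rewrite ltnNge; apply/negP => /size1_polyC qE; move: qz q0.
      by rewrite qE map_polyC rootC fmorph_eq0 polyC_eq0 => ->.
    apply/eqP => /(congr1 (fun p : {poly F} => p`_(size q).-2)).
    rewrite /= coef_deriv coef0.
    have -> : ((size q).-2.+1 = (size q).-1)%N by lia.
    rewrite -lead_coefE -mulr_natr => /eqP.
    rewrite mulf_eq0 lead_coef_eq0 (negPf q0) /=.
    by case: (size q) sq1 => [|[|l]] // _; rewrite (negPf (char0 _)).
  have : (k <= size q^`())%N by apply: mink; apply/asboolP; exists q^`().
  by rewrite leqNgt -sq lt_size_deriv.
pose Q := map_poly f1 (map_poly iF q).
have Q1 : Q.[f1 z] = 0 by rewrite horner_map; move/rootP: qz => ->; rewrite rmorph0.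
have Q2 : Q.[f2 z] = 0.
  have -> : Q = map_poly f2 (map_poly iF q).
    by apply/polyP => i; rewrite !coef_map_id0 ?rmorph0 // f12.
  by rewrite horner_map; move/rootP: qz => ->; rewrite rmorph0.
have [e] := horner_taylor2 Q (f1 z) (f2 z - f1 z).
rewrite [f1 z + _]addrC subrK Q1 Q2 add0r expr2 -mulrA -mulrDr => /esym/eqP.
rewrite mulf_eq0 subr_eq0 => /orP[/eqP //|/eqP /(congr1 th)].
rewrite rmorphD [th (_ * e)]rmorphM rmorphB th12 subrr mul0r addr0 rmorph0.
rewrite /Q !deriv_map horner_map => /eqP; rewrite (fmorph_eq0 (th \o f1)).
by move: q'z; rewrite rootE => /negPf ->.
Qed.

End SectionUnique.

Lemma map_mx_unit (R S : comUnitRingType) (g : {rmorphism R -> S}) n (M : 'M[R]_n) :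
  M \in unitmx -> map_mx g M \in unitmx.
Proof. by rewrite !unitmxE det_map_mx; apply: rmorph_unit. Qed.

Lemma map_mx_inv (R S : comUnitRingType) (g : {rmorphism R -> S}) n (M : 'M[R]_n) :
  M \in unitmx -> map_mx g (invmx M) = invmx (map_mx g M).
Proof.
move=> U; have U' := map_mx_unit g U.
by rewrite -[LHS](mulKmx U') -map_mxM mulmxV // map_mx1 mulmx1.
Qed.

Section Functoriality.
Context (k : fieldType) (n : nat) (G : linear_group k n).

Lemma mmap_rmorph (N : nat) (R S : comNzRingType) (g : {rmorphism R -> S})
  (f : {rmorphism k -> R}) (v : 'I_N -> R) (q : {mpoly k[N]}) :
  g (mmap f v q) = mmap (g \o f) (g \o v) q.
Proof.
rewrite /mmap rmorph_sum; apply: eq_bigr => m _; rewrite rmorphM /mmap1 rmorph_prod.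
by congr (_ * _); apply: eq_bigr => i _; rewrite rmorphXn.
Qed.

Lemma mmap_ext (N : nat) (R : comNzRingType) (f f' : k -> R) (v v' : 'I_N -> R)
  (q : {mpoly k[N]}) : f =1 f' -> v =1 v' -> mmap f v q = mmap f' v' q.
Proof. by move=> /funext -> /funext ->. Qed.

Lemma mxvec_map (R S : nzRingType) (g : R -> S) (M : 'M[R]_n) :
  (fun l => mxvec (map_mx g M) 0 l) = g \o (fun l => mxvec M 0 l).
Proof. by apply/funext => l; rewrite -map_mxvec mxE. Qed.

Lemma points_map (R S : comUnitRingType) (g : {rmorphism R -> S})
  (f : {rmorphism k -> R}) (M : 'M[R]_n) :
  points G f M -> points G (g \o f) (map_mx g M).
Proof.
move=> [U E]; split=> [|q Sq]; first exact: map_mx_unit.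
by rewrite mxvec_map -mmap_rmorph (E q Sq) rmorph0.
Qed.

Lemma points_inj (R S : comUnitRingType) (g : {rmorphism R -> S})
  (f : {rmorphism k -> R}) (M : 'M[R]_n) : injective g -> M \in unitmx ->
  points G (g \o f) (map_mx g M) -> points G f M.
Proof.
move=> gI U [_ E]; split=> // q Sq; apply: gI.
by rewrite rmorph0 -(E q Sq) mmap_rmorph mxvec_map.
Qed.

Lemma rho_map (r : rep G) (R S : comUnitRingType) (g : {rmorphism R -> S})
  (f : {rmorphism k -> R}) (M : 'M[R]_n) : M \in unitmx ->
  map_mx g (rho r f M) = rho r (g \o f) (map_mx g M).
Proof.
move=> U; rewrite /rho /rep_at map_mxZ; congr (_ *: _).
  by rewrite rmorphV ?unitrX // rmorphXn det_map_mx.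
by apply/matrixP => a b; rewrite !mxE mmap_rmorph mxvec_map.
Qed.

Lemma rho1 (r : rep G) (R : comUnitRingType) (f : {rmorphism k -> R}) :
  rho r f 1%:M = 1%:M.
Proof. exact: rep_1. Qed.

Lemma rhoM (r : rep G) (R : comUnitRingType) (f : {rmorphism k -> R}) g h :
  points G f g -> points G f h -> rho r f (g *m h) = rho r f g *m rho r f h.
Proof. exact: rep_mul. Qed.

Lemma rho_inv (r : rep G) (R : comUnitRingType) (f : {rmorphism k -> R}) g :
  points G f g -> rho r f g \in unitmx /\ rho r f (invmx g) = invmx (rho r f g).
Proof.
move=> Hg; have [U _] := Hg; have Hi := points_inv Hg.
have E : rho r f g *m rho r f (invmx g) = 1%:M by rewrite -rhoM // mulmxV // rho1.
have [Ur _] := mulmx1_unit E; split => //.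
by rewrite -[LHS](mulKmx Ur) E mulmx1.
Qed.

End Functoriality.

(** * Weight decompositions *)

(** The substitute for a generic point of the multiplicative group: in characteristic 0 the positive
    integers are pairwise distinct, so there are more roots than the degree allows. In a field they
    are also units, hence legitimate arguments of a cocharacter. *)
Lemma poly_nat_eq0 (R : idomainType) (q : {poly R}) :
  (forall m, (m.+1)%:R != 0 :> R) -> (forall m, q.[(m.+1)%:R] = 0) -> q = 0.
Proof.
move=> char0 Hq; apply/eqP/negP => /negP q0.
pose s : seq R := [seq (m.+1)%:R | m <- iota 0 (size q)].
have := @max_poly_roots _ q s q0; rewrite size_map size_iota ltnn.
suff H : all (root q) s /\ uniq s by case: H => -> ->; move=> /(_ isT isT).
split; first by apply/allP => _ /mapP[m _ ->]; rewrite rootE Hq.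
rewrite map_inj_in_uniq ?iota_uniq // => a b _ _.
wlog ab : a b / (a <= b)%N => [H E|/eqP].
  by have [ab|/ltnW ba] := leqP a b; [apply: H|apply/esym/H].
rewrite eq_sym -subr_eq0 -natrB // subSS => /eqP E; apply/eqP; rewrite eqn_leq ab /=.
by move: E; rewrite -subn_eq0; case: (b - a)%N => // m /eqP; rewrite (negPf (char0 _)).
Qed.

Lemma mx_nat_eq0 (R : idomainType) m p d (E : 'I_d -> 'M[R]_(m, p)) :
  (forall l, (l.+1)%:R != 0 :> R) ->
  (forall l, \sum_(k < d) (l.+1)%:R ^+ k *: E k = 0) -> forall k, E k = 0.
Proof.
move=> char0 H k; apply/matrixP => a b; rewrite mxE.
pose q := \poly_(l < d) (if insub l is Some l' then E l' a b else 0).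
have q0 : q = 0.
  apply: poly_nat_eq0 => // l; rewrite horner_poly.
  have := congr1 (fun M : 'M[R]_(m, p) => M a b) (H l); rewrite [RHS]mxE summxE; apply: etrans.
  by apply: eq_bigr => i _; rewrite valK mxE mulrC.
by have := congr1 (fun r : {poly R} => r`_k) q0; rewrite coef_poly ltn_ord coef0 valK.
Qed.

(** * Regular functions on the multiplicative group *)

Section Laurent.
Context (K : fieldType).

Definition family := forall R : comUnitRingType, {rmorphism K -> R} -> R -> R.

(** A regular function on the multiplicative group over [K], known through its values on the units
    of all [K]-algebras. The same [N] and [q] serve all algebras, which later allows evaluation in
    [C], [Bp] and [B]. *)
Definition laurent (phi : family) : Prop :=
  exists N (q : {poly K}), forall (R : comUnitRingType) (f : {rmorphism K -> R}) t,
    t \is a GRing.unit -> phi R f t = t ^- N * (map_poly f q).[t].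

Lemma laurent_ext (phi psi : family) :
  (forall R f t, t \is a GRing.unit -> phi R f t = psi R f t) ->
  laurent phi -> laurent psi.
Proof. by move=> E [N [q H]]; exists N, q => R f t Ut; rewrite -E // H. Qed.

Lemma laurentD (phi psi : family) : laurent phi -> laurent psi ->
  laurent (fun R f t => phi R f t + psi R f t).
Proof.
move=> [N [p Hp]] [M [q Hq]]; exists (N + M)%N, ('X^M * p + 'X^N * q) => R f t Ut.
rewrite Hp // Hq // rmorphD !rmorphM /= !map_polyXn hornerD !hornerM !hornerXn.
rewrite exprD invrM ?unitrX //; set P := _.[t]; set Q := _.[t].
have -> : t ^- M * t ^- N * (t ^+ M * P + t ^+ N * Q)
  = (t ^- M * t ^+ M) * (t ^- N * P) + (t ^- N * t ^+ N) * (t ^- M * Q) by ring.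
by rewrite !mulVr ?unitrX // !mul1r.
Qed.

Lemma laurentM (phi psi : family) : laurent phi -> laurent psi ->
  laurent (fun R f t => phi R f t * psi R f t).
Proof.
move=> [N [p Hp]] [M [q Hq]]; exists (N + M)%N, (p * q) => R f t Ut.
rewrite Hp // Hq // rmorphM hornerM exprD invrM ?unitrX //; ring.
Qed.

Lemma laurentC (phi : family) c :
  (forall (R : comUnitRingType) (f : {rmorphism K -> R}) t, phi R f t = f c) -> laurent phi.
Proof.
by move=> E; exists 0%N, c%:P => R f t _; rewrite E map_polyC hornerC invr1 mul1r.
Qed.

Lemma laurent0 : laurent (fun R f t => 0).
Proof. by apply: (@laurentC _ 0) => R f t; rewrite rmorph0. Qed.

Lemma laurent1 : laurent (fun R f t => 1).
Proof. by apply: (@laurentC _ 1) => R f t; rewrite rmorph1. Qed.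

Lemma laurentX (phi : family) m : laurent phi -> laurent (fun R f t => phi R f t ^+ m).
Proof.
move=> H; elim: m => [|m IH]; first exact: laurent_ext laurent1.
by apply: laurent_ext (laurentM H IH) => R f t _; rewrite exprS.
Qed.

Lemma laurent_sum (I : Type) (s : seq I) (P : pred I) (phi : I -> family) :
  (forall i, laurent (phi i)) -> laurent (fun R f t => \sum_(i <- s | P i) phi i R f t).
Proof.
move=> H; elim: s => [|i s IH].
  by apply: laurent_ext laurent0 => R f t _; rewrite big_nil.
case Pi: (P i).
  by apply: laurent_ext (laurentD (H i) IH) => R f t _; rewrite big_cons Pi.
by apply: laurent_ext IH => R f t _; rewrite big_cons Pi.
Qed.

Lemma laurent_prod (I : Type) (s : seq I) (P : pred I) (phi : I -> family) :
  (forall i, laurent (phi i)) -> laurent (fun R f t => \prod_(i <- s | P i) phi i R f t).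
Proof.
move=> H; elim: s => [|i s IH].
  by apply: laurent_ext laurent1 => R f t _; rewrite big_nil.
case Pi: (P i).
  by apply: laurent_ext (laurentM (H i) IH) => R f t _; rewrite big_cons Pi.
by apply: laurent_ext IH => R f t _; rewrite big_cons Pi.
Qed.

Lemma laurent_var : laurent (fun R f t => t).
Proof. by exists 0%N, 'X => R f t _; rewrite map_polyX hornerX invr1 mul1r. Qed.

Lemma laurent_varV : laurent (fun R f t => t^-1).
Proof. by exists 1%N, 1 => R f t _; rewrite rmorph1 hornerC mulr1. Qed.

Lemma laurent_inv (phi : family) : laurent phi ->
  laurent (fun R f t => phi R f t^-1).
Proof.
move=> [N [p Hp]].
apply: (@laurent_ext (fun R f t =>
  t ^+ N * \sum_(i < size p) f p`_i * t^-1 ^+ i)).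
  move=> R f t Ut; rewrite Hp ?unitrV // exprVn invrK; congr (_ * _).
  rewrite (@horner_coef_wide _ (size p)) ?size_poly //.
  by apply: eq_bigr => i _; rewrite coef_map.
apply: (laurentM (laurentX N laurent_var)); apply: laurent_sum => i.
apply: laurentM; first exact: laurentC.
exact: laurentX laurent_varV.
Qed.

Lemma laurent_mmap (k : fieldType) (i : {rmorphism k -> K}) (n : nat) (phi : 'I_n -> family)
  (q : {mpoly k[n]}) : (forall l, laurent (phi l)) ->
  laurent (fun R f t => mmap (f \o i) (fun l => phi l R f t) q).
Proof.
move=> H; rewrite /mmap; apply: laurent_sum => m; apply: laurentM.
  exact: (@laurentC _ (i q@_m)).
by rewrite /mmap1; apply: laurent_prod => l; apply: laurentX.
Qed.

Lemma laurent_det (n : nat) (phi : 'I_n -> 'I_n -> family) :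
  (forall a b, laurent (phi a b)) ->
  laurent (fun R f t => \det (\matrix_(a, b) phi a b R f t)).
Proof.
move=> H; rewrite /determinant; apply: laurent_sum => s.
apply: laurentM.
  by apply: (@laurentC _ ((-1) ^+ s)) => R f t; rewrite rmorph_sign.
apply: (@laurent_ext (fun R f t => \prod_a phi a (s a) R f t)).
  by move=> R f t _; apply: eq_bigr => a _; rewrite mxE.
exact: laurent_prod.
Qed.

Lemma laurent_mx m (phi : 'I_m -> 'I_m -> family) :
  (forall a b, laurent (phi a b)) ->
  exists N d (e : 'I_d -> 'M[K]_m), forall R f t, t \is a GRing.unit ->
    \matrix_(a, b) phi a b R f t = t ^- N *: \sum_(k < d) t ^+ k *: map_mx f (e k).
Proof.
move=> H; have {H} H' (ab : 'I_m * 'I_m) : {Nq : nat * {poly K} |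
    forall (R : comUnitRingType) (f : {rmorphism K -> R}) t, t \is a GRing.unit ->
      phi ab.1 ab.2 R f t = t ^- Nq.1 * (map_poly f Nq.2).[t]}.
  by apply: cid; have [N [q Hq]] := H ab.1 ab.2; exists (N, q).
pose N := \sum_ab (sval (H' ab)).1.
pose Q ab := 'X^(N - (sval (H' ab)).1) * (sval (H' ab)).2.
pose d := \max_ab size (Q ab).
exists N, d, (fun k => \matrix_(a, b) (Q (a, b))`_k) => R f t Ut.
apply/matrixP => a b; rewrite !mxE summxE.
have HN : ((sval (H' (a, b))).1 <= N)%N by rewrite /N (bigD1 (a, b)) //= leq_addr.
have -> : \sum_(k < d) (t ^+ k *: map_mx f (\matrix_(a, b) (Q (a, b))`_k)) a b
    = (map_poly f (Q (a, b))).[t].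
  rewrite (@horner_coef_wide _ d).
    by apply: eq_bigr => k _; rewrite !mxE coef_map mulrC.
  by apply: leq_trans (size_poly _ _) _; rewrite /d (bigD1 (a, b)) //= leq_maxl.
rewrite (svalP (H' (a, b)) R f t Ut) /Q /= rmorphM hornerM /= map_polyXn hornerXn mulrA; congr (_ * _).
apply: (mulrI (unitrX N Ut)); rewrite mulrA divrr ?unitrX // mul1r.
by rewrite -{1}(subnK HN) exprD -mulrA divrr ?unitrX // mulr1.
Qed.

End Laurent.

(** The projectors on the weight spaces of an action of the multiplicative group. Some [e k] may be
    0, so [d] only bounds the range of the weights. *)
Record grading (K : nzRingType) m d (e : 'I_d -> 'M[K]_m) : Prop := Grading {
  grading_orth : forall k l, e k *m e l = if k == l then e k else 0;
  grading_sum : \sum_k e k = 1%:M }.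

Lemma grading_map (K L : nzRingType) (h : {rmorphism K -> L}) m d (e : 'I_d -> 'M[K]_m) :
  grading e -> grading (fun k => map_mx h (e k)).
Proof.
move=> [O S]; split=> [k l|].
  by rewrite -map_mxM O; case: ifP => // _; rewrite map_mx0.
by rewrite -(map_mx1 h) -S rmorph_sum.
Qed.

(** Write [A(t)] for the sum of the [t^k e_k]. Comparing coefficients of [s] in [A(s t) = A(s) A(t)]
    gives [t^k e_k = e_k A(t)], and comparing coefficients of [t] in this gives the
    orthogonality. *)
Lemma grading_of_mul (K : idomainType) m d (e : 'I_d -> 'M[K]_m) :
  (forall l, (l.+1)%:R != 0 :> K) ->
  (forall s t : nat, \sum_(k < d) (s.+1%:R * t.+1%:R) ^+ k *: e k
    = (\sum_(k < d) s.+1%:R ^+ k *: e k) *m (\sum_(k < d) t.+1%:R ^+ k *: e k)) ->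
  \sum_k e k = 1%:M -> grading e.
Proof.
move=> char0 H H1; split=> // k l.
have E1 (t : nat) (k' : 'I_d) : t.+1%:R ^+ k' *: e k' = e k' *m (\sum_(k < d) t.+1%:R ^+ k *: e k).
  apply/eqP; rewrite -subr_eq0; apply/eqP; move: k'.
  apply: mx_nat_eq0 => // s.
  under eq_bigr do rewrite scalerBr scalerA -exprMn scalemxAl.
  by rewrite sumrB -mulmx_suml H subrr.
have : (if k == l then e k else 0) - e k *m e l = 0.
  move: l; apply: mx_nat_eq0 => // s.
  under eq_bigr do rewrite scalerBr scalemxAr.
  rewrite sumrB -mulmx_sumr -E1 (bigD1 k) //= eqxx big1 ?addr0 ?subrr // => i.
  by rewrite eq_sym => /negPf ->; rewrite scaler0.
by move/eqP; rewrite subr_eq0 => /eqP.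
Qed.

Section Cochar.
Context (k : fieldType) (n : nat) (G : linear_group k n) (K : fieldType)
  (i : {rmorphism k -> K}) (mu : cochar G i).
Hypothesis char0 : forall l, (l.+1)%:R != 0 :> K.

Lemma unit_nat l : ((l.+1)%:R : K) \is a GRing.unit.
Proof. by rewrite unitfE. Qed.

Lemma cevM (R : comUnitRingType) (f : {rmorphism K -> R}) s t :
  s \is a GRing.unit -> t \is a GRing.unit ->
  cev mu f (s * t) = cev mu f s *m cev mu f t.
Proof. exact: cochar_mul. Qed.

Lemma cev_points (R : comUnitRingType) (f : {rmorphism K -> R}) t :
  t \is a GRing.unit -> points G (f \o i) (cev mu f t).
Proof. exact: cochar_points. Qed.

Lemma cev1 (R : comUnitRingType) (f : {rmorphism K -> R}) : cev mu f 1 = 1%:M.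
Proof.
have [U _] := cev_points f (unitr1 R).
by rewrite -[LHS](mulKmx U) -cevM ?unitr1 // mulr1 mulVmx.
Qed.

Lemma cevV (R : comUnitRingType) (f : {rmorphism K -> R}) t :
  t \is a GRing.unit -> invmx (cev mu f t) = cev mu f t^-1.
Proof.
move=> Ut; have [U _] := cev_points f Ut.
by rewrite -[RHS](mulKmx U) -cevM ?unitrV // divrr // cev1 mulmx1.
Qed.

Lemma laurent_cev a b : laurent (fun R f t => cev mu f t a b).
Proof.
exists (cdenom mu), (cnum mu a b) => R f t _.
by rewrite /cev /cochar_at !mxE.
Qed.

(** The index [k] stands for the weight [k - N]: the common denominator keeps the indices in
    [nat]. *)
Definition diagonalizes m (A : forall R : comUnitRingType, {rmorphism K -> R} -> R -> 'M[R]_m)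
    (N d : nat) (e : 'I_d -> 'M[K]_m) : Prop :=
  grading e /\ forall R f t, t \is a GRing.unit ->
    A R f t = t ^- N *: \sum_(k < d) t ^+ k *: map_mx f (e k).

Lemma laurent_diagonalizes m
    (A : forall R : comUnitRingType, {rmorphism K -> R} -> R -> 'M[R]_m) :
  (forall a b, laurent (fun R f t => A R f t a b)) ->
  (forall s t : K, s \is a GRing.unit -> t \is a GRing.unit ->
     A K idfun (s * t) = A K idfun s *m A K idfun t) ->
  A K idfun 1 = 1%:M ->
  exists N d (e : 'I_d -> 'M[K]_m), diagonalizes A N e.
Proof.
move=> L AM A1; have [N [d [e E]]] := laurent_mx L.
have {}E R f t : t \is a GRing.unit ->
    A R f t = t ^- N *: \sum_(k < d) t ^+ k *: map_mx f (e k).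
  by move=> Ut; rewrite -E //; apply/matrixP => a b; rewrite mxE.
exists N, d, e; split=> //; apply: grading_of_mul => // [s t|].
  have Us := unit_nat s; have Ut := unit_nat t.
  have := AM _ _ Us Ut; rewrite !E ?unitrM ?Us ?Ut //.
  under eq_bigr do rewrite map_mx_id //.
  under [X in _ = (_ *: X) *m _]eq_bigr do rewrite map_mx_id //.
  under [X in _ = _ *m (_ *: X)]eq_bigr do rewrite map_mx_id //.
  rewrite -scalemxAl -scalemxAr scalerA exprMn invrM ?unitrX // [X in X *: _ = _]mulrC.
  by apply: scalerI; rewrite mulf_neq0 // invr_eq0 expf_neq0.
have := E K idfun 1 (unitr1 _); rewrite A1 expr1n invr1 scale1r => ->.
by apply: eq_bigr => j _; rewrite expr1n scale1r map_mx_id.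
Qed.

Lemma cev_diagonalizes : exists N d (e : 'I_d -> 'M[K]_n),
  diagonalizes (fun R f t => cev mu f t) N e.
Proof.
apply: laurent_diagonalizes => [a b|s t Us Ut|].
- exact: laurent_cev.
- exact: cevM.
- exact: cev1.
Qed.

(** The inverse determinant in [rho] causes no denominators: [mu(t)^-1 = mu(t^-1)], so it is again a
    determinant of Laurent polynomials. *)
Lemma rho_diagonalizes (r : rep G) : exists N d (e : 'I_d -> 'M[K]_(rdim r)),
  diagonalizes (fun R f t => rho r (f \o i) (cev mu f t)) N e.
Proof.
apply: laurent_diagonalizes => [a b|s t Us Ut|].
- pose phi a b : family K := fun R f t => cev mu f t a b.
  apply: (@laurent_ext _ (fun R f t =>
    (\det (\matrix_(a, b) phi a b R f t^-1)) ^+ rdenom r *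
    mmap (f \o i) (fun l => mxvec (cev mu f t) 0 l) (rnum r a b))).
    move=> R f t Ut; rewrite /rho /rep_at !mxE; congr (_ * _).
    rewrite -exprVn; congr (_ ^+ _).
    have -> : \matrix_(a, b) phi a b R f t^-1 = invmx (cev mu f t).
      by rewrite cevV //; apply/matrixP => a' b'; rewrite mxE.
    by rewrite det_inv.
  apply: laurentM.
    apply: laurentX; apply: (@laurent_inv _ (fun R f t => \det (\matrix_(a, b) phi a b R f t))).
    by apply: laurent_det => a' b'; apply: laurent_cev.
  apply: laurent_mmap => l; case/mxvec_indexP: l => a' b'.
  by apply: laurent_ext (laurent_cev a' b') => R f t _; rewrite mxvecE.
- by rewrite cevM // rhoM //; apply: cev_points.
- by rewrite cev1 rho1.
Qed.

End Cochar.

Lemma expr_exprz (R : comUnitRingType) (t : R) (N k : nat) :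
  t \is a GRing.unit -> t ^- N * t ^+ k = t ^ (k%:Z - N%:Z).
Proof. by move=> Ut; rewrite exprzDr // -exprnN mulrC. Qed.

(** In characteristic 0 the element 2 has infinite order, so the single value [t = 2] separates the
    weights. *)
Lemma exprz2_inj (L : fieldType) : (forall l, (l.+1)%:R != 0 :> L) ->
  forall a b : int, (2 : L) ^ a = 2 ^ b -> a = b.
Proof.
move=> char0 a b; wlog ab : a b / a <= b => [H E|E].
  by have [ab|/ltW ba] := leP a b; [apply: H|apply/esym/H].
have two0 : (2 : L) != 0 by exact: (char0 1%N).
have [l bE] : exists l : nat, b = a + l%:Z by exists `|b - a|%N; lia.
move: E; rewrite bE expfzDr // -[X in X = _]mulr1 => /(mulfI (expfz_neq0 _ two0)) E.
case: l bE E => [|l _]; first by rewrite addr0.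
rewrite -exprnP -natrX => E.
have : (1 < 2 ^ l.+1)%N by rewrite -{1}(expn0 2) ltn_exp2l.
case: (2 ^ l.+1)%N E => [|[|c]] // /eqP; rewrite eq_sym -subr_eq0 -(@natrB _ c.+2 1) // subn1.
by rewrite (negPf (char0 _)).
Qed.

Section Weights.
Context (k : fieldType) (n : nat) (G : linear_group k n) (K : fieldType)
  (i : {rmorphism k -> K}) (mu : cochar G i) (r : rep G).
Context (N d : nat) (e : 'I_d -> 'M[K]_(rdim r)).
Hypothesis D : diagonalizes (fun R f t => rho r (f \o i) (cev mu f t)) N e.
Context (L : fieldType) (h : {rmorphism K -> L}).
Hypothesis char0 : forall l, (l.+1)%:R != 0 :> L.

Definition wt (q : 'I_d) : int := q%:Z - N%:Z.

Let eL q := map_mx h (e q).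

Lemma weight_vecP w v : weight_vec r mu h w v <->
  forall q, wt q != w -> eL q *m v = 0.
Proof.
have [Gr E] := D; have [O S] := grading_map h Gr; split=> [Hv q qw|Hv R f t Ut].
  have two0 : (2 : L) \is a GRing.unit by rewrite unitfE (char0 1%N).
  have E2 : rho r (idfun \o h \o i) (cev mu (idfun \o h) (2 : L)) *m map_mx idfun v = 2 ^ w *: map_mx idfun v.
    exact: Hv.
  have E3 : rho r (idfun \o h \o i) (cev mu (idfun \o h) (2 : L)) = 2 ^- N *: \sum_(q < d) 2 ^+ q *: eL q.
    exact: E.
  rewrite E3 map_mx_id // in E2.
  have := congr1 (mulmx (eL q)) E2; rewrite mulmxA -!scalemxAr mulmx_sumr (bigD1 q) //= big1.
    rewrite addr0 -scalemxAr O eqxx scalerA expr_exprz // -/(wt q) => E4.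
    have : (2 ^ wt q - 2 ^ w) *: (eL q *m v) = 0.
      by rewrite scalerBl -E4 scalemxAl subrr.
    move/eqP; rewrite scaler_eq0 subr_eq0 => /orP[/eqP /(exprz2_inj char0) H|/eqP //].
    by move: qw; rewrite H eqxx.
  by move=> q' q'q; rewrite -scalemxAr O eq_sym (negPf q'q) scaler0.
have -> : rho r (f \o h \o i) (cev mu (f \o h) t) = t ^- N *: \sum_(q < d) t ^+ q *: map_mx f (eL q).
  rewrite (E R (f \o h) t Ut); congr (_ *: _); apply: eq_bigr => q _.
  by rewrite /eL -map_mx_comp.
have vE : map_mx f v = \sum_q map_mx f (eL q) *m map_mx f v.
  have S' : \sum_q map_mx f (eL q) = 1%:M by rewrite -(map_mx1 f) -S rmorph_sum.
  by rewrite -mulmx_suml S' mul1mx.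
rewrite {2}vE -scalemxAl mulmx_suml !scaler_sumr; apply: eq_bigr => q _.
have [qw|qw] := eqVneq (wt q) w; last first.
  by rewrite -scalemxAl -map_mxM (Hv _ qw) map_mx0 !scaler0.
by rewrite -scalemxAl scalerA expr_exprz // -/(wt q) qw.
Qed.

Lemma weight_sumP P v : weight_sum r mu h P v <->
  forall q, ~ P (wt q) -> eL q *m v = 0.
Proof.
have [Gr E] := D; have [O S] := grading_map h Gr; split=> [[l [w [u [H ->]]]] q qP|Hv].
  rewrite mulmx_sumr big1 // => a _; have [Pa /weight_vecP Ha] := H a; apply: Ha.
  by apply/eqP => E1; apply: qP; rewrite E1.
pose s := enum [pred q : 'I_d | `[< P (wt q) >]].
pose q0 (a : 'I_(size s)) := tnth (in_tuple s) a.
exists (size s), (fun a => wt (q0 a)), (fun a => eL (q0 a) *m v); split=> [a|].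
  split.
    have : q0 a \in s by apply: mem_tnth.
    by rewrite mem_enum => /asboolP.
  apply/weight_vecP => q qw; rewrite mulmxA O; case: eqP => [qE|_]; last by rewrite mul0mx.
  by rewrite qE eqxx in qw.
rewrite -{1}[v]mul1mx -S mulmx_suml (bigID [pred q : 'I_d | `[< P (wt q) >]]) /= [X in _ + X]big1 ?addr0.
  by rewrite -big_enum /= -/s -(big_tnth _ _ _ xpredT (fun q => eL q *m v)).
by move=> q /asboolP; apply: Hv.
Qed.

End Weights.

Section Parabolic.
Context (L : fieldType) (m d : nat) (e : 'I_d -> 'M[L]_m) (Gr : grading e).

Definition vge (P : set 'I_d) : set 'cV[L]_m := [set v | forall q, ~ P q -> e q *m v = 0].

(** The condition on the blocks says that [gm] maps block [l] into blocks of index at least [l],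
    which gives one inclusion; equality follows because an injective map preserves dimensions. *)
Lemma vge_stable (gm : 'M[L]_m) (P : set 'I_d) : gm \in unitmx ->
  (forall q l : 'I_d, (q < l)%N -> e q *m gm *m e l = 0) ->
  (forall q l : 'I_d, (q <= l)%N -> P q -> P l) ->
  [set gm *m v | v in vge P] = vge P.
Proof.
move=> U low Pup; have [O S] := Gr.
have sub v : vge P v -> vge P (gm *m v).
  move=> Pv q nPq; rewrite -[v]mul1mx -S mulmx_suml !mulmx_sumr big1 // => l _.
  rewrite !mulmxA; have [ql|lq] := ltnP q l; first by rewrite low // mul0mx.
  have nPl : ~ P l by move=> Pl; apply: nPq; apply: Pup Pl.
  by rewrite -!mulmxA (Pv _ nPl) !mulmx0.
pose V : {vspace 'cV[L]_m} := (\bigcap_(q | `[< ~ P q >]) lker (linfun (mulmx (e q))))%VS.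
have VE v : v \in V <-> vge P v.
  split=> [Vv q nPq|Pv].
    have : (V <= lker (linfun (mulmx (e q))))%VS by apply: (bigcapv_inf q) => //; apply/asboolP.
    by move/subvP/(_ v Vv); rewrite memv_ker lfunE => /eqP.
  rewrite memvE; apply/subv_bigcapP => q /asboolP nPq; rewrite -memvE memv_ker lfunE /=.
  by rewrite Pv.
pose g := linfun (mulmx gm : 'cV[L]_m -> 'cV[L]_m).
have gV : (g @: V = V)%VS.
  apply/eqP; rewrite eqEdim; apply/andP; split.
    apply/subvP => _ /memv_imgP[v Vv ->]; rewrite lfunE /=.
    by apply/VE/sub/VE.
  rewrite limg_dim_eq //; apply/eqP; rewrite -subv0; apply/subvP => v.
  rewrite memv_cap memv_ker lfunE /= => /andP[_ /eqP gv0].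
  by rewrite memv0 -[v](mulKmx U) gv0 mulmx0.
apply/seteqP; split=> [_ [v Pv <-]|v Pv]; first exact: sub.
have : v \in (g @: V)%VS by rewrite gV; apply/VE.
by move/memv_imgP => [u Vu ->]; exists u; [apply/VE|rewrite lfunE].
Qed.

End Parabolic.

(** * Adapted bases *)

Section Columns.
Context (L : fieldType) (m : nat).

Lemma row_solve b (M : 'M[L]_(m, b)) (y : 'rV[L]_b) :
  (forall c : 'cV[L]_b, M *m c = 0 -> y *m c = 0) -> exists x, x *m M = y.
Proof.
move=> H; suff /submxP [x ->] : (y <= M)%MS by exists x.
rewrite submxE; apply/eqP/rowP => a; rewrite [RHS]mxE.
have E : y *m col a (cokermx M) = 0.
  by apply: H; rewrite colE mulmxA mulmx_coker mul0mx.
by have /matrixP /(_ 0 0) := E; rewrite colE mulmxA -colE [LHS]mxE [RHS]mxE.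
Qed.

Lemma left_inverse b (M : 'M[L]_(m, b)) :
  (forall c : 'cV[L]_b, M *m c = 0 -> c = 0) -> exists A, A *m M = 1%:M.
Proof.
move=> H; have /choice [A HA] : forall a : 'I_b, exists x : 'rV[L]_m, x *m M = row a 1%:M.
  by move=> a; apply: row_solve => c /H ->; rewrite mulmx0.
by exists (\matrix_a A a); apply/row_matrixP => a; rewrite row_mul rowK HA.
Qed.

Definition tcol p (X : p.-tuple 'cV[L]_m) : 'M[L]_(m, p) :=
  \matrix_(a, q) (tnth X q) a 0.

Lemma tcol_mul p (X : p.-tuple 'cV[L]_m) c :
  tcol X *m c = \sum_q c q 0 *: tnth X q.
Proof.
apply/matrixP => a b; rewrite mxE summxE ord1; apply: eq_bigr => q _.
by rewrite !mxE mulrC.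
Qed.

Lemma span_tcol p (X : p.-tuple 'cV[L]_m) v :
  v \in <<X>>%VS <-> exists c, v = tcol X *m c.
Proof.
split=> [Xv|[c ->]].
  exists (\col_q coord X q v); rewrite tcol_mul {1}(coord_span Xv).
  by apply: eq_bigr => q _; rewrite mxE -tnth_nth.
rewrite tcol_mul; apply: memv_suml => q _; apply: memvZ; apply: memv_span.
exact: mem_tnth.
Qed.

Lemma free_tcol p (X : p.-tuple 'cV[L]_m) : free X ->
  exists A, A *m tcol X = 1%:M.
Proof.
move=> /freeP FX; apply: left_inverse => c; rewrite tcol_mul => E.
apply/matrixP => q b; rewrite ord1 mxE; apply: (FX (fun q => c q 0)).
by apply: etrans E; apply: eq_bigr => q' _; rewrite -tnth_nth.
Qed.

End Columns.

Section Extend.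
Context (k L : fieldType) (f : {rmorphism k -> L}) (m : nat).
Implicit Types U W : {vspace 'cV[k]_m}.

Lemma tcol_map p (X : p.-tuple 'cV[k]_m) :
  tcol (map_tuple (map_mx f) X) = map_mx f (tcol X).
Proof. by apply/matrixP => a q; rewrite !mxE tnth_map mxE. Qed.

Lemma extendP W v : v \in extend_vspace f W <->
  exists c, v = map_mx f (tcol (vbasis W)) *m c.
Proof. by rewrite -tcol_map -span_tcol. Qed.

Lemma extend_mem W v : v \in W -> map_mx f v \in extend_vspace f W.
Proof.
rewrite -{1}(span_basis (vbasisP W)) => /span_tcol [c ->].
by rewrite map_mxM; apply/extendP; eexists.
Qed.

Lemma extend_sub U W : (U <= W)%VS -> (extend_vspace f U <= extend_vspace f W)%VS.
Proof.
move=> UW; apply/span_subvP => _ /mapP[v Uv ->]; apply: extend_mem.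
by apply: (subvP UW); apply: vbasis_mem.
Qed.

Lemma extend_add U W :
  extend_vspace f (U + W)%VS = (extend_vspace f U + extend_vspace f W)%VS.
Proof.
apply: subv_anti; apply/andP; split; last first.
  by rewrite subv_add !extend_sub ?addvSl ?addvSr.
apply/span_subvP => _ /mapP[_ /vbasis_mem /memv_addP [u Uu [w Ww ->]] ->].
by rewrite map_mxD memv_add ?extend_mem.
Qed.

Lemma extend_dim W : \dim (extend_vspace f W) = \dim W.
Proof.
have [A HA] := free_tcol (basis_free (vbasisP W)).
suff FX : free (map_tuple (map_mx f) (vbasis W)).
  by rewrite /extend_vspace -[map _ _]/(val (map_tuple (map_mx f) (vbasis W))) (eqnP FX) size_tuple.
apply/freeP => c Hc q.
have E : map_mx f (tcol (vbasis W)) *m (\col_q c q) = 0.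
  rewrite -tcol_map tcol_mul; apply: etrans Hc; apply: eq_bigr => q' _.
  by rewrite mxE -tnth_nth.
have := congr1 (mulmx (map_mx f A)) E.
rewrite mulmxA -map_mxM HA map_mx1 mul1mx mulmx0 => /matrixP /(_ q 0).
by rewrite !mxE.
Qed.

End Extend.

Section Adapted.
Context (L : fieldType) (m : nat) (U W : {vspace 'cV[L]_m}).
Hypothesis UW : (U <= W)%VS.
Context (Fl : int -> {vspace 'cV[L]_m}) (lo hi : int).
Hypothesis Fl_lo : forall w : int, w <= lo -> Fl w = fullv.
Hypothesis Fl_hi : forall w : int, hi <= w -> Fl w = 0%VS.
Hypothesis Fl_dec : forall w w' : int, w <= w' -> (Fl w' <= Fl w)%VS.

Let H w := ((Fl w :&: W) + U)%VS.

Let vecs (s : seq ('cV[L]_m * int)) (w : int) := [seq p.1 | p <- s & w <= p.2].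

(** Descending from [hi], where [H] is [U], each step adds a basis of a complement to [H (c + 1)]
    inside [Fl c :&: W]. The vectors are taken in [Fl c :&: W] itself, not merely modulo [U], and
    each carries the step at which it appears. *)
Lemma adapted_list (l : nat) : exists s : seq ('cV[L]_m * int),
  (forall p, p \in s -> p.1 \in (Fl p.2 :&: W)%VS /\ hi - l%:Z <= p.2) /\
  (forall w : int, hi - l%:Z <= w -> basis_of (H w) (vecs s w ++ vbasis U)).
Proof.
elim: l => [|l [s [Hs Bs]]].
  exists [::]; split=> // w; rewrite subr0 => hw.
  by rewrite /H Fl_hi // cap0v add0v vbasisP.
set c := hi - l.+1%:Z; have c1 : hi - l%:Z = c + 1 by rewrite /c; lia.
rewrite c1 in Hs Bs.
pose D := ((Fl c :&: W) :\: H (c + 1))%VS.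
exists ([seq (x, c) | x <- vbasis D] ++ s); split=> [p|w cw].
  rewrite mem_cat => /orP[/mapP[x xD ->] /=|/Hs [? ?]]; last by split=> //; lia.
  by split=> //; apply: (subvP (diffvSl _ _)); apply: vbasis_mem xD.
have [wc|cw'] := eqVneq w c; last first.
  have cw1 : c + 1 <= w by lia.
  rewrite /vecs filter_cat (_ : [seq p <- [seq (x, c) | x <- vbasis D] | w <= p.2] = [::]).
    exact: Bs.
  apply/eqP; rewrite -(negbK (_ == _)) -has_filter; apply/hasPn => _ /mapP[x _ ->] /=.
  by rewrite -ltNge; lia.
rewrite wc /vecs filter_cat (_ : [seq p <- [seq (x, c) | x <- vbasis D] | c <= p.2] = [seq (x, c) | x <- vbasis D]).
  rewrite (_ : [seq p <- s | c <= p.2] = [seq p <- s | c + 1 <= p.2]).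
    rewrite map_cat -map_comp map_id -catA.
    have -> : H c = (D + H (c + 1))%VS.
      rewrite addv_diff /H addvA; congr (_ + _)%VS; apply/esym/addv_idPl.
      by apply: capvS => //; apply: Fl_dec; lia.
    apply: cat_basis; [|exact: vbasisP|exact: Bs].
    by rewrite directv_addE /= !directv_trivial /= capv_diff.
  apply: eq_in_filter => p /Hs [_ Hp]; by rewrite Hp; apply: le_trans Hp; rewrite lerDl.
by apply/all_filterP/allP => _ /mapP[x _ ->].
Qed.

(** Besides a basis [V] of [W / U] adapted to the filtration, dual forms are needed: row [q] of [Y]
    has to vanish on all of [Fl (w q + 1)], not only on its intersection with [W], because the
    comparison with lattices splits vectors of [W] into components that leave [W]. *)
Lemma adapted_basis e : (\dim U + e = \dim W)%N ->
  exists (V : 'M[L]_(m, e)) (w : 'I_e -> int) (Y : 'M[L]_(e, m)),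
  [/\ forall q, col q V \in (Fl (w q) :&: W)%VS,
      Y *m V = 1%:M,
      forall v, v \in U -> Y *m v = 0,
      forall q v, v \in Fl (w q + 1) -> row q Y *m v = 0
    & forall c : int, \dim (H c) = (\dim U + \sum_q (c <= w q)%R)%N].
Proof.
move=> dimE.
have [s [Hs Bs]] := adapted_list `|hi - lo|%N.
set c0 := hi - _ in Hs Bs.
have c0lo : c0 <= lo by rewrite /c0; lia.
have HW (c : int) : c <= lo -> H c = W.
  by move=> clo; rewrite /H Fl_lo // capfv; apply/addv_idPl.
have Hsall : [seq p <- s | c0 <= p.2] = s by apply/all_filterP/allP => p /Hs [].
have dimH (c : int) : c0 <= c -> \dim (H c) = (size [seq p <- s | (c <= p.2)%R] + \dim U)%N.
  move=> cc; have BH := Bs c cc.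
  by rewrite -(span_basis BH) (eqnP (basis_free BH)) size_cat size_map size_tuple.
have sz : size s = e.
  by have := dimH c0 (lexx _); rewrite HW // Hsall -dimE addnC => /addIn.
pose w (q : 'I_e) : int := (nth (0, 0) s q).2.
have Xsz : size ([seq p.1 | p <- s] ++ vbasis U) == (e + \dim U)%N.
  by rewrite size_cat size_map sz size_tuple.
pose X := Tuple Xsz.
have FX : free X by have := basis_free (Bs c0 (lexx _)); rewrite /vecs Hsall.
have [A HA] := free_tcol FX.
pose A1 := usubmx A.
have AX (q : 'I_e) i : row q A1 *m tnth X i = (lshift _ q == i)%:R%:M.
  have := congr1 (fun M : 'M_(_, _) => M (lshift _ q) i) HA; rewrite [RHS]mxE => E.
  apply/matrixP => a b; rewrite !ord1 [RHS]mxE eqxx mulr1n -E [RHS]mxE mxE.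
  by apply: eq_bigr => l _; rewrite !mxE.
have Xl (q : 'I_e) : tnth X (lshift _ q) = (nth (0, 0) s q).1.
  by rewrite (tnth_nth 0) /= nth_cat size_map sz ltn_ord (nth_map (0, 0)) ?sz.
have ws (q : 'I_e) : nth (0, 0) s q \in s by rewrite mem_nth ?sz.
have AU v : v \in U -> A1 *m v = 0.
  rewrite -{1}(span_basis (vbasisP U)) => /span_tcol [c ->].
  apply/row_matrixP => q; rewrite row0 mulmxA row_mul row_mul -[RHS](mul0mx _ c); congr (_ *m _).
  apply/rowP => i; have := AX q (rshift e i).
  have -> : tnth X (rshift e i) = tnth (vbasis U) i.
    by rewrite !(tnth_nth 0) /= nth_cat size_map sz ltnNge leq_addr addKn.
  rewrite eq_lrshift => /matrixP /(_ 0 0); rewrite !mxE eqxx => E.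
  apply: etrans E.
  by apply: eq_bigr => l _; rewrite !mxE.
have AH q v : v \in H (w q + 1) -> row q A1 *m v = 0.
  have cw : c0 <= w q + 1 by have [_ h] := Hs _ (ws q); apply: le_trans h _; rewrite lerDl.
  rewrite -(span_basis (Bs _ cw)) => Hv.
  suff : (<<vecs s (w q + 1)%R ++ vbasis U>> <= lker (linfun (mulmx (row q A1) : 'cV[L]_m -> 'cV[L]_1)))%VS.
    by move/subvP/(_ v Hv); rewrite memv_ker lfunE => /eqP.
  apply/span_subvP => x; rewrite mem_cat memv_ker lfunE /= => /orP[|/vbasis_mem Ux]; last first.
    by rewrite -row_mul AU // row0.
  move/mapP => [p]; rewrite mem_filter => /andP[wp ps] ->.
  have ip : (index p s < e)%N by rewrite -sz index_mem.
  have := AX q (lshift _ (Ordinal ip)); rewrite Xl nth_index // => ->.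
  rewrite eq_lshift; case: (q =P _) => [qp|_].
    by move: wp; rewrite /w qp /= nth_index // gerDl.
  by apply/eqP/matrixP => a b; rewrite !mxE mul0rn.
(* On [W] the form from the dual basis kills [W :&: Fl (w q + 1)], so it extends by 0 to
   [Fl (w q + 1)]. *)
have /choice [y Hy] : forall q, exists x : 'rV[L]_m,
    (forall v, v \in W -> x *m v = row q A1 *m v) /\
    (forall v, v \in Fl (w q + 1) -> x *m v = 0).
  move=> q; pose MW := tcol (vbasis W); pose MF := tcol (vbasis (Fl (w q + 1))).
  have inW v : v \in W <-> exists c, v = MW *m c.
    by rewrite -{1}(span_basis (vbasisP W)) span_tcol.
  have inF v : v \in Fl (w q + 1) <-> exists c, v = MF *m c.
    by rewrite -{1}(span_basis (vbasisP (Fl (w q + 1)))) span_tcol.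
  have [|x] := @row_solve _ _ _ (row_mx MW MF) (row_mx (row q A1 *m MW) 0).
    move=> c; rewrite -(vsubmxK c) !mul_row_col mul0mx addr0 => E.
    have E' : MW *m usubmx c = MF *m (- dsubmx c).
      by rewrite mulmxN; apply/eqP; rewrite -addr_eq0 E.
    rewrite -mulmxA AH // /H; apply: (subvP (addvSl _ _)); rewrite memv_cap.
    apply/andP; split; [apply/inF|apply/inW]; last by eexists.
    by rewrite E'; eexists.
  rewrite mul_mx_row => /eq_row_mx [E1 E2]; exists x; split=> v.
    by move/inW => [c ->]; rewrite !mulmxA E1.
  by move/inF => [c ->]; rewrite mulmxA E2 mul0mx.
pose Y := \matrix_q y q.
have rY q : row q Y = y q by rewrite rowK.
have colV q : col q (lsubmx (tcol X)) = tnth X (lshift _ q).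
  by apply/matrixP => a b; rewrite !mxE ord1.
have colVin q : col q (lsubmx (tcol X)) \in (Fl (w q) :&: W)%VS.
  by rewrite colV Xl; have [] := Hs _ (ws q).
exists (lsubmx (tcol X)), w, Y; split=> //.
- apply/matrixP => q q'.
  have -> : (Y *m lsubmx (tcol X)) q q' = (row q Y *m col q' (lsubmx (tcol X))) 0 0.
    by rewrite !mxE; apply: eq_bigr => l _; rewrite !mxE.
  have := colVin q'; rewrite memv_cap => /andP[_ Wv].
  by rewrite rY (Hy q).1 // colV AX !mxE eq_lshift eqxx mulr1n.
- move=> v Uv; apply/row_matrixP => q; rewrite row0 row_mul rY (Hy q).1.
    by rewrite -row_mul AU // row0.
  by apply: (subvP UW).
- by move=> q v Fv; rewrite rY (Hy q).2.
- move=> c; have -> : (\sum_q (c <= w q)%R)%N = size [seq p <- s | (c <= p.2)%R].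
    rewrite size_filter -sum1_count -(big_mkord xpredT (fun q => nat_of_bool (c <= (nth (0, 0) s q).2))).
    by rewrite (big_nth (0, 0)) sz [RHS]big_mkcond /=; apply: eq_bigr => i _; case: ifP.
  have [cc|/ltW cc] := leP c0 c; first by rewrite dimH // addnC.
  have -> : [seq p <- s | (c <= p.2)%R] = s.
    by apply/all_filterP/allP => p /Hs [_] /=; apply: le_trans.
  by rewrite HW ?(le_trans cc) // sz.
Qed.

End Adapted.

(** * Degrees of lattices and of filtrations *)

Lemma exprz_sum (L : fieldType) (x : L) (I : finType) (w : I -> int) : x != 0 ->
  \prod_q x ^ (w q) = x ^ (\sum_q w q).
Proof.
move=> x0; elim/big_rec2: _ => [|q a b _ ->]; first by rewrite expr0z.
by rewrite expfzDr.
Qed.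

(** The difference of the two counts is the multiplicity of [i] among the [w q]; in particular the
    sum is supported on the finitely many values of [w]. *)
Lemma fsum_jumps (I : finType) (w : I -> int) :
  \sum_(i \in [set: int]) i * ((\sum_q (i <= w q)%R)%N%:Z - (\sum_q (i + 1 <= w q)%R)%N%:Z)
  = \sum_q w q.
Proof.
have jump i : (\sum_q (i <= w q)%R)%N%:Z - (\sum_q (i + 1 <= w q)%R)%N%:Z
    = \sum_q (w q == i)%:Z.
  rewrite !(big_morph Posz PoszD (erefl 0%:Z)) -sumrB; apply: eq_bigr => q _.
  by case: (ltgtP (w q) i) => [?|?|->]; lia.
rewrite (fsbigE (undup (codom w))) ?undup_uniq //; last first.
  move=> i _; rewrite mem_undup => iw; rewrite jump big1 ?mulr0 // => q _.
  by case: eqP => // E; rewrite -E codom_f in iw.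
under eq_bigl do rewrite in_setT.
under eq_bigr do rewrite jump mulr_sumr.
rewrite exchange_big /=; apply: eq_bigr => q _.
rewrite (bigD1_seq (w q)) ?undup_uniq ?mem_undup ?codom_f //= eqxx mulr1 big1 ?addr0 // => i.
by rewrite eq_sym => /negPf ->; rewrite mulr0.
Qed.

(** * Lattices split by the weight projectors *)

Section Lattice.
Context (B : fieldType) (Bp : idomainType) (xi : Bp) (j : {rmorphism Bp -> B}).
Hypothesis jI : injective j.
Hypothesis xi0 : xi != 0.
Hypothesis xiN : xi \isn't a GRing.unit.

Lemma jxi0 : j xi != 0.
Proof. by rewrite -(rmorph0 j) (inj_eq jI). Qed.

Lemma val_xiE u i : u \is a GRing.unit -> val_xi xi j (j u * j xi ^ i) = i.
Proof.
move=> Uu; have uniq (a b : int) u1 u2 : u1 \is a GRing.unit -> a <= b ->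
    j u1 * j xi ^ a = j u2 * j xi ^ b -> a = b.
  move=> U1 ab; have [l bE] : exists l : nat, b = a + l%:Z by exists `|b - a|%N; lia.
  rewrite bE expfzDr ?jxi0 // [j xi ^ a * _]mulrC mulrA => /(mulIf (expfz_neq0 _ jxi0)).
  rewrite -exprnP -rmorphXn -rmorphM => /jI E.
  case: l bE E => [|l] bE E; first by rewrite addr0.
  by move: U1; rewrite E exprS !unitrM (negPf xiN) /= andbF.
apply: xget_unique => [|b [u' Uu' E]]; first by exists u.
by have [ab|/ltW ba] := leP i b; [apply/esym/(uniq _ _ _ _ Uu ab E)|apply: (uniq _ _ _ _ Uu' ba (esym E))].
Qed.

Definition integral (x : B) : Prop := exists u, x = j u.

Lemma integralM x y : integral x -> integral y -> integral (x * y).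
Proof. by move=> [u ->] [v ->]; exists (u * v); rewrite rmorphM. Qed.

Lemma integralD x y : integral x -> integral y -> integral (x + y).
Proof. by move=> [u ->] [v ->]; exists (u + v); rewrite rmorphD. Qed.

Lemma integral_j u : integral (j u). Proof. by exists u. Qed.

Lemma integral_xi (a : int) : 0 <= a -> integral (j xi ^ a).
Proof. by case: a => // l _; exists (xi ^+ l); rewrite rmorphXn. Qed.

Lemma integral_sum (I : Type) (s : seq I) (P : pred I) (f : I -> B) :
  (forall i, P i -> integral (f i)) -> integral (\sum_(i <- s | P i) f i).
Proof.
move=> H; elim/big_ind: _ => //; [by exists 0; rewrite rmorph0|exact: integralD].
Qed.

Lemma integral_mxP a b (M : 'M[B]_(a, b)) :
  (exists M', M = map_mx j M') <-> (forall p q, integral (M p q)).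
Proof.
split=> [[M' ->] p q|H]; first by exists (M' p q); rewrite mxE.
have /choice [f Hf] : forall pq, exists u, M pq.1 pq.2 = j u by move=> [p q]; apply: H.
by exists (\matrix_(p, q) f (p, q)); apply/matrixP => p q; rewrite !mxE -Hf.
Qed.

(** The basis picked by [lattice_deg] and [g] differ by a matrix invertible over [Bp], which changes
    the determinant by a unit. *)
Lemma lattice_degE m (g : 'M[B]_m) u (i : int) : u \is a GRing.unit ->
  \det g = j u * j xi ^ i ->
  lattice_deg xi j [set g *m map_mx j w | w in [set: 'cV[Bp]_m]] = - i.
Proof.
move=> Uu Dg; rewrite /lattice_deg; congr (- _).
set S := [set h | _]; set h := xget _ _.
have Ug : g \in unitmx.
  rewrite unitmxE Dg unitrM rmorph_unit // unitfE expfz_neq0 //; exact: jxi0.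
have [Uh Eh] : S h by apply: (@xgetI _ 1%:M S g).
have cols (g1 g2 : 'M[B]_m) :
    [set g1 *m map_mx j w | w in [set: 'cV[Bp]_m]] `<=`
    [set g2 *m map_mx j w | w in [set: 'cV[Bp]_m]] -> exists r, g1 = g2 *m map_mx j r.
  move=> sub.
  have /choice [f Hf] : forall q, exists w, col q g1 = g2 *m map_mx j w.
    move=> q; have [|w _ E] := sub (col q g1); last by exists w.
    by exists (delta_mx q 0) => //; rewrite map_delta_mx -colE.
  exists (\matrix_(p, q) f q p 0); apply/matrixP => p q.
  have := congr1 (fun M : 'cV_m => M p 0) (Hf q); rewrite !mxE => ->.
  by apply: eq_bigr => l _; rewrite !mxE.
have [r1 E1] : exists r, h = g *m map_mx j r by apply: cols; rewrite Eh.
have [r2 E2] : exists r, g = h *m map_mx j r by apply: cols; rewrite Eh.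
have U1 : \det r1 \is a GRing.unit.
  apply/unitrPr; exists (\det r2); apply: jI; rewrite rmorph1 rmorphM.
  have : \det g != 0 by rewrite -unitfE -unitmxE.
  move/mulfI; apply; rewrite mulr1 mulrA -!det_map_mx -!det_mulmx.
  by rewrite -E1 -E2.
rewrite E1 det_mulmx det_map_mx Dg mulrAC -rmorphM; apply: val_xiE.
by rewrite unitrM Uu.
Qed.

Context (k C : fieldType) (s : {rmorphism C -> Bp}) (fC : {rmorphism k -> C}).
Let J : {rmorphism C -> B} := (j \o s : {rmorphism C -> B}).
Let fB : {rmorphism k -> B} := (J \o fC : {rmorphism k -> B}).

Lemma integral_J x : integral (J x). Proof. exact: integral_j. Qed.

Context (m d N : nat) (P : 'I_d -> 'M[C]_m) (Gr : grading P).
Context (La : set 'cV[B]_m) (Fl : int -> {vspace 'cV[C]_m}).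
Hypothesis LaP : forall v, La v <->
  forall q, exists u, j xi ^ (wt N q) *: (map_mx J (P q) *m v) = map_mx j u.
Hypothesis FlP : forall w v, v \in Fl w <-> forall q, wt N q < w -> P q *m v = 0.

Lemma Fl_lo w : w <= - N%:Z -> Fl w = fullv.
Proof.
move=> wN; apply/vspaceP => v; rewrite memvf; apply/FlP => q; rewrite /wt => H; lia.
Qed.

Lemma Fl_hi w : d%:Z - N%:Z <= w -> Fl w = 0%VS.
Proof.
have [O S] := Gr; move=> wN; apply/vspaceP => v; rewrite memv0.
apply/idP/eqP => [/FlP H|->]; last by apply/FlP => q _; rewrite mulmx0.
rewrite -[v]mul1mx -S mulmx_suml big1 // => q _; apply: H; rewrite /wt.
by have := ltn_ord q; lia.
Qed.

Lemma Fl_dec w w' : w <= w' -> (Fl w' <= Fl w)%VS.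
Proof.
move=> ww; apply/subvP => v /FlP H; apply/FlP => q qw; apply: H; exact: lt_le_trans ww.
Qed.

Lemma integral_scale (x y : int) (z : B) : 
  integral (j xi ^ x * z) -> x <= y -> integral (j xi ^ y * z).
Proof.
move=> H xy; have -> : y = (y - x) + x by lia.
by rewrite expfzDr ?jxi0 // -mulrA; apply: integralM => //; apply: integral_xi; lia.
Qed.

(** The image lattice in [W / U] is generated by the adapted basis with its [q]-th vector scaled by
    [xi^-(w q)], so the valuation of its determinant is minus the sum of the jumps. [LaP] and [FlP]
    describe lattice and filtration by the same projectors, [P q] having weight [wt N q]. *)
Lemma lattice_deg_DOR (U W : {vspace 'cV[k]_m}) : (U <= W)%VS ->
  lattice_deg xi j (subquotient_lattice fB La U W) = DOR_deg fC Fl U W.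
Proof.
move=> UW; set e := \dim (W :\: U).
have [O S] := Gr.
have dimE : (\dim (extend_vspace fC U) + e = \dim (extend_vspace fC W))%N.
  by rewrite !extend_dim -(dimv_cap_compl W U); congr (\dim _ + _)%N; apply/esym/capv_idPr.
have [V [w [Y [VF YV YU YF dH]]]] := adapted_basis (extend_sub fC UW) Fl_lo Fl_hi Fl_dec dimE.
have -> : DOR_deg fC Fl U W = \sum_q w q.
  rewrite -fsum_jumps /DOR_deg; apply: eq_fsbigr => i _.
  by rewrite !dH !PoszD; congr (_ * _); ring.
pose X : 'M[k]_(m, e) := tcol (vbasis (W :\: U)); pose MU := tcol (vbasis U).
(* [g] and [h] are the coordinates of the adapted basis with respect to the bases of [W :\: U] and
   [U] over the base field; [Z] below inverts [g]. *)
have [g [h Vgh]] : exists g h, V = map_mx fC X *m g + map_mx fC MU *m h.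
  have /choice [f Hf] : forall q, exists gh, col q V = map_mx fC X *m gh.1 + map_mx fC MU *m gh.2.
    move=> q; have : col q V \in extend_vspace fC W by have := VF q; rewrite memv_cap => /andP[].
    have -> : W = (W :\: U + U)%VS by rewrite addv_diff; apply/esym/addv_idPl.
    rewrite extend_add => /memv_addP [v1 /extendP [c1 ->] [v2 /extendP [c2 ->] ->]].
    by exists (c1, c2).
  exists (\matrix_(a, q) (f q).1 a 0), (\matrix_(a, q) (f q).2 a 0).
  apply/matrixP => a q; have := congr1 (fun M : 'cV_m => M a 0) (Hf q); rewrite !mxE => ->.
  by congr (_ + _); apply: eq_bigr => l _; rewrite !mxE.
have YMU : Y *m map_mx fC MU = 0.
  apply/matrixP => a q; rewrite [RHS]mxE.
  have := YU (map_mx fC (tnth (vbasis U) q)) (extend_mem _ (vbasis_mem (mem_tnth _ _))).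
  move/(congr1 (fun M : 'cV_e => M a 0)); rewrite !mxE => E; apply: etrans E.
  by apply: eq_bigr => l _; rewrite !mxE.
pose Z := Y *m map_mx fC X.
have Zg : Z *m g = 1%:M by rewrite -YV Vgh mulmxDr !mulmxA YMU mul0mx addr0.
have gZ : g *m Z = 1%:M by apply: mulmx1C.
have [Ug _] := mulmx1_unit gZ.
pose D (w : 'I_e -> int) : 'M[B]_e := diag_mx (\row_q j xi ^ (w q)).
pose g1 := map_mx J g *m D (fun q => - w q).
have -> : \sum_q w q = - (\sum_q - w q) by rewrite sumrN opprK.
have Dg1 : \det g1 = j (s (\det g)) * j xi ^ (\sum_q - w q).
  rewrite det_mulmx det_diag det_map_mx; congr (_ * _).
  by rewrite -exprz_sum ?jxi0 //; apply: eq_bigr => q _; rewrite mxE.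
rewrite -(lattice_degE _ Dg1); last by rewrite rmorph_unit // -unitmxE.
congr (lattice_deg xi j _).
have XB (c : 'cV[B]_e) : \sum_q c q 0 *: map_mx fB (tnth (vbasis (W :\: U)) q) = map_mx fB X *m c.
  by rewrite -tcol_map tcol_mul; apply: eq_bigr => q _; rewrite tnth_map.
have fBE a b (M : 'M[k]_(a, b)) : map_mx fB M = map_mx J (map_mx fC M) by rewrite -map_mx_comp.
apply/seteqP; split=> [c [l [Lal lW lU]]|_ [w0 _ <-]].
- rewrite XB in lU; have /extendP [u lE] := lU.
  have Yl : map_mx J Z *m c = map_mx J Y *m l.
    rewrite /Z map_mxM -mulmxA -fBE; apply/eqP; rewrite -subr_eq0 -mulmxBr lE.
    by rewrite fBE mulmxA -map_mxM YMU map_mx0 mul0mx.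
  (* What remains is to bound the values of the dual forms on [l]. The part of [l] of weight at most
     [w q] is controlled by [LaP]; the part of larger weight comes from [Fl (w q + 1)], which row
     [q] of [Y] kills. *)
  suff /integral_mxP [w0 Hw0] : forall q a, integral ((D w *m (map_mx J Z *m c)) q a).
    exists w0 => //; rewrite -Hw0 /g1 -!mulmxA [D _ *m (D _ *m _)]mulmxA.
    have -> : D (fun q => - w q) *m D w = 1%:M.
      rewrite mulmx_diag; apply/matrixP => a b.
      by rewrite !mxE -expfzDr ?jxi0 // addNr expr0z.
    by rewrite mul1mx mulmxA -map_mxM gZ map_mx1 mul1mx.
  move=> q a; rewrite Yl -[l]mul1mx -(map_mx1 J) -S rmorph_sum mulmx_suml !mulmx_sumr summxE.
  apply: integral_sum => q' _; rewrite mul_diag_mx !mxE.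
  have [wq|qw] := leP (wt N q') (w q).
    have /LaP /(_ q') [u' /matrixP Hu'] := Lal.
    rewrite mulr_sumr; apply: integral_sum => b _; rewrite mulrCA; apply: integralM.
      by rewrite mxE; apply: integral_J.
    apply: integral_scale wq; have := Hu' b a; rewrite !mxE => ->.
    exact: integral_j.
  rewrite (_ : \sum__ _ = 0) ?mulr0; first by exists 0; rewrite rmorph0.
  have YP : row q Y *m P q' = 0.
    apply/matrixP => a' b; rewrite [RHS]mxE ord1.
    have PF : col b (P q') \in Fl (w q + 1).
      apply/FlP => q'' Hq''; rewrite colE mulmxA O; case: eqP => [E|_]; last by rewrite mul0mx.
      by move: Hq''; rewrite E; lia.
    have := YF q _ PF; rewrite colE mulmxA -colE => /matrixP /(_ 0 0).
    by rewrite [LHS]mxE [RHS]mxE.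
  have : map_mx J (row q Y) *m (map_mx J (P q') *m l) = 0.
    by rewrite mulmxA -map_mxM YP map_mx0 mul0mx.
  move/matrixP => /(_ 0 a); rewrite !mxE => E; apply: etrans E.
  by apply: eq_bigr => b _; rewrite !mxE.
(* Conversely, the combination of the adapted basis is itself a lift in [La]: column [q'] of [V]
   lies in [Fl (w q')], so it has only components of weight at least [w q']. *)
- pose w1 := D (fun q => - w q) *m map_mx j w0.
  exists (map_mx J V *m w1); split.
  + apply/LaP => q; suff /integral_mxP [u ->] : forall p a,
      integral ((j xi ^ wt N q *: (map_mx J (P q) *m (map_mx J V *m w1))) p a) by exists u.
    move=> p a; rewrite mxE mulmxA -map_mxM mxE mulr_sumr; apply: integral_sum => q' _.
    rewrite /w1 mul_diag_mx [map_mx J _ _ _]mxE.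
    have [wq|qw] := ltP (wt N q) (w q').
      have := VF q'; rewrite memv_cap => /andP[/FlP /(_ q wq) E _].
      have -> : (P q *m V) p q' = 0.
        move: E; rewrite colE mulmxA -colE => /matrixP /(_ p 0).
        by rewrite [LHS]mxE [RHS]mxE.
      by exists 0; rewrite !rmorph0 mul0r mulr0.
    rewrite !mxE mulrCA; apply: integralM; first exact: integral_J.
    rewrite mulrA -expfzDr ?jxi0 //; apply: integralM; last exact: integral_j.
    by apply: integral_xi; lia.
  + have VW : exists c, V = map_mx fC (tcol (vbasis W)) *m c.
      have /choice [f Hf] : forall q, exists c, col q V = map_mx fC (tcol (vbasis W)) *m c.
        by move=> q; apply/extendP; have := VF q; rewrite memv_cap => /andP[].
      exists (\matrix_(a, q) f q a 0); apply/matrixP => a q.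
      have := congr1 (fun M : 'cV_m => M a 0) (Hf q); rewrite !mxE => ->.
      by apply: eq_bigr => l _; rewrite !mxE.
    have [c ->] := VW; apply/extendP; exists (map_mx J c *m w1).
    by rewrite map_mxM -fBE mulmxA.
  + rewrite XB; apply/extendP; exists (- (map_mx J h *m w1)).
    rewrite Vgh map_mxD !map_mxM -!fBE mulmxDl /g1 mulmxN !mulmxA.
    by rewrite /w1 ?mulmxA opprD addrA subrr add0r.
Qed.

End Lattice.

(** * The minuscule case *)

Section Gradient.
Context (k : fieldType).

Lemma mmap_deriv (M : nat) (R : comNzRingType) (f : {rmorphism k -> R})
  (v : 'I_M -> {poly R}) (q : {mpoly k[M]}) :
  (mmap (polyC \o f) v q)^`() = \sum_l mmap (polyC \o f) v (q^`M(l)) * (v l)^`().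
Proof.
pose E := mmap (polyC \o f) v.
pose T q := (E q)^`() = \sum_l E (q^`M(l)) * (v l)^`(); rewrite -/E -/(T q).
have TC c : T c%:MP.
  by rewrite /T /E mmapC derivC big1 // => l _; rewrite mderivC mmap0 mul0r.
have TX a : T 'X_a.
  rewrite /T /E mmapX mmap1U (bigD1 a) //= mderivX mnmE eqxx scale1r.
  have -> : (U_(a) - U_(a))%MM = 0%MM by apply/mnmP => b; rewrite mnmBE mnm0E subnn.
  rewrite mpolyX0 -mpolyC1 mmapC /= rmorph1 polyC1 mul1r big1 ?addr0 // => l la.
  by rewrite mderivX mnmE eq_sym (negPf la) scale0r mmap0 mul0r.
have TD p r : T p -> T r -> T (p + r).
  rewrite /T /E mmapD derivD => -> ->; rewrite -big_split; apply: eq_bigr => l _.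
  by rewrite mderivD mmapD mulrDl.
have TM p r : T p -> T r -> T (p * r).
  rewrite /T /E rmorphM derivM => -> ->; rewrite mulr_suml mulr_sumr -big_split.
  by apply: eq_bigr => l _; rewrite mderivM mmapD !rmorphM /=; ring.
rewrite [q]mpolyE; elim/big_ind: _ => //; first by rewrite -(mpolyC0 M k); apply: TC.
move=> m _; rewrite -mul_mpolyC; apply: (TM _ _ (TC _)).
rewrite mpolyXE_id; elim/big_ind: _ => // [|a _]; first by rewrite -mpolyC1; apply: TC.
by elim: (m a) => [|l IH]; rewrite ?expr0 -?mpolyC1 // exprS; apply: TM.
Qed.

Lemma mmap_powdvd (M : nat) (R : comNzRingType) (r : R) (N : nat) (f : k -> R)
  (v v' : 'I_M -> R) (q : {mpoly k[M]}) :
  (forall l, powdvd r N (v l - v' l)) -> powdvd r N (mmap f v q - mmap f v' q).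
Proof.
move=> H; rewrite /mmap -sumrB; apply: powdvd_sum => m _.
rewrite -mulrBr; apply: powdvd_mull; rewrite /mmap1.
apply: (big_ind2 (fun a b => powdvd r N (a - b))) => [|a a' b b' Ha Hb|l _].
- by rewrite subrr; apply: powdvd0.
- have -> : a * b - a' * b' = (a - a') * b + a' * (b - b') by ring.
  by apply: powdvdD; [apply: powdvd_mulr|apply: powdvd_mull].
- by rewrite subrXX; apply: powdvd_mulr.
Qed.

Context (n : nat).

(** The differential of [q] at the identity, as a linear form on matrices flattened by [mxvec]; the
    Lie algebra is the common kernel of these forms over the equations of [G]. *)
Definition grad (R : comNzRingType) (f : k -> R) (q : {mpoly k[n * n]}) : 'rV[R]_(n * n) :=
  \row_l mmap f (fun a => mxvec (1%:M : 'M[R]_n) 0 a) (q^`M(l)).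

Lemma grad_map (R S : comNzRingType) (f : {rmorphism k -> R}) (g : {rmorphism R -> S}) q :
  map_mx g (grad f q) = grad (g \o f) q.
Proof.
apply/rowP => l; rewrite !mxE mmap_rmorph; apply: mmap_ext => // a /=.
by rewrite -(map_mx1 g) -map_mxvec mxE.
Qed.

Lemma mmap_coef1 (R : comNzRingType) (f : {rmorphism k -> R}) (X : 'M[{poly R}]_n)
  (q : {mpoly k[n * n]}) : map_mx (horner_eval 0) X = 1%:M ->
  (mmap (polyC \o f) (fun l => mxvec X 0 l) q)`_1 =
  (grad f q *m (mxvec (map_mx (fun p : {poly R} => p`_1) X))^T) 0 0.
Proof.
move=> X0; set p := mmap _ _ _.
have -> : p`_1 = p^`()`_0 by rewrite coef_deriv mulr1n.
rewrite -horner_coef0 /p mmap_deriv -[_.[0]]/(horner_eval 0 _) rmorph_sum mxE.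
apply: eq_bigr => l _; rewrite rmorphM !mxE; congr (_ * _).
  rewrite mmap_rmorph; apply: mmap_ext => [c|a] /=; first by rewrite ?horner_evalE hornerC.
  by rewrite -X0 -map_mxvec mxE.
by rewrite -map_mxvec mxE /= horner_evalE horner_coef0 coef_deriv mulr1n.
Qed.

End Gradient.

Section Lie.
Context (k : fieldType) (n : nat) (G : linear_group k n) (K : fieldType)
  (i : {rmorphism k -> K}).

Lemma Lie_grad (X : 'M[K]_n) :
  (forall q, equations G q -> grad i q *m (mxvec X)^T = 0) -> Lie G i X.
Proof.
move=> H q Gq; set Y : 'M[{poly K}]_n := 1%:M + _; set p := mmap _ _ _.
have Y0 : map_mx (horner_eval 0) Y = 1%:M.
  rewrite /Y map_mxD map_mx1; apply/matrixP => a b; rewrite !mxE.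
  by rewrite /= horner_evalE hornerM hornerX mul0r addr0.
have Y1 : map_mx (fun p : {poly K} => p`_1) Y = X.
  apply/matrixP => a b; rewrite !mxE coefD coefXM /= coefC eqxx.
  by rewrite coefMn coef1 mul0rn add0r.
have p0 : p`_0 = 0.
  rewrite -horner_coef0 -[_.[0]]/(horner_eval 0 _) (mmap_rmorph _ (polyC \o i)).
  have [_ /(_ q Gq) E] := points_1 G i; rewrite -[RHS]E; apply: mmap_ext => [c|a] /=.
    by rewrite ?horner_evalE hornerC.
  by rewrite -Y0 -map_mxvec mxE.
have p1 : p`_1 = 0.
  by rewrite (mmap_coef1 i) // Y1 H // mxE.
rewrite -(poly_take_drop 2 p) (_ : take_poly 2 p = 0).
  by rewrite add0r dvdp_mull.
by apply/polyP => -[|[|a]]; rewrite coef_take_poly coef0.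
Qed.

End Lie.

(** A finite family in [S] of maximal rank spans all of [S], so its common kernel is that of [S],
    namely 0. The left inverse has entries in [K], so the relation survives any ring map out of
    [K]. *)
Lemma left_inverse_of_forms (K : fieldType) (M : nat) (S : set 'rV[K]_M) :
  (forall y : 'cV[K]_M, (forall x, S x -> x *m y = 0) -> y = 0) ->
  exists p (A : 'M[K]_(p, M)) A', (forall a, S (row a A)) /\ A' *m A = 1%:M.
Proof.
move=> H.
pose good (r : nat) := `[< exists p (A : 'M[K]_(p, M)), (forall a, S (row a A)) /\ \rank A = r >].
have ex : exists r, good r.
  exists 0%N; apply/asboolP; exists 0%N, (0 : 'M_(0, M)); split; first by case.
  by rewrite mxrank0.
have bd r : good r -> (r <= M)%N by move=> /asboolP [p [A [_ <-]]]; apply: rank_leq_col.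
have [r /asboolP [p [A [SA rA]]] maxr] := ex_maxnP ex bd.
have [|A' HA'] := @left_inverse _ _ _ A; last by exists p, A, A'.
move=> y Ay; apply: H => x Sx.
suff /submxP [z ->] : (x <= A)%MS by rewrite -mulmxA Ay mulmx0.
have : (\rank (col_mx A x) <= r)%N.
  apply: maxr; apply/asboolP; exists (p + 1)%N, (col_mx A x); split=> // a.
  rewrite -[a]splitK; case: split => b /=; first by rewrite rowKu.
  by rewrite rowKd row_id // (_ : row b x = x) //; apply/rowP => c; rewrite !mxE ord1.
rewrite -rA => rk; have sub : (A <= col_mx A x)%MS by rewrite -addsmxE addsmxSl.
have : (col_mx A x <= A)%MS by rewrite -(geq_leqif (mxrank_leqif_sup sub)).
by rewrite col_mx_sub => /andP[].
Qed.

Section BinomialPolys.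
Context (R : idomainType).
Hypothesis natU : forall l, ((l.+1)%:R : R) \is a GRing.unit.

(** The binomial coefficient of [X] over [l]; for [l > 0] its linear coefficient [(-1)^(l-1) / l] is
    that of the logarithm series. *)
Fixpoint binp (l : nat) : {poly R} :=
  if l is l'.+1 then (l%:R^-1)%:P * (binp l' * ('X - (l'%:R)%:P)) else 1.

Lemma binpE l m : (binp l).[m%:R] = 'C(m, l)%:R.
Proof.
elim: l => [|l IH] /=; first by rewrite hornerC bin0.
rewrite hornerCM hornerM IH hornerD hornerN hornerX hornerC.
apply: (mulrI (natU l)); rewrite mulrA divrr ?natU // mul1r -natrM mul_bin_left.
have [lm|ml] := leqP l m; first by rewrite natrM natrB // mulrC.
by rewrite bin_small // mul0r muln0.
Qed.

Lemma binp0 l : (binp l).[0] = (l == 0%N)%:R.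
Proof. by rewrite -[0]/(0%:R) binpE bin0n. Qed.

Lemma binp1_coef1 : (binp 1)`_1 = 1.
Proof. by rewrite /= coefCM invr1 mul1r mul1r subr0 coefX. Qed.

End BinomialPolys.

Section MxPowDvd.
Context (A : comNzRingType) (r : A).

Definition mxdvd (N m p : nat) (M : 'M[A]_(m, p)) : Prop := forall a b, powdvd r N (M a b).

Lemma mxdvdD N m p (M M' : 'M[A]_(m, p)) : mxdvd N M -> mxdvd N M' -> mxdvd N (M + M').
Proof. by move=> H H' a b; rewrite mxE; apply: powdvdD. Qed.

Lemma mxdvdN N m p (M : 'M[A]_(m, p)) : mxdvd N M -> mxdvd N (- M).
Proof. by move=> H a b; rewrite mxE; apply: powdvdN. Qed.

Lemma mxdvdM N N' m p q (M : 'M[A]_(m, p)) (M' : 'M[A]_(p, q)) :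
  mxdvd N M -> mxdvd N' M' -> mxdvd (N + N') (M *m M').
Proof. by move=> H H' a b; rewrite mxE; apply: powdvd_sum => l _; apply: powdvdM. Qed.

Lemma mxdvd_mull N m p q (M : 'M[A]_(m, p)) (M' : 'M[A]_(p, q)) :
  mxdvd N M' -> mxdvd N (M *m M').
Proof. by move=> H a b; rewrite mxE; apply: powdvd_sum => l _; apply: powdvd_mull. Qed.

Lemma mxdvd_mulr N m p q (M : 'M[A]_(m, p)) (M' : 'M[A]_(p, q)) :
  mxdvd N M -> mxdvd N (M *m M').
Proof. by move=> H a b; rewrite mxE; apply: powdvd_sum => l _; apply: powdvd_mulr. Qed.

Lemma mxdvdZ N m p c (M : 'M[A]_(m, p)) : mxdvd N M -> mxdvd N (c *: M).
Proof. by move=> H a b; rewrite mxE; apply: powdvd_mull. Qed.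

Lemma mxdvd_sum N m p (I : Type) (s : seq I) (P : pred I) (F : I -> 'M[A]_(m, p)) :
  (forall i, P i -> mxdvd N (F i)) -> mxdvd N (\sum_(i <- s | P i) F i).
Proof. by move=> H a b; rewrite summxE; apply: powdvd_sum => i Pi; apply: H. Qed.

Lemma mxdvd_leq N N' m p (M : 'M[A]_(m, p)) : (N <= N')%N -> mxdvd N' M -> mxdvd N M.
Proof. by move=> NN H a b; apply: powdvd_leq (H a b). Qed.

End MxPowDvd.

(* The weights of conjugation are shifted by [d] to keep them in [nat]. *)
Section ConjWeights.
Context (R : comUnitRingType) (n d : nat) (e : 'I_d -> 'M[R]_n).
Hypothesis Gr : grading e.

Definition cwt (a b : 'I_d) : nat := a + (d - b).

Lemma cwt_lt a b : (cwt a b < d + d.+1)%N.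
Proof. by rewrite /cwt; have := ltn_ord a; lia. Qed.

(** The component of [X] of weight [w - d] under conjugation. *)
Definition cpart (w : nat) (X : 'M[R]_n) : 'M[R]_n :=
  \sum_a \sum_(b | cwt a b == w) e a *m X *m e b.

Lemma cpart_block w X a b :
  e a *m cpart w X *m e b = if cwt a b == w then e a *m X *m e b else 0.
Proof.
have [O _] := Gr; rewrite /cpart mulmx_sumr mulmx_suml (bigD1 a) //= [X in _ + X]big1 ?addr0; last first.
  move=> a' aa'; rewrite mulmx_sumr mulmx_suml big1 // => b' _.
  by rewrite !mulmxA O eq_sym (negPf aa') !mul0mx.
rewrite mulmx_sumr mulmx_suml; case: ifP => [ab|ab].
  rewrite (bigD1 b) //= big1 ?addr0.
    by rewrite !mulmxA O eqxx -!mulmxA O eqxx.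
  by move=> b' /andP[_ bb']; rewrite -!mulmxA O (negPf bb') !mulmx0.
rewrite big1 // => b' b'w; rewrite -!mulmxA O; case: eqP => [E|_]; last by rewrite !mulmx0.
by rewrite -E b'w in ab.
Qed.

Lemma cpart_cpart w w' X : cpart w' (cpart w X) = if w' == w then cpart w X else 0.
Proof.
rewrite {1}/cpart; under eq_bigr do under eq_bigr do rewrite cpart_block.
case: eqP => [->|ww']; first by apply: eq_bigr => a _; apply: eq_bigr => b ->.
by rewrite big1 // => a _; rewrite big1 // => b /eqP ->; case: eqP.
Qed.

Lemma cpart_sum X (t : R) :
  \sum_(w < d + d.+1) t ^+ w *: cpart w X
  = \sum_a \sum_b t ^+ cwt a b *: (e a *m X *m e b).
Proof.
rewrite /cpart; under eq_bigr do rewrite scaler_sumr.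
rewrite exchange_big; apply: eq_bigr => a _.
under eq_bigr do rewrite scaler_sumr big_mkcond.
rewrite exchange_big; apply: eq_bigr => b _ /=.
rewrite (bigD1 (Ordinal (cwt_lt a b))) //= eqxx big1 ?addr0 // => w wab.
by case: eqP => // E; rewrite -val_eqE /= E eqxx in wab.
Qed.

Lemma conj_scaled (A A' X : 'M[R]_n) N t : t \is a GRing.unit ->
  A = t ^- N *: \sum_(a < d) t ^+ a *: e a ->
  A *m X *m invmx A = t ^- d *: \sum_a \sum_b t ^+ cwt a b *: (e a *m X *m e b).
Proof.
have [O S] := Gr; move=> Ut AE.
pose M := \sum_(a < d) t ^+ a *: e a; pose M' := \sum_(b < d) t ^+ (d - b) *: e b.
have MM' : M *m M' = (t ^+ d)%:M.
  rewrite mulmx_suml -[RHS]mulmx1 -S mul_scalar_mx scaler_sumr; apply: eq_bigr => a _.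
  rewrite mulmx_sumr (bigD1 a) //= big1 ?addr0.
    rewrite -scalemxAl -scalemxAr O eqxx scalerA -exprD subnKC //; exact: ltnW.
  by move=> b ba; rewrite -scalemxAl -scalemxAr O eq_sym (negPf ba) !scaler0.
have AA' : A *m ((t ^+ N * t ^- d) *: M') = 1%:M.
  rewrite AE -/M -scalemxAl -scalemxAr MM' scalerA mulrA mulVr ?unitrX // mul1r.
  by rewrite scale_scalar_mx mulVr ?unitrX.
have [UA _] := mulmx1_unit AA'.
have -> : invmx A = (t ^+ N * t ^- d) *: M' by rewrite -[RHS](mulKmx UA) AA' mulmx1.
rewrite AE -/M -scalemxAr -!scalemxAl scalerA -mulrA [t ^- d * _]mulrC mulrA divrr ?unitrX // mul1r.
congr (_ *: _); rewrite !mulmx_suml; apply: eq_bigr => a _; rewrite mulmx_sumr.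
by apply: eq_bigr => b _; rewrite -scalemxAr -!scalemxAl scalerA mulrC -exprD.
Qed.

(** The linear form sending [X] to the entry [(a, b)] of [X - cpart w X]. The common kernel over all
    [a], [b] consists of the matrices homogeneous of index [w], so homogeneity becomes linear
    equations on the same footing as those of the Lie algebra. *)
Definition psi w (a b : 'I_n) : 'rV[R]_(n * n) :=
  mxvec ((delta_mx 0 a : 'rV_n)^T *m delta_mx 0 b
    - \sum_c \sum_(c' | cwt c c' == w) (row a (e c))^T *m (col b (e c'))^T).

Lemma psiE w a b (X : 'M[R]_n) :
  psi w a b *m (mxvec X)^T = ((X - cpart w X) a b)%:M.
Proof.
rewrite /psi raddfB /= mulmxBl mxvec_dotmul.
have -> : (delta_mx 0 a : 'rV_n) *m X *m (delta_mx 0 b : 'rV_n)^T = (X a b)%:M.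
  rewrite -rowE trmx_delta -colE; apply/matrixP => p q.
  by rewrite !ord1 [RHS]mxE eqxx mulr1n !mxE.
have -> : mxvec (\sum_c \sum_(c' | cwt c c' == w) (row a (e c))^T *m (col b (e c'))^T)
    *m (mxvec X)^T = (cpart w X a b)%:M.
  rewrite raddf_sum mulmx_suml summxE raddf_sum; apply: eq_bigr => c _.
  rewrite raddf_sum mulmx_suml summxE raddf_sum; apply: eq_bigr => c' _.
  rewrite /= mxvec_dotmul trmxK -row_mul colE mulmxA -row_mul -colE.
  by apply/matrixP => p q; rewrite !ord1 [RHS]mxE eqxx mulr1n !mxE.
by rewrite [in RHS]mxE [in RHS]mxE raddfD raddfN.
Qed.

End ConjWeights.

Lemma psi_map (R S : comUnitRingType) (g : {rmorphism R -> S}) n d (e : 'I_d -> 'M[R]_n) w a b :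
  map_mx g (psi e w a b) = psi (fun c => map_mx g (e c)) w a b.
Proof.
rewrite /psi map_mxvec map_mxD map_mxN map_mxM -map_trmx !map_delta_mx; congr (mxvec (_ - _)).
rewrite rmorph_sum; apply: eq_bigr => c _; rewrite rmorph_sum; apply: eq_bigr => c' _.
by rewrite /= map_mxM -!map_trmx map_row map_col.
Qed.

(** * The truncated logarithm of a point congruent to 1 *)

Section Log.
Context (k : fieldType) (n : nat) (G : linear_group k n).
Context (C : fieldType) (Bp : idomainType) (th : {rmorphism Bp -> C}) (xi : Bp).
Context (f : {rmorphism k -> Bp}).
Hypothesis xi0 : xi != 0.
Hypothesis th_ker : forall b, (th b = 0) <-> (exists c, b = xi * c).
Hypothesis charC : forall m, (m.+1)%:R != 0 :> C.
Hypothesis natU : forall l, ((l.+1)%:R : Bp) \is a GRing.unit.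

(** Interpolation modulo powers of [xi]: after division by [xi^N] the reduction of the polynomial
    vanishes at all positive integers, hence is 0 because [C] has characteristic 0. *)
Lemma poly_powdvd N (Q : {poly Bp}) :
  (forall l, powdvd xi N Q.[(l.+1)%:R]) -> forall a, powdvd xi N Q`_a.
Proof.
elim: N => [|N IH] H a; first exact: powdvd0n.
have /choice [c Hc] : forall a, exists c, Q`_a = xi ^+ N * c.
  by apply: IH => l; apply: powdvd_leq (H l).
pose Q' := \poly_(b < size Q) c b.
have QE : Q = xi ^+ N *: Q'.
  apply/polyP => b; rewrite coefZ coef_poly; case: ltnP => // sb.
  by rewrite nth_default // mulr0.
have : map_poly th Q' = 0.
  apply: (poly_nat_eq0 charC) => l; rewrite -(rmorph_nat th) horner_map.
  apply/(th_ker1 th_ker)/(powdvd_cancel xi0 (m := N)).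
  by rewrite addn1 -hornerZ -QE.
move/(congr1 (fun p : {poly C} => p`_a)); rewrite coef_map coef0 => /(th_ker1 th_ker) H1.
by rewrite QE coefZ -addn1; apply: powdvdM => //; exists 1; rewrite mulr1.
Qed.

(** The logarithm series at [1 + Z], cut before degree [N]. Its coefficients are read off [binp]
    because the logarithm is the derivative at 0 of the interpolation of [m |-> (1 + Z)^m]. *)
Definition logmx (N : nat) (Z : 'M[Bp]_n) : 'M[Bp]_n := \sum_(l < N) (binp Bp l)`_1 *: Z ^+ l.

Lemma mxdvdX r (Z : 'M[Bp]_n) l : mxdvd xi r Z -> mxdvd xi (r * l) (Z ^+ l).
Proof.
move=> HZ; elim: l => [|l IH]; first by move=> a b; rewrite muln0; apply: powdvd0n.
by rewrite exprS mulnS; apply: mxdvdM.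
Qed.

(* Interpolating the powers [h ^ m], which all satisfy the equations of [G], by
   the polynomial [m |-> sum_l binomial(m, l) (h - 1)^l] modulo [xi ^ N]. *)
Lemma log_forms (h : 'M[Bp]_n) N q : points G f h -> mxdvd xi 1 (h - 1%:M) ->
  (0 < N)%N -> equations G q ->
  powdvd xi N ((grad f q *m (mxvec (logmx N (h - 1%:M)))^T) 0 0).
Proof.
move=> Gh HZ N0 Gq; set Z := h - 1%:M in HZ *.
pose P : 'M[{poly Bp}]_n := \matrix_(a, b) \sum_(l < N) binp Bp l * ((Z ^+ l) a b)%:P.
have P0 : map_mx (horner_eval 0) P = 1%:M.
  apply/matrixP => a b; rewrite !mxE /= horner_evalE horner_sum.
  rewrite (bigD1 (Ordinal N0)) //= big1 ?addr0.
    by rewrite hornerM !hornerC mul1r !mxE.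
  move=> l; rewrite -val_eqE /= => l0.
  by rewrite hornerM (binp0 natU) (negPf l0) mul0r.
have P1 : map_mx (fun p : {poly Bp} => p`_1) P = logmx N Z.
  apply/matrixP => a b; rewrite !mxE /logmx summxE coef_sum; apply: eq_bigr => l _.
  by rewrite coefMC mxE.
rewrite -P1 -(mmap_coef1 f q P0); apply: poly_powdvd => l.
rewrite -[_.[_]]/(horner_eval _ _) (mmap_rmorph _ (polyC \o f)).
have Gm m : points G f (h ^+ m).
  elim: m => [|m IH]; first exact: points_1.
  by rewrite exprS; apply: points_mul.
have [_ /(_ q Gq) E] := Gm l.+1.
set x := mmap _ _ _; rewrite -[x]subr0 -E.
have -> : x = mmap f (fun a => mxvec (map_mx (horner_eval (l.+1)%:R) P) 0 a) q.
  apply: mmap_ext => [c|a] /=; first by rewrite ?horner_evalE hornerC.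
  by rewrite -map_mxvec mxE.
apply: mmap_powdvd => ab; rewrite {x}.
have -> : mxvec (map_mx (horner_eval (l.+1)%:R) P) 0 ab - mxvec (h ^+ l.+1) 0 ab =
  mxvec (map_mx (horner_eval (l.+1)%:R) P - h ^+ l.+1) 0 ab.
  by rewrite raddfB !mxE.
case/mxvec_indexP: ab => a b; rewrite mxvecE.
have -> : map_mx (horner_eval (l.+1)%:R) P = \sum_(c < N) Z ^+ c *+ 'C(l.+1, c).
  apply/matrixP => a' b'; rewrite !mxE /= horner_evalE horner_sum summxE; apply: eq_bigr => c _.
  by rewrite hornerM hornerC (binpE natU) mulmxnE mulr_natl.
(* Padding the binomial expansion with [N] zero terms allows it to be split at [N] for every [l];
   the terms from [N] on are divisible by [xi^N]. *)
have -> : h ^+ l.+1 = \sum_(c < l.+2 + N) Z ^+ c *+ 'C(l.+1, c).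
  rewrite big_split_ord /= [X in _ + X]big1 ?addr0; last by move=> c _; rewrite bin_small ?mulr0n // ltn_addr.
  by rewrite -exprD1n subrK.
rewrite addnC big_split_ord /= opprD addrA subrr add0r.
apply: mxdvdN; apply: mxdvd_sum => c _.
have : mxdvd xi N (Z ^+ (N + c)).
  by apply: mxdvd_leq (mxdvdX _ HZ); rewrite mul1n leq_addr.
by move=> H a' b'; rewrite mulmxnE; apply: powdvdMn.
Qed.

End Log.

Lemma pairingZ (R : comNzRingType) n (x : 'rV[R]_(n * n)) c (X : 'M[R]_n) :
  (x *m (mxvec (c *: X))^T) 0 0 = c * (x *m (mxvec X)^T) 0 0.
Proof. by rewrite linearZ linearZ /= -scalemxAr mxE. Qed.

Lemma pairing_sum (R : comNzRingType) n (x : 'rV[R]_(n * n)) (I : finType) (X : I -> 'M[R]_n) :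
  (x *m (mxvec (\sum_l X l))^T) 0 0 = \sum_l (x *m (mxvec (X l))^T) 0 0.
Proof. by rewrite [mxvec _]raddf_sum [(\sum_l _)^T]raddf_sum mulmx_sumr summxE. Qed.

(** * Divisibility of the blocks of a point congruent to 1 *)

Section Minuscule.
Context (k K C : fieldType) (n : nat) (G : linear_group k n) (i : {rmorphism k -> K}).
Context (mu : cochar G i).
Context (Bp : idomainType) (th : {rmorphism Bp -> C}) (xi : Bp) (iB : {rmorphism K -> Bp}).
Hypothesis xi0 : xi != 0.
Hypothesis th_ker : forall b, (th b = 0) <-> (exists c, b = xi * c).
Hypothesis charK : forall m, (m.+1)%:R != 0 :> K.
Hypothesis Hmin : minuscule mu.

Context (N d : nat) (e : 'I_d -> 'M[K]_n).
Hypothesis D : diagonalizes (fun R f t => cev mu f t) N e.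

Let E (a : 'I_d) : 'M[Bp]_n := map_mx iB (e a).
Let GE : grading E := grading_map iB D.1.

Lemma natU_Bp l : ((l.+1)%:R : Bp) \is a GRing.unit.
Proof. by rewrite -(rmorph_nat iB) rmorph_unit // unitfE. Qed.

Let charC m : (m.+1)%:R != 0 :> C.
Proof. exact: (char0_rmorph (th \o iB) charK). Qed.

Lemma conj_cev (R : comUnitRingType) (f : {rmorphism K -> R}) (t : R) (X : 'M[R]_n) :
  t \is a GRing.unit ->
  cev mu f t *m X *m invmx (cev mu f t)
  = t ^- d *: \sum_a \sum_b t ^+ cwt a b *: (map_mx f (e a) *m X *m map_mx f (e b)).
Proof. by move=> Ut; apply: conj_scaled => //; [apply: grading_map D.1|apply: D.2]. Qed.

Lemma minuscule_weight w (X : 'M[K]_n) : cpart e w X = X -> Lie G i X -> X != 0 ->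
  (w = d.-1 \/ w = d \/ w = d.+1)%N.
Proof.
move=> Xw LX X0; have := @Hmin X (w%:Z - d%:Z) LX X0.
suff H : forall (R : comUnitRingType) (f : {rmorphism K -> R}) (t : R), t \is a GRing.unit ->
    cev mu f t *m map_mx f X *m invmx (cev mu f t) = t ^ (w%:Z - d%:Z) *: map_mx f X.
  by move=> /(_ H); lia.
move=> R f t Ut; have Gf := grading_map f D.1.
have Xf : cpart (fun a => map_mx f (e a)) w (map_mx f X) = map_mx f X.
  rewrite -[in RHS]Xw /cpart rmorph_sum; apply: eq_bigr => a _.
  by rewrite rmorph_sum; apply: eq_bigr => b _; rewrite /= !map_mxM.
rewrite conj_cev // -cpart_sum -expr_exprz // -scalerA; congr (_ *: _).
have [wd|wd] := ltnP w (d + d.+1); last first.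
  have X00 : map_mx f X = 0.
    rewrite -Xf /cpart big1 // => a _; rewrite big1 // => b /eqP ab.
    by have := cwt_lt a b; rewrite ab ltnNge wd.
  by rewrite X00 scaler0 big1 // => w' _; rewrite -X00 -Xf cpart_cpart //; case: eqP => // _;
    rewrite ?Xf ?X00 scaler0.
rewrite (bigD1 (Ordinal wd)) //= Xf big1 ?addr0 // => w'; rewrite -val_eqE /= => ww'.
by rewrite -Xf (cpart_cpart Gf) (negPf ww') scaler0.
Qed.

(** Over [K], a matrix of this weight killed by all differentials lies in the Lie algebra, hence is
    0 as [mu] is minuscule. So the differentials together with the forms [psi] have a left inverse
    over [K], which recovers [Y] from values divisible by [xi^M]. *)
Lemma cpart_forms_dvd M w (Y : 'M[Bp]_n) : cpart E w Y = Y ->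
  ~ (w = d.-1 \/ w = d \/ w = d.+1)%N ->
  (forall q, equations G q -> powdvd xi M ((grad (iB \o i) q *m (mxvec Y)^T) 0 0)) ->
  mxdvd xi M Y.
Proof.
move=> Yw wN H.
pose S : set 'rV[K]_(n * n) := [set x |
  (exists2 q, equations G q & x = grad i q) \/ (exists a b, x = psi e w a b)].
have [|p [A [A' [SA AA]]]] := @left_inverse_of_forms _ _ S.
  move=> y Hy; pose X := vec_mx y^T.
  have yX : y = (mxvec X)^T by rewrite vec_mxK trmxK.
  have Xw : cpart e w X = X.
    apply/matrixP => a b; have := Hy (psi e w a b); rewrite yX psiE => H1.
    have /matrixP /(_ 0 0) : ((X - cpart e w X) a b)%:M = 0 :> 'M_1.
      by apply: H1; right; exists a, b.
    by rewrite !mxE eqxx mulr1n => /eqP; rewrite subr_eq0 => /eqP.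
  have [X0|X0] := eqVneq X 0; first by rewrite yX X0 raddf0 trmx0.
  case: wN; apply: minuscule_weight Xw _ X0; apply: Lie_grad => q Gq.
  by rewrite -yX; apply: Hy; left; exists q.
have HA : mxdvd xi M (map_mx iB A *m (mxvec Y)^T).
  move=> a b; rewrite ord1.
  have -> : (map_mx iB A *m (mxvec Y)^T) a 0 = (map_mx iB (row a A) *m (mxvec Y)^T) 0 0.
    by rewrite map_row -row_mul [RHS]mxE.
  case: (SA a) => [[q Gq ->]|[c [c' ->]]].
    by rewrite grad_map; apply: H.
  by rewrite psi_map psiE -/E Yw subrr !mxE eqxx mulr1n; apply: powdvd0.
move=> a b; rewrite -(mxvecE Y).
have -> : mxvec Y 0 (mxvec_index a b) = (map_mx iB A' *m (map_mx iB A *m (mxvec Y)^T)) (mxvec_index a b) 0.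
  by rewrite mulmxA -map_mxM AA map_mx1 mul1mx mxE.
exact: mxdvd_mull.
Qed.

(* For [a > 0] one has [phi a r + phi a r' >= phi a.+1 (r + r')], so that the powers [Z ^+ l] with [l >= 2] gain one step over [Z]. *)
Let phi (a r : nat) : nat := minn (maxn r 1) a.

(** Blocks with [b - a >= 2] have weight at most -2, so there the logarithm [L] is 0 modulo [xi^M],
    and [Z = h - 1] is minus the sum of the higher terms of the series. These are products of blocks
    of [Z]; feeding the known divisibility back raises the bound [phi] by one step per round. *)
Lemma minuscule_blocks (h : 'M[Bp]_n) : points G (iB \o i) h -> map_mx th h = 1%:M ->
  forall a b : 'I_d, mxdvd xi (maxn (b - a) 1) (E a *m (h - 1%:M) *m E b).
Proof.
move=> Gh h1; set Z := h - 1%:M; have [O S] := GE.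
have HZ : mxdvd xi 1 Z.
  move=> a b; apply/(th_ker1 th_ker).
  by have := congr1 (fun M : 'M_n => M a b) h1; rewrite !mxE rmorphB rmorph_nat => ->; rewrite subrr.
(* Larger than every [b - a], and such that after the terms of degree 0 and 1 exactly [d] terms of
   the logarithm remain. *)
pose M := d.+2; pose L := logmx M Z.
have conjX t r : t \is a GRing.unit ->
    (cev mu iB t *m Z *m invmx (cev mu iB t)) ^+ r = cev mu iB t *m Z ^+ r *m invmx (cev mu iB t).
  move=> Ut; have [Uc _] := cev_points mu iB Ut.
  elim: r => [|r IH]; first by rewrite !expr0 mulmx1 mulmxV.
  by rewrite !exprS IH -!mulmxE !mulmxA mulmxKV.
(* The conjugate of [h] by [mu(t)] is again a point of [G] congruent to 1, and conjugation commutes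
   with the logarithm. *)
have Lforms t q : t \is a GRing.unit -> equations G q ->
    powdvd xi M ((grad (iB \o i) q *m (mxvec (cev mu iB t *m L *m invmx (cev mu iB t)))^T) 0 0).
  move=> Ut Gq; have Gt := cev_points mu iB Ut; have [Uc _] := Gt.
  pose ht := cev mu iB t *m h *m invmx (cev mu iB t).
  have Ght : points G (iB \o i) ht.
    by apply: points_mul; [apply: points_mul|apply: points_inv].
  have htE : ht - 1%:M = cev mu iB t *m Z *m invmx (cev mu iB t).
    by rewrite mulmxBr mulmxBl mulmx1 mulmxV.
  have := @log_forms _ _ _ _ _ th _ _ xi0 th_ker charC natU_Bp ht M q Ght.
  rewrite htE => /(_ _ _ Gq); have -> : logmx M (cev mu iB t *m Z *m invmx (cev mu iB t)) =
      cev mu iB t *m L *m invmx (cev mu iB t).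
    rewrite /L /logmx mulmx_sumr mulmx_suml; apply: eq_bigr => r _.
    by rewrite conjX // scalemxAl scalemxAr.
  by apply=> //; apply: mxdvd_mulr; apply: mxdvd_mull.
(* The pairing with the conjugated logarithm is, up to the factor [t^-d], a polynomial in [t] whose
   coefficients are the pairings with the weight components. Its values at positive integers are
   divisible by [xi^M], hence so are the coefficients. *)
have Lw w q : equations G q ->
    powdvd xi M ((grad (iB \o i) q *m (mxvec (cpart E w L))^T) 0 0).
  move=> Gq; have [wd|wd] := ltnP w (d + d.+1); last first.
    rewrite /cpart big1 ?raddf0 ?trmx0 ?mulmx0 ?mxE; first exact: powdvd0.
    move=> a _; rewrite big1 // => b /eqP ab.
    by have := cwt_lt a b; rewrite ab ltnNge wd.
  pose c w := (grad (iB \o i) q *m (mxvec (cpart E w L))^T) 0 0.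
  have : powdvd xi M (\poly_(w < d + d.+1) c w)`_w; last by rewrite coef_poly wd.
  apply: (poly_powdvd xi0 th_ker charC) => l; rewrite horner_poly.
  set t : Bp := (l.+1)%:R; have Ut : t \is a GRing.unit by apply: natU_Bp.
  have [Uc _] := cev_points mu iB Ut.
  have := Lforms t q Ut Gq.
  rewrite conj_cev // -cpart_sum => H.
  have -> : \sum_(w' < d + d.+1) c w' * t ^+ w' =
     t ^+ d * (grad (iB \o i) q *m (mxvec (t ^- d *: \sum_(w' < d + d.+1) t ^+ w' *: cpart E w' L))^T) 0 0.
    rewrite pairingZ mulrA divrr ?unitrX // mul1r pairing_sum; apply: eq_bigr => w' _.
    by rewrite pairingZ mulrC.
  exact: powdvd_mull.
have Lblock (a b : 'I_d) : (2 <= b - a)%N -> mxdvd xi M (E a *m L *m E b).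
  move=> ab; have HY := @cpart_forms_dvd M (cwt a b) (cpart E (cwt a b) L).
  have : E a *m cpart E (cwt a b) L *m E b = E a *m L *m E b by rewrite cpart_block // eqxx.
  move=> <-; apply: mxdvd_mulr; apply: mxdvd_mull; apply: HY.
  - by rewrite cpart_cpart // eqxx.
  - by rewrite /cwt; have := ltn_ord b; lia.
  - by move=> q Gq; apply: Lw.
have step r : (0 < r)%N -> (r < M)%N ->
    (forall a b : 'I_d, mxdvd xi (phi r (b - a)) (E a *m Z *m E b)) ->
    forall a b : 'I_d, mxdvd xi (phi r.+1 (b - a)) (E a *m Z *m E b).
  move=> r0 rM IH.
  have block (X Y : 'M[Bp]_n) a b : E a *m (X *m Y) *m E b = \sum_c (E a *m X *m E c) *m (E c *m Y *m E b).
    transitivity (E a *m X *m (\sum_c E c) *m (Y *m E b)); first by rewrite S mulmx1 !mulmxA.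
    rewrite mulmx_sumr mulmx_suml; apply: eq_bigr => c _.
    by rewrite !mulmxA -[_ *m E c *m E c]mulmxA O eqxx.
  have pow u (a b : 'I_d) : mxdvd xi (phi r.+1 (b - a)) (E a *m Z ^+ u.+2 *m E b).
    elim: u a b => [|u IHu] a b.
      rewrite -[Z ^+ 2]/(Z *m Z) block; apply: mxdvd_sum => c _.
      apply: mxdvd_leq (mxdvdM (IH a c) (IH c b)); rewrite /phi; lia.
    rewrite exprS -mulmxE block; apply: mxdvd_sum => c _.
    apply: mxdvd_leq (mxdvdM (IH a c) (IHu c b)); rewrite /phi; lia.
  move=> a b; have [ab|ab] := leqP (b - a) 1.
    have -> : phi r.+1 (b - a) = 1%N by rewrite /phi; lia.
    by apply: mxdvd_mulr; apply: mxdvd_mull.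
  have LE : L = Z + \sum_(l < d) (binp Bp l.+2)`_1 *: Z ^+ l.+2.
    rewrite /L /logmx /M big_ord_recl big_ord_recl /=.
    have -> : (1 : {poly Bp})`_1 = 0 by rewrite coef1.
    by rewrite scale0r add0r binp1_coef1 scale1r expr1.
  have -> : Z = L - \sum_(l < d) (binp Bp l.+2)`_1 *: Z ^+ l.+2 by rewrite LE addrK.
  rewrite mulmxBr mulmxBl; apply: mxdvdD.
    by apply: mxdvd_leq (Lblock a b ab); rewrite /phi; lia.
  apply: mxdvdN; rewrite mulmx_sumr mulmx_suml; apply: mxdvd_sum => l _.
  by rewrite -scalemxAr -scalemxAl; apply: mxdvdZ.
have all r : (r < M)%N -> forall a b : 'I_d, mxdvd xi (phi r.+1 (b - a)) (E a *m Z *m E b).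
  elim: r => [|r IH] rM a b.
    apply: mxdvd_mulr; apply: mxdvd_mull; have -> // : phi 1 (b - a) = 1%N by rewrite /phi; lia.
  by apply: step => //; apply: IH; lia.
move=> a b; apply: mxdvd_leq (all d.+1 _ a b) => //.
by rewrite /phi; have := ltn_ord b; lia.
Qed.

(** Conjugation by [mu(xi)] multiplies the block [(a, b)] by [xi^(a - b)], and the divisibility of
    that block of [h - 1] by [xi^(b - a)] when [b > a] compensates this. *)
Lemma minuscule_conj_integral (h : 'M[Bp]_n) (B : fieldType) (j : {rmorphism Bp -> B}) :
  injective j -> points G (iB \o i) h -> map_mx th h = 1%:M ->
  exists h', cev mu (j \o iB) (j xi) *m map_mx j h *m invmx (cev mu (j \o iB) (j xi)) = map_mx j h'.
Proof.
move=> jI Gh h1; have blocks := minuscule_blocks Gh h1.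
have jx0 : j xi != 0 by rewrite -(rmorph0 j) (inj_eq jI).
have Ux : j xi \is a GRing.unit by rewrite unitfE.
have [Uc _] := cev_points mu (j \o iB) Ux.
set c := cev _ _ _ in Uc *.
have -> : c *m map_mx j h *m invmx c = 1%:M + c *m map_mx j (h - 1%:M) *m invmx c.
  by rewrite map_mxB map_mx1 mulmxBr mulmxBl mulmx1 mulmxV // addrC subrK.
suff /integral_mxP [Z' ->] : forall p q, integral j ((c *m map_mx j (h - 1%:M) *m invmx c) p q).
  by exists (1%:M + Z'); rewrite map_mxD map_mx1.
move=> p q; rewrite conj_cev // mxE mulrC summxE mulr_suml; apply: integral_sum => a _.
rewrite summxE mulr_suml; apply: integral_sum => b _; rewrite mxE.
have -> : map_mx (j \o iB) (e a) *m map_mx j (h - 1%:M) *m map_mx (j \o iB) (e b)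
    = map_mx j (E a *m (h - 1%:M) *m E b) by rewrite !map_mxM /E -!map_mx_comp.
have [u Hu] := blocks a b p q; rewrite [map_mx j _ _ _]mxE Hu rmorphM rmorphXn.
have -> : j xi ^+ cwt a b * (j xi ^+ maxn (b - a) 1 * j u) / j xi ^+ d
  = (j xi ^+ (cwt a b + maxn (b - a) 1) / j xi ^+ d) * j u by rewrite exprD; ring.
have [v vE] : exists v, (cwt a b + maxn (b - a) 1 = v + d)%N.
  exists (cwt a b + maxn (b - a) 1 - d)%N; rewrite subnK // /cwt.
  by have := ltn_ord a; have := ltn_ord b; lia.
rewrite vE exprD mulfK ?expf_neq0 //.
by exists (xi ^+ v * u); rewrite rmorphM rmorphXn.
Qed.

End Minuscule.

(** * Comparison of the two filtrations *)

Section HNStep.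
Context (k : fieldType) (m : nat).
Context (deg1 deg2 : {vspace 'cV[k]_m} -> {vspace 'cV[k]_m} -> int).
Hypothesis deg12 : forall U W, (U <= W)%VS -> deg1 U W = deg2 U W.

Lemma slope_eq U W : (U <= W)%VS -> slope deg1 U W = slope deg2 U W.
Proof. by move=> UW; rewrite /slope deg12. Qed.

Lemma semistable_sub U W : (U <= W)%VS -> semistable deg1 U W -> semistable deg2 U W.
Proof.
move=> UW ss W' UW' neq W'W; rewrite -!slope_eq //; exact: ss.
Qed.

Lemma HN_flag_sub l E : is_HN_flag deg1 l E -> is_HN_flag deg2 l E.
Proof.
move=> [E0 El st sl]; split=> // [q ql|q ql].
  by have [s1 s2 s3] := st q ql; split=> //; apply: semistable_sub.
have [s1 _ _] := st q.+1 ql; have [s2 _ _] := st q (ltnW ql).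
by rewrite -!slope_eq // sl.
Qed.

Lemma HN_step_sub a : HN_step deg1 a `<=` HN_step deg2 a.
Proof.
move=> v [l [E [q [HE ql sl vq]]]]; exists l, E, q; split=> //; first exact: HN_flag_sub.
move=> s sq; have [_ _ st _] := HE; have [s1 _ _] := st s (leq_trans sq ql).
by rewrite -slope_eq // sl.
Qed.

End HNStep.

(** Along a flag, slopes and semistability evaluate the degree on nested pairs only. *)
Lemma HN_step_eq (k : fieldType) (m : nat)
    (deg1 deg2 : {vspace 'cV[k]_m} -> {vspace 'cV[k]_m} -> int) :
  (forall U W, (U <= W)%VS -> deg1 U W = deg2 U W) -> HN_step deg1 = HN_step deg2.
Proof.
move=> H; apply/funext => a; apply/seteqP; split; apply: HN_step_sub => //.
by move=> U W UW; rewrite H.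
Qed.

Lemma grading_mull (R : comUnitRingType) n d (e : 'I_d -> 'M[R]_n) (Gr : grading e) N t b :
  e b *m (t ^- N *: \sum_(a < d) t ^+ a *: e a) = (t ^- N * t ^+ b) *: e b.
Proof.
have [O _] := Gr; rewrite -scalemxAr mulmx_sumr (bigD1 b) //= big1 ?addr0.
  by rewrite -scalemxAr O eqxx scalerA.
by move=> a ab; rewrite -scalemxAr O eq_sym (negPf ab) scaler0.
Qed.

Lemma grading_mulr (R : comUnitRingType) n d (e : 'I_d -> 'M[R]_n) (Gr : grading e) N t b :
  (t ^- N *: \sum_(a < d) t ^+ a *: e a) *m e b = (t ^- N * t ^+ b) *: e b.
Proof.
have [O _] := Gr; rewrite -scalemxAl mulmx_suml (bigD1 b) //= big1 ?addr0.
  by rewrite -scalemxAl O eqxx scalerA.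
by move=> a ab; rewrite -scalemxAl O (negPf ab) scaler0.
Qed.

Lemma grading_conj (R : comUnitRingType) n d (e : 'I_d -> 'M[R]_n) (A : 'M[R]_n) :
  grading e -> A \in unitmx -> grading (fun q => A *m e q *m invmx A).
Proof.
move=> [O S] U; split=> [q l|].
  rewrite !mulmxA mulmxKV // -[A *m e q *m e l]mulmxA O; case: eqP => // _.
  by rewrite mulmx0 mul0mx.
by rewrite -mulmx_suml -mulmx_sumr S mulmx1 mulmxV.
Qed.

Lemma vspace_ofP (C : fieldType) m (S : set 'cV[C]_m) (I : finType) (Q : pred I)
    (A : I -> 'M[C]_m) :
  S = [set v | forall q, Q q -> A q *m v = 0] -> forall v, v \in vspace_of S <-> S v.
Proof.
move=> SE; have : [set v | v \in vspace_of S] = S.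
  apply: (@xgetI _ 0%VS [set W : {vspace 'cV[C]_m} | [set v | v \in W] = S]
    (\bigcap_(q | Q q) lker (linfun (mulmx (A q))))%VS).
  rewrite /= SE; apply/seteqP; split=> v /=.
    move=> Hv q Qq; have sub : (\bigcap_(q | Q q) lker (linfun (mulmx (A q)))
        <= lker (linfun (mulmx (A q) : 'cV[C]_m -> 'cV[C]_m)))%VS by apply: (bigcapv_inf q).
    by have := subvP sub v Hv; rewrite memv_ker lfunE => /eqP.
  move=> Hv; rewrite memvE; apply/subv_bigcapP => q Qq.
  by rewrite -memvE memv_ker lfunE /= Hv.
by move=> E v; rewrite -[in X in _ <-> X]E.
Qed.

Section Cosets.
Context (k : fieldType) (n : nat) (G : linear_group k n).
Context (Bp : idomainType) (f : {rmorphism k -> Bp}) (B : fieldType) (j : {rmorphism Bp -> B}).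

Lemma gr_coset_refl A : gr_coset G f j A A.
Proof. by exists 1%:M; [apply: points_1|rewrite map_mx1 mulmx1]. Qed.

Lemma gr_coset_mul A h : points G f h -> gr_coset G f j (A *m map_mx j h) = gr_coset G f j A.
Proof.
move=> Gh; have [U _] := Gh; apply/seteqP; split=> _ [h' Gh' <-].
  by exists (h *m h'); [apply: points_mul|rewrite map_mxM mulmxA].
exists (invmx h *m h'); first by apply: points_mul => //; apply: points_inv.
by rewrite map_mxM map_mx_inv // !mulmxA mulmxK // map_mx_unit.
Qed.

Lemma x_latticeP (r : rep G) A v : points G (j \o f) A ->
  x_lattice j f (gr_coset G f j A) r v <-> exists w, v = rho r (j \o f) A *m map_mx j w.
Proof.
move=> GA; split=> [[_ [w [[h Gh <-] ->]]]|[w ->]].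
  exists (rho r f h *m w); rewrite rhoM //; last exact: points_map.
  by rewrite map_mxM rho_map ?mulmxA //; case: Gh.
by exists A, w; split=> //; apply: gr_coset_refl.
Qed.

End Cosets.

(** * Block triangularity of the parabolic of [mu] *)

Section PMu.
Context (k K C : fieldType) (n : nat) (G : linear_group k n) (i : {rmorphism k -> K}).
Context (mu : cochar G i) (r : rep G) (h : {rmorphism K -> C}).
Context (N d : nat) (e : 'I_d -> 'M[K]_(rdim r)).
Hypothesis D : diagonalizes (fun R f t => rho r (f \o i) (cev mu f t)) N e.
Hypothesis charC : forall m, (m.+1)%:R != 0 :> C.
Let p a := map_mx h (e a).

Lemma P_mu1 : P_mu mu h 1%:M.
Proof.
split; first exact: (points_1 G (h \o i)).
exists 1%:M => R f t /=.
have -> : map_mx (fun q => (map_poly f q).[t]) 1%:M = 1%:M :> 'M[R]_n.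
  apply/matrixP => a b; rewrite !mxE; case: (a == b) => /=; first by rewrite rmorph1 hornerC.
  by rewrite rmorph0 horner0.
split=> [|Ut]; first exact: (points_1 G (f \o h \o i)).
have [U _] := cev_points mu (f \o h) Ut.
by rewrite map_mx1 mulmx1 mulmxV.
Qed.

(** The limit [Lm] gives a point of [G] over [C[X]] at [t = 'X], although ['X] is not a unit, so
    [rho] of it is a polynomial matrix. Comparing it with conjugation at the positive integers
    yields [X^b Y = X^a Z] with [Y] polynomial and [Z] the constant block in question; as [a < b],
    the coefficient of [X^a] shows that [Z] is 0. *)
Lemma P_mu_low q (a b : 'I_d) : P_mu mu h q -> (a < b)%N ->
  p a *m rho r (h \o i) q *m p b = 0.
Proof.
move=> [Gq [Lm HL]] ab; have Gp := grading_map h D.1.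
have [] := HL {poly C} polyC 'X; set LX := map_mx _ Lm => GLX _.
pose M := rho r (polyC \o h \o i) LX.
have Ml l : map_mx (horner_eval (l.+1)%:R) M *m rho r (h \o i) (cev mu h (l.+1)%:R)
    = rho r (h \o i) (cev mu h (l.+1)%:R) *m rho r (h \o i) q.
  have Ul : ((l.+1)%:R : C) \is a GRing.unit by rewrite unitfE.
  have [] := HL C idfun (l.+1)%:R; set Ll := map_mx _ Lm => GLl /(_ Ul) LlE.
  have Gc := cev_points mu h Ul; have [Uc _] := Gc.
  rewrite -rhoM //.
  have <- : Ll *m cev mu h (l.+1)%:R = cev mu h (l.+1)%:R *m q.
    by rewrite LlE map_mx_id // mulmxKV.
  rewrite rhoM //; congr (_ *m _); rewrite /M (rho_map _ _ (polyC \o h \o i)) //; last by case: GLX.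
  have -> : map_mx (horner_eval (l.+1)%:R) LX = Ll.
    apply/matrixP => a' b'; rewrite !mxE /= horner_evalE map_poly_id //.
    by rewrite (_ : (Lm a' b')^:P.['X] = Lm a' b') //; apply: comp_polyXr.
  by congr (rho r _ Ll); apply/funext => c /=; rewrite horner_evalE hornerC.
set X := p a *m _ *m p b.
pose Y := map_mx polyC (p a) *m M *m map_mx polyC (p b).
have YE l : (l.+1)%:R ^+ b *: map_mx (horner_eval (l.+1)%:R) Y = (l.+1)%:R ^+ a *: X.
  set t : C := (l.+1)%:R; have Ul : t \is a GRing.unit by rewrite unitfE; apply: charC.
  have evC (Z : 'M[C]_(rdim r)) : map_mx (horner_eval t) (map_mx polyC Z) = Z.
    by apply/matrixP => a' b'; rewrite !mxE /= horner_evalE hornerC.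
  have E : rho r (h \o i) (cev mu h t) = t ^- N *: \sum_(q < d) t ^+ q *: p q by apply: D.2.
  have := congr1 (fun Z => p a *m Z *m p b) (Ml l); rewrite /= -/t E.
  rewrite !mulmxA grading_mull // -[_ *m (_ *: _) *m _]mulmxA grading_mulr //.
  rewrite -scalemxAr -!scalemxAl -!scalerA /Y !map_mxM !evC => /(scalerI _); apply.
  by rewrite invr_eq0 expf_neq0 //; apply: charC.
apply/matrixP => u v; rewrite [RHS]mxE.
have Q0 : 'X^b * Y u v - 'X^a * (X u v)%:P = 0.
  apply: (poly_nat_eq0 charC) => l; rewrite hornerD hornerN !hornerM !hornerXn hornerC.
  have /matrixP /(_ u v) := YE l; rewrite !mxE => ->.
  by rewrite subrr.
have := congr1 (fun q : {poly C} => q`_a) Q0.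
rewrite coefB coefXnM ab coefXnM ltnn subnn coefC eqxx sub0r coef0 => /eqP.
by rewrite oppr_eq0 => /eqP.
Qed.

End PMu.

(** * Lattice and flag filtration in terms of the same projectors *)

Section Comparison.
Context (k K : fieldType) (C : closedFieldType) (n : nat) (G : linear_group k n)
  (i : {rmorphism k -> K}) (mu : cochar G i).
Context (Bp : idomainType) (th : {rmorphism Bp -> C}) (xi : Bp).
Context (B : fieldType) (j : {rmorphism Bp -> B}).
Context (iC : {rmorphism K -> C}) (iB : {rmorphism K -> Bp}).
Hypothesis xi0 : xi != 0.
Hypothesis th_ker : forall b, (th b = 0) <-> (exists c, b = xi * c).
Hypothesis jI : injective j.
Hypothesis charK : forall m, (m.+1)%:R != 0 :> K.
Hypothesis thB : forall z, th (iB z) = iC z.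
Context (s : {rmorphism C -> Bp}).
Hypothesis ths : forall c, th (s c) = c.
Hypothesis sB : forall z, s (iC z) = iB z.

Let J : {rmorphism C -> B} := (j \o s : {rmorphism C -> B}).

Let jx0 : j xi != 0. Proof. by rewrite -(rmorph0 j) (inj_eq jI). Qed.
Let Ux : j xi \is a GRing.unit. Proof. by rewrite unitfE. Qed.
Let UxV : (j xi)^-1 \is a GRing.unit. Proof. by rewrite unitrV. Qed.
Let xiN : xi \isn't a GRing.unit.
Proof.
apply/negP => /(rmorph_unit th); rewrite unitfE (_ : th xi = 0) ?eqxx //.
by apply/th_ker; exists 1; rewrite mulr1.
Qed.
Let charC m : (m.+1)%:R != 0 :> C. Proof. exact: (char0_rmorph iC charK). Qed.

Let thBE : th \o iB = iC :> (K -> C). Proof. exact/funext. Qed.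

Context (g0 : 'M[C]_n) (x : set 'M[B]_n).
Hypothesis Gg0 : points G (iC \o i) g0.
Hypothesis xE : x = gr_coset G (iB \o i) j (map_mx (j \o s) g0 *m cev mu (j \o iB) (j xi)^-1).

Section OneRep.
Context (r : rep G) (N d : nat) (e : 'I_d -> 'M[K]_(rdim r)).
Hypothesis D : diagonalizes (fun R f t => rho r (f \o i) (cev mu f t)) N e.

Let p (q : 'I_d) : 'M[C]_(rdim r) := map_mx iC (e q).
Let R0 : 'M[C]_(rdim r) := rho r (iC \o i) g0.
Let P (q : 'I_d) : 'M[C]_(rdim r) := R0 *m p q *m invmx R0.

Let UR0 : R0 \in unitmx. Proof. exact: (rho_inv r Gg0).1. Qed.
Let Gp : grading p. Proof. exact: grading_map D.1. Qed.
Let GP : grading P. Proof. exact: grading_conj. Qed.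

Let mapJ a b (M : 'M[K]_(a, b)) : map_mx J (map_mx iC M) = map_mx (j \o iB) M.
Proof. by apply/matrixP => u v; rewrite !mxE /= sB. Qed.

Let pJ q : map_mx J (p q) = map_mx (j \o iB) (e q). Proof. exact: mapJ. Qed.

Let GpJ : grading (fun q => map_mx J (p q)). Proof. exact: grading_map Gp. Qed.

Let rhoc t : t \is a GRing.unit -> rho r (j \o (iB \o i)) (cev mu (j \o iB) t)
  = t ^- N *: \sum_(q < d) t ^+ q *: map_mx J (p q).
Proof.
move=> Ut; apply: etrans (D.2 _ (j \o iB : {rmorphism K -> B}) t Ut) _.
by congr (_ *: _); apply: eq_bigr => q _; rewrite pJ.
Qed.

Let GcV : points G (j \o (iB \o i)) (cev mu (j \o iB) (j xi)^-1).
Proof. exact: (cev_points mu (j \o iB) UxV). Qed.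

Let Gc : points G (j \o (iB \o i)) (cev mu (j \o iB) (j xi)).
Proof. exact: (cev_points mu (j \o iB) Ux). Qed.

Let sfun : s \o (iC \o i) = iB \o i :> (k -> Bp).
Proof. by apply/funext => c /=; rewrite sB. Qed.

Let Jfun : J \o (iC \o i) = j \o (iB \o i) :> (k -> B).
Proof. by apply/funext => c /=; rewrite sB. Qed.

Let GJg0 : points G (j \o (iB \o i)) (map_mx J g0).
Proof. by have := points_map J Gg0; rewrite /= Jfun. Qed.

Let rhoJ : rho r (j \o (iB \o i)) (map_mx J g0) = map_mx J R0.
Proof. by rewrite /R0 (rho_map _ J) /= ?Jfun //; case: Gg0. Qed.

Let rhocV : rho r (j \o (iB \o i)) (cev mu (j \o iB) (j xi)^-1) =
  invmx (rho r (j \o (iB \o i)) (cev mu (j \o iB) (j xi))).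
Proof. by rewrite -cevV // (rho_inv r Gc).2. Qed.

(** [rho(s(g0))] is invertible over [Bp], and [mu(xi)^-1] acts on the block of index [q] by
    [xi^-(wt N q)]. So membership in the lattice can be tested on each scaled block of [v]
    separately. *)
Lemma lattice_blocks v : x_lattice j (iB \o i) x r v <->
  forall q, exists u, j xi ^ (wt N q) *: (map_mx J (P q) *m v) = map_mx j u.
Proof.
have GA : points G (j \o (iB \o i)) (map_mx J g0 *m cev mu (j \o iB) (j xi)^-1).
  exact: points_mul.
have [_ S] := GpJ.
rewrite xE x_latticeP // rhoM // rhoJ.
have UJ := map_mx_unit J UR0.
split=> [[w ->] q|H].
  exists (map_mx s (R0 *m p q) *m w).
  rewrite /P !map_mxM map_mx_inv // !mulmxA mulmxKV // rhoc // -[_ *m map_mx J (p q) *m _]mulmxA.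
  rewrite grading_mull // -scalemxAr -scalemxAl scalerA.
  rewrite expr_exprz // -/(wt N q) exprz_inv -expfzDr // subrr expr0z scale1r.
  by rewrite -!map_mx_comp.
have /choice [u Hu] := H.
exists (map_mx s (invmx R0) *m \sum_q u q).
rewrite rhocV map_mxM -map_mx_comp -/J.
have Urc := (rho_inv r Gc).1; set M := rho r _ _ in Urc *.
suff -> : map_mx (j \o s) (invmx R0) *m map_mx j (\sum_q u q) = M *m (invmx (map_mx J R0) *m v).
  by rewrite mulmxA mulmxKV // mulKVmx.
rewrite /M rhoc // scaler_sumr mulmx_suml raddf_sum mulmx_sumr; apply: eq_bigr => q _.
rewrite /= -Hu -map_mx_inv // /P !map_mxM scalerA expr_exprz // -/(wt N q).
by rewrite -scalemxAr -scalemxAl !mulmxA -map_mxM mulVmx // map_mx1 mul1mx.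
Qed.

(* Two representatives of [x] differ by [mu(xi)^-1]-conjugates of integral
   points, which are unipotent-upper-triangular modulo [xi]. *)
Lemma coset_low g' (a b : 'I_d) : points G (iB \o i) g' ->
  x = gr_coset G (iB \o i) j (map_mx j g' *m cev mu (j \o iB) (j xi)^-1) -> (a < b)%N ->
  p a *m (invmx R0 *m rho r (iC \o i) (map_mx th g')) *m p b = 0.
Proof.
move=> Gg' xE' ab.
have [h Gh hE] : exists2 h, points G (iB \o i) h &
    map_mx J g0 *m cev mu (j \o iB) (j xi)^-1 *m map_mx j h = map_mx j g' *m cev mu (j \o iB) (j xi)^-1.
  have := gr_coset_refl G (iB \o i) j (map_mx j g' *m cev mu (j \o iB) (j xi)^-1).
  by rewrite -xE' xE => -[h Gh E]; exists h.
have Gjg' : points G (j \o (iB \o i)) (map_mx j g') := points_map j Gg'.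
have Gjh : points G (j \o (iB \o i)) (map_mx j h) := points_map j Gh.
have Ug' : g' \in unitmx by case: Gg'.
have Uh : h \in unitmx by case: Gh.
pose Gam := map_mx s (invmx R0) *m rho r (iB \o i) g'.
pose H := rho r (iB \o i) h.
have Urc := (rho_inv r Gc).1; set M := rho r _ (cev mu _ _) in Urc.
have UJ := map_mx_unit J UR0.
have GA : points G (j \o (iB \o i)) (map_mx J g0 *m cev mu (j \o iB) (j xi)^-1).
  exact: points_mul.
(* [Gam] is [rho] of [s(g0)^-1 g']. On the block [(a, b)] the relation says that [xi^b] times the
   block of [H] is [xi^a] times that of [Gam], so for [a < b] the latter is divisible by [xi]. *)
have HM : map_mx j H *m M = M *m map_mx j Gam.
  have := congr1 (rho r (j \o (iB \o i))) hE; rewrite !rhoM // rhoJ rhocV -/M.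
  rewrite -!(rho_map _ j) // -/H => E.
  have E1 : map_mx j (rho r (iB \o i) g') = map_mx J R0 *m invmx M *m map_mx j H *m M.
    by rewrite E mulmxKV.
  rewrite /Gam map_mxM -map_mx_comp -/J map_mx_inv // E1 !mulmxA mulmxKV //.
  by rewrite mulmxV // mul1mx.
have thG : invmx R0 *m rho r (iC \o i) (map_mx th g') = map_mx th Gam.
  rewrite /Gam map_mxM; congr (_ *m _).
    by apply/matrixP => u v; rewrite !mxE ths.
  by rewrite (rho_map _ th) //=; congr (rho r _ _); apply/funext => c /=; rewrite thB.
rewrite thG.
move: Gam HM {thG} => Gam HM.
have pE q : p q = map_mx th (map_mx s (p q)).
  by apply/matrixP => u v; rewrite !mxE ths.
rewrite (pE a) (pE b) -!map_mxM.
have pJs q : map_mx J (p q) = map_mx j (map_mx s (p q)) by rewrite -map_mx_comp.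
have := congr1 (fun Z => map_mx J (p a) *m Z *m map_mx J (p b)) HM.
rewrite /= /M rhoc // !mulmxA grading_mull // -[_ *m (_ *: _) *m _]mulmxA grading_mulr //.
rewrite !pJs -!scalemxAr -!scalemxAl -!map_mxM.
set Y := _ *m H *m _; set Z := _ *m Gam *m _ => /matrixP E.
apply/matrixP => u v; rewrite [LHS]mxE [RHS]mxE; apply/th_ker.
have E2 := E u v; rewrite [LHS]mxE [RHS]mxE [X in _ * X = _]mxE [X in _ = _ * X]mxE in E2.
move: E2; set y := Y u v; set z := Z u v.
rewrite -!mulrA => /(mulfI _); rewrite invr_eq0 expf_neq0 // => /(_ isT).
rewrite -!rmorphXn -!rmorphM => /jI yz.
exists (xi ^+ (b - a).-1 * y); apply: (mulfI (expf_neq0 a xi0)).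
by rewrite -yz [xi * (_ * _)]mulrA -exprS prednK ?subn_gt0 // mulrA -exprD subnKC // ltnW.
Qed.

Let V (w : int) : set 'cV[C]_(rdim r) := vge p [set q | w <= wt N q].

Let weight_sumV w : weight_sum r mu iC [set w' | w <= w'] = V w.
Proof.
apply/funext => v; apply/propext; rewrite (weight_sumP D iC charC); split=> H q /=.
  by move/H.
exact: H.
Qed.

Let V_up w (a b : 'I_d) : (a <= b)%N -> (w <= wt N a) -> (w <= wt N b).
Proof. by rewrite /wt => ab; lia. Qed.

(** Two arbitrary choices intervene: the representative [g'] of [x] made by [BB] and the element of
    its flag coset made by [flag_filtration]. They change [R0] by right multiplication with [gam]
    and [rho(q)], which both preserve the weight filtration [V w]. *)
Lemma flag_filtration_blocks w v :
  v \in flag_filtration mu iC (BB mu th xi iB j x) r w <->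
  forall q, wt N q < w -> P q *m v = 0.
Proof.
have exBB : exists y, exists g', [/\ points G (iB \o i) g',
    x = gr_coset G (iB \o i) j (map_mx j g' *m cev mu (j \o iB) (j xi)^-1)
    & y = flag_coset mu (th \o iB) (map_mx th g')].
  eexists; exists (map_mx s g0); split; last by reflexivity.
    by have := points_map s Gg0; rewrite /= sfun.
  by rewrite xE -map_mx_comp.
have [g' [Gg' xE' yE]] := xgetPex set0 exBB; rewrite -/(BB mu th xi iB j x) in yE.
rewrite yE thBE.
have Gtg' : points G (iC \o i) (map_mx th g').
  have := points_map th Gg'; rewrite /= (_ : th \o (iB \o i) = iC \o i) //.
  by apply/funext => c /=.
have [q Pq zE] : flag_coset mu iC (map_mx th g') (xget 1%:M (flag_coset mu iC (map_mx th g'))).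
  apply: xgetPex; exists (map_mx th g' *m 1%:M); exists 1%:M => //; exact: P_mu1.
rewrite /flag_filtration; set S := [set _ | _ in weight_sum _ _ _ _].
have SE : S = [set v | forall q, wt N q < w -> P q *m v = 0].
  rewrite /S -zE weight_sumV rhoM //; last by case: Pq.
  have Uq : rho r (iC \o i) q \in unitmx by case: Pq => Gq _; have [] := rho_inv r Gq.
  have Vq : [set rho r (iC \o i) q *m v | v in V w] = V w.
    apply: vge_stable => // [a b ab|a b ab /=]; last exact: V_up.
    exact: (P_mu_low D charC Pq ab).
  pose gam := invmx R0 *m rho r (iC \o i) (map_mx th g').
  have Vg : [set gam *m v | v in V w] = V w.
    apply: vge_stable => // [|a b ab|a b ab /=]; last exact: V_up.
      by rewrite unitmx_mul unitmx_inv UR0 (rho_inv r Gtg').1.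
    exact: coset_low xE' ab.
  have PV v' : (forall q, wt N q < w -> P q *m v' = 0) <-> V w (invmx R0 *m v').
    split=> H a; last first.
      by move=> aw; rewrite /P -!mulmxA H ?mulmx0 //=; apply/negP; rewrite -ltNge.
    move=> /= /negP; rewrite -ltNge => aw; have := congr1 (mulmx (invmx R0)) (H a aw).
    by rewrite /P !mulmxA mulVmx // mul1mx mulmx0.
  apply/seteqP; split=> [_ [u Vu <-]|v' /PV].
    apply/PV; rewrite !mulmxA -/gam -mulmxA -[V w]Vg; exists (rho r (iC \o i) q *m u) => //.
    by rewrite -[V w]Vq; exists u.
  move=> Vv'; have [u Vu E] : [set gam *m v | v in V w] (invmx R0 *m v') by rewrite Vg.
  have [u' Vu' uE] : [set rho r (iC \o i) q *m v | v in V w] u by rewrite Vq.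
  exists u' => //; rewrite -[RHS](mulKVmx UR0) -E -uE /gam !mulmxA mulmxV //.
  by rewrite mul1mx.
by rewrite (vspace_ofP SE) SE.
Qed.

Lemma deg_eq (U W : {vspace 'cV[k]_(rdim r)}) : (U <= W)%VS ->
  lattice_deg xi j (subquotient_lattice (j \o (iB \o i)) (x_lattice j (iB \o i) x r) U W)
  = DOR_deg (iC \o i) (flag_filtration mu iC (BB mu th xi iB j x) r) U W.
Proof.
move=> UW; rewrite -Jfun.
exact: (lattice_deg_DOR jI xi0 xiN (s := s) (iC \o i) GP lattice_blocks
  flag_filtration_blocks UW).
Qed.

End OneRep.

Lemma HN_filtration_eq : HN_filtration (G := G) xi (iB \o i) j x
  = DOR_filtration mu iC (BB mu th xi iB j x).
Proof.
apply: functional_extensionality_dep => r; have [N [d [e D]]] := rho_diagonalizes mu charK r.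
by apply: HN_step_eq => U W UW; apply: deg_eq D _ _ UW.
Qed.

End Comparison.

Theorem theorem5p1
  (R : realType) (p : nat) (p_prime : prime p)
  (Qp : fieldType) (absQp : Qp -> R) (HQp : is_Qp p absQp)
  (F : fieldExtType Qp)
  (Fbar : closedFieldType) (iF : {rmorphism F -> Fbar})
  (HFbar : forall z : Fbar, algebraicOver iF z)
  (C : closedFieldType) (absC : C -> R) (iC : {rmorphism Fbar -> C})
  (HabsC : nonarch_abs absC) (HC : abs_complete absC)
  (HabsCQp : forall z : Qp, absC (iC (iF z%:A)) = absQp z)
  (A : comNzRingType) (T : (nat -> C) -> A) (thA : {rmorphism A -> C})
  (HA : is_Ainf p absC T thA)
  (Bp : idomainType) (io : {rmorphism A -> Bp}) (th : {rmorphism Bp -> C})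
  (xi : Bp) (HBp : is_BdRplus p thA io th xi)
  (iB : {rmorphism Fbar -> Bp})
  (HiB : forall z : Fbar, th (iB z) = iC z)
  (HZp : forall z : Qp, absQp z <= 1 -> exists y : A, io y = iB (iF z%:A))
  (B : fieldType) (j : {rmorphism Bp -> B}) (HB : is_BdR xi j)
  (n : nat) (G : linear_group F n) (HG : connected_reductive G iF)
  (mu : cochar G iF)
  (x : set 'M[B]_n) (Hx : in_Gr_mu mu xi iB j x)
  (Hor : in_section_orbit mu th xi iB j x \/ minuscule mu) :
  let HN1 := HN_filtration (G := G) xi (iB \o iF) j x in
  let HN2 := DOR_filtration mu iC (BB mu th xi iB j x) in
  filtration_vector iF HN1 = filtration_vector iF HN2 /\
  (forall (S : comUnitRingType) (f : {rmorphism F -> S}),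
     filtration_parabolic HN1 f = filtration_parabolic HN2 f).
Proof.
move=> HN1 HN2; suff -> : HN1 = HN2 by [].
have charF : forall m, (m.+1)%:R != 0 :> F.
  exact: (char0_rmorph (in_alg F) (is_Qp_char0 p_prime HQp)).
have charK : forall m, (m.+1)%:R != 0 :> Fbar := char0_rmorph iF charF.
have charC : forall m, (m.+1)%:R != 0 :> C := char0_rmorph iC charK.
have xi0 := xi_neq0 HBp; have th_ker := residue_ker HBp.
have th_surj := residue_surj HBp; have compl := BdRplus_complete HBp.
have jI := HB.1.
have thF : th \o iB \o iF = iC \o iF :> (F -> C) by apply/funext => a /=; rewrite HiB.
have jx0 : j xi != 0 by rewrite -(rmorph0 j) (inj_eq jI).
have Ux : j xi \is a GRing.unit by rewrite unitfE.
suff [s [ths sB [g0 Gg0 xE]]] : exists s : {rmorphism C -> Bp},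
    [/\ forall c, th (s c) = c, forall z, s (iC z) = iB z
      & exists2 g0, points G (iC \o iF) g0 &
        x = gr_coset G (iB \o iF) j (map_mx (j \o s) g0 *m cev mu (j \o iB) (j xi)^-1)].
  exact: (HN_filtration_eq xi0 th_ker jI charK HiB ths sB Gg0 xE).
case: Hor => [[s [ths sF [g Gg xE]]]|Hmin].
  exists s; split=> // [z|]; last by exists g; rewrite // -thF.
  apply: (@section_unique _ _ _ _ iF th (s \o iC) iB charF HFbar) => [a|z'] /=.
    by rewrite -HiB sF.
  by rewrite ths HiB.
(* The image of [Fbar] is a field, so [th] is injective on it and it can serve as the starting ring;
   the section obtained then extends [iB]. *)
have [|s [ths sB]] := @residue_section _ _ th xi xi0 th_surj th_ker compl charC (range iB).
  split; first by exists 1; rewrite ?rmorph1.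
  - by move=> _ _ [a _ <-] [b _ <-]; exists (a - b); rewrite ?rmorphB.
  - by move=> _ _ [a _ <-] [b _ <-]; exists (a * b); rewrite ?rmorphM.
  - by move=> _ [a _ <-]; rewrite HiB => /eqP; rewrite fmorph_eq0 => /eqP ->; rewrite rmorph0.
have {}sB z : s (iC z) = iB z by rewrite -HiB sB //; exists z.
exists s; split=> //.
have [g Gg xE] := Hx; pose g0 := map_mx th g.
have Gg0 : points G (iC \o iF) g0 by have := points_map th Gg; rewrite /= -thF.
have sfun : s \o (iC \o iF) = iB \o iF :> (F -> Bp) by apply/funext => a /=; rewrite sB.
have Gg1 : points G (iB \o iF) (map_mx s g0) by have := points_map s Gg0; rewrite /= sfun.
pose h := invmx (map_mx s g0) *m g.
have Gh : points G (iB \o iF) h by apply: points_mul => //; apply: points_inv.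
have [U1 _] := Gg1; have [U0 _] := Gg0; have [Uh _] := Gh.
have h1 : map_mx th h = 1%:M.
  rewrite map_mxM map_mx_inv // -map_mx_comp (_ : map_mx (th \o s) g0 = g0) ?mulVmx //.
  by apply/matrixP => a b; rewrite !mxE /= ths.
have [N [d [e D]]] := cev_diagonalizes mu charK.
have [h' h'E] := minuscule_conj_integral xi0 th_ker charK Hmin D jI Gh h1.
have Gc := cev_points mu (j \o iB) Ux; have [Uc _] := Gc.
have Gh' : points G (iB \o iF) h'.
  (* Integrality gives [h'] only as a matrix over [Bp]. It is invertible since its determinant is
     that of [h], and the equations of [G] can be checked in [B]. *)
  apply: (points_inj (g := j)) => //.
    rewrite unitmxE (_ : \det h' = \det h) -?unitmxE //; apply: jI.
    rewrite -!det_map_mx -h'E !det_mulmx mulrAC -det_mulmx mulmxV // det1 mul1r //.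
  rewrite -h'E; apply: points_mul; last exact: points_inv.
  by apply: points_mul => //; apply: (points_map j Gh).
(* [x] is the coset of [s(g0) h mu(xi)^-1 = s(g0) mu(xi)^-1 h'], and the coset absorbs [h']. *)
exists g0 => //; rewrite xE -[RHS](gr_coset_mul j _ Gh'); congr (gr_coset G _ j _).
rewrite -h'E -cevV // !mulmxA mulmxKV //; congr (_ *m _).
by rewrite /h map_mxM map_mx_inv // [map_mx (j \o s) g0]map_mx_comp mulKVmx // map_mx_unit.
Qed.
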